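(* For integers $k\ge1$, the quantity $\tau_k^{*}=\lim_{n\to\infty}\tau_{n,k}$ admits the representation $$ \tau_k^*= A\,\Big(\frac{2}{e}\Big)^{k+1/2} e^{-a k^{1/3}}\,k^{-1/6}\,\Big(1 + O\big(k^{-1/6}\big)\Big), $$ where $a=2^{-1/3}|i_1|\approx 1.8558$, with $i_1$ the first zero of the Airy function, and $$ A= \left(\int_0^{\infty} e^{-\frac{x^3}{3}-2ax}\,\frac{dx}{\sqrt{\pi x}} \right)^{-1/2}\approx 1.3951 . $$
   Context: $T_n$ is the $n$-th Chebyshev polynomial of the first kind, $T_n(\cos\theta)=\cos n\theta$, and $T_n^{(k)}$ is its $k$-th derivative. For integers $k\ge1$ and $n\geq k+2$, $\omega_{n,k}$ denotes the largest (rightmost) zero of the polynomial $T_n^{(k+1)}$ (all of whose zeros are real and lie in $(-1,1)$), and $$\tau_{n,k}:=\frac{|T_n^{(k)}(\omega_{n,k})|}{T_n^{(k)}(1)}.$$ It is known (from earlier work) that for each fixed $k$ the sequence $\{\tau_{n,k}\}_{n>k+1}$ is monotonically decreasing in $n$, so the limit $\tau_k^{*}:=\lim_{n\to\infty}\tau_{n,k}$ exists. The first zero $i_1$ of the Airy function $\mathrm{Ai}$ is its (negative real) zero closest to the origin. The $O(k^{-1/6})$ term is a quantity bounded in absolute value by $Ck^{-1/6}$ with an absolute constant $C$. *)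

(* Defs.v *)
From HB Require Import structures.
From mathcomp Require Import all_boot all_order all_algebra.
From mathcomp Require Import all_classical all_reals all_analysis.

Set Implicit Arguments.
Unset Strict Implicit.
Unset Printing Implicit Defensive.

Import Order.TTheory GRing.Theory Num.Theory.
Import numFieldNormedType.Exports.

Local Open Scope classical_set_scope.
Local Open Scope ring_scope.

Section Chebyshev.
Context {R : realType}.

Fixpoint chebyT (n : nat) : {poly R} :=
  match n with
  | 0 => 1
  | n'.+1 => match n' with
             | 0 => 'X
             | m.+1 => 2%:R *: ('X * chebyT n') - chebyT m
             end
  end.

Lemma chebyT_rec n :
  chebyT n.+2 = 2%:R *: ('X * chebyT n.+1) - chebyT n.
Proof. by []. Qed.

                                                                             
Lemma chebyT_cos n (t : R) : (chebyT n).[cos t] = cos (n%:R * t).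
Proof.
suff: (chebyT n).[cos t] = cos (n%:R * t) /\
      (chebyT n.+1).[cos t] = cos (n.+1%:R * t) by case.
elim: n => [|n [IH0 IH1]].
  by rewrite /= hornerC hornerX mul0r cos0 mul1r.
split=> //; rewrite chebyT_rec hornerD hornerN hornerZ hornerM hornerX IH0 IH1.
have -> : n.+2%:R * t = n.+1%:R * t + t by rewrite -natr1 mulrDl mul1r.
have -> : n%:R * t = n.+1%:R * t - t by rewrite -natr1 mulrDl mul1r addrK.
by rewrite cosB cosD (mulrC (cos t)) mulr_natl mulr2n opprD addrACA subrr add0r.
Qed.

                                                
Definition largest_root (p : {poly R}) : R :=
  [get w : R | root p w /\ forall x, root p x -> x <= w].

Lemma largest_rootE (p : {poly R}) (w : R) :
  root p w -> (forall x, root p x -> x <= w) -> largest_root p = w.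
Proof.
move=> pw wmax; apply: get_unique; first by [].
by move=> v [pv vmax]; apply/eqP; rewrite eq_le wmax//= vmax.
Qed.

                                     
Definition omega (n k : nat) : R := largest_root (chebyT n)^`(k.+1).

Definition tau (n k : nat) : R :=
  `|(chebyT n)^`(k).[omega n k]| / (chebyT n)^`(k).[1].

Definition tau_star (k : nat) : R := lim (tau n k @[n --> \oo]).

End Chebyshev.

Section Airy.
Context {R : realType}.

                                                                      
                                                                             
Definition Ai (x : R) : R :=
  pi^-1 * lim (\int[lebesgue_measure]_(t in `[0, M]) cos (t ^+ 3 / 3%:R + x * t)
               @[M --> +oo]).

                                                    
Definition airy_zero1 : R :=
  [get x : R | [/\ x < 0, Ai x = 0 &
            forall y, y < 0 -> Ai y = 0 -> `|x| <= `|y|]].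

Definition a_const : R := 2%:R `^ (- (1 / 3%:R)) * `|airy_zero1|.

Definition A_const : R :=
  (\int[lebesgue_measure]_(x in `]0, +oo[)
     (expR (- (x ^+ 3 / 3%:R) - 2%:R * a_const * x) / Num.sqrt (pi * x)))
  `^ (- (1 / 2%:R)).

End Airy.

(* Main.v *)
(** At the scale x = 1 - y/(2n^2) the functions T_n^(k)(x)/T_n^(k)(1) converge to
    0F1(; k+1/2; -y/4), so tau_k^* is the absolute value of this function at the
    first zero z of 0F1(; k+3/2; -y/4).  Put b = k+1/2.  Both functions solve
    spherical Bessel equations, whose modulus y^k |x h_k(x)|^2 (y = x^2) is a
    polynomial S with positive coefficients, and a first integral of the system
    gives tau_k^*^2 = c_k/S(z) with c_k = ((2k-1)!!)^2.

    Sturm comparison with V(s) = Ai(-2^(1/3) s) (up to a factor), which solves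
    V'' = -2sV and has first zero a, locates the zero:
    ln z = 2 ln b + 2a b^(-2/3) + O(b^(-4/3)).  Then S(z)/z^k is a Riemann sum of
    mesh b^(-2/3) for the integral of exp(-x^3/3-2ax)/sqrt(pi x), where sqrt(pi x)
    comes from the Wallis product, and c_k is estimated by Stirling's formula, whose
    constant cancels.

    The function V is the combination of the two series solutions that stays
    positive and increasing on s <= 0, which encloses its slope at 0 and hence a;
    A is enclosed by integrating Taylor polynomials of the exponential.  Both
    enclosures use interval arithmetic on binary integers. *)
From HB Require Import structures.
Require Import Defs.
From mathcomp Require Import all_boot all_order all_algebra.
From mathcomp Require Import all_classical all_reals all_analysis.
From Stdlib Require Import ZArith.
From mathcomp Require Import ring lra zify ssrZ.

Import Order.TTheory GRing.Theory Num.Theory.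
Import numFieldNormedType.Exports.
Local Open Scope ring_scope.
(* ZArith rebinds the key N to binary naturals. *)
Delimit Scope nat_scope with N.

(** * Calculus *)

Section Calculus.
Context {R : realType}.
Implicit Types (f g df : R -> R) (x a b c : R).

(** The zero enters as [z ^+ k], so ln z is needed up to o(1/k). No turning-point expansion is used:
    one Airy solution is compared in two coordinates whose potentials have opposite curvature. With
    x = e^t the potential e^(2t) - b^2 is convex, above its tangent at the turning point, and the
    zero comes early; in x itself 1 - k(k+1)/x^2 is concave, below its tangent, and the zero comes
    late. Both estimates agree to the order needed. Counted from the leading coefficient, the m-th
    term of S(z)/z^k is a Wallis factor times a product of factors (b^2 - (i+1/2)^2)/z. At x = m
    b^(-2/3) the logarithm of the product is about -2ax - x^3/3: the linear part is the displacement
    of z from b^2, the cubic part the sum of the squares. Ai is given only as an improper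
    oscillatory integral. The truncated integral solves an inhomogeneous Airy equation, which ties
    it to the power series; a bound 1/x for x > 0 singles it out among the solutions. The errors met
    are O(k^(-1/3)), within the O(k^(-1/6)) of the statement. *)

Lemma dv_eq f x a b : is_derive x (1 : R) f a -> a = b -> is_derive x (1 : R) f b.
Proof. by move=> ? <-. Qed.

Lemma dv_ext f g x a : f =1 g -> is_derive x (1 : R) g a -> is_derive x (1 : R) f a.
Proof. by move=> /funext ->. Qed.

Lemma dv_cst c x : is_derive x (1 : R) (fun=> c) 0.
Proof. exact: is_derive_cst. Qed.

Lemma dv_id x : is_derive x (1 : R) (fun y => y) 1.
Proof. exact: is_derive_id. Qed.

Lemma dvD f g x a b : is_derive x (1 : R) f a -> is_derive x (1 : R) g b ->
  is_derive x (1 : R) (fun y => f y + g y) (a + b).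
Proof. exact: is_deriveD. Qed.

Lemma dvB f g x a b : is_derive x (1 : R) f a -> is_derive x (1 : R) g b ->
  is_derive x (1 : R) (fun y => f y - g y) (a - b).
Proof. exact: is_deriveB. Qed.

Lemma dvN f x a : is_derive x (1 : R) f a ->
  is_derive x (1 : R) (fun y => - f y) (- a).
Proof. exact: is_deriveN. Qed.

Lemma dvM f g x a b : is_derive x (1 : R) f a -> is_derive x (1 : R) g b ->
  is_derive x (1 : R) (fun y => f y * g y) (a * g x + f x * b).
Proof.
move=> hf hg; have H := is_deriveM hf hg; apply: (dv_eq _ _ _ _ H).
by rewrite /GRing.scale /= addrC (mulrC a).
Qed.

Lemma dvX f n x a : is_derive x (1 : R) f a ->
  is_derive x (1 : R) (fun y => f y ^+ n) (n%:R * f x ^+ n.-1 * a).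
Proof.
move=> hf; elim: n => [|n IH].
  by rewrite !mul0r; apply: dv_ext (dv_cst 1 x) => y; rewrite expr0.
have e : (fun y => f y ^+ n.+1) = (fun y => f y * f y ^+ n).
  by apply/funext => y; rewrite exprS.
rewrite e; apply: (dv_eq _ _ _ _ (dvM _ _ _ _ _ hf IH)).
case: n {IH e} => [|n]; first by rewrite /= !expr0 mul0r mul0r mulr0 addr0 !mulr1 mul1r.
by rewrite /= exprS -[n.+2%:R]natr1; ring.
Qed.

Lemma dv_comp f g x a b : is_derive (g x) (1 : R) f a -> is_derive x (1 : R) g b ->
  is_derive x (1 : R) (fun y => f (g y)) (a * b).
Proof. by move=> hf hg; apply: is_derive1_comp. Qed.

Lemma dvV f x a : f x != 0 -> is_derive x (1 : R) f a ->
  is_derive x (1 : R) (fun y => (f y)^-1) (- a / f x ^+ 2).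
Proof.
move=> f0 hf; have H := is_deriveV f0 hf; apply: (dv_eq _ _ _ _ H).
by rewrite /GRing.scale /= mulNr mulrC mulNr.
Qed.

Lemma dv_expR f x a : is_derive x (1 : R) f a ->
  is_derive x (1 : R) (fun y => expR (f y)) (expR (f x) * a).
Proof. by move=> hf; apply: dv_comp => //; apply: is_derive_expR. Qed.

Lemma dv_sin f x a : is_derive x (1 : R) f a ->
  is_derive x (1 : R) (fun y => sin (f y)) (cos (f x) * a).
Proof. by move=> hf; apply: dv_comp => //; apply: is_derive_sin. Qed.

Lemma dv_cos f x a : is_derive x (1 : R) f a ->
  is_derive x (1 : R) (fun y => cos (f y)) (- sin (f x) * a).
Proof. by move=> hf; apply: dv_comp => //; apply: is_derive_cos. Qed.

Lemma dv_ln f x a : 0 < f x -> is_derive x (1 : R) f a ->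
  is_derive x (1 : R) (fun y => ln (f y)) ((f x)^-1 * a).
Proof. by move=> f0 hf; apply: dv_comp => //; apply: is_derive1_ln. Qed.

Lemma dv_sqrt f x a : 0 < f x -> is_derive x (1 : R) f a ->
  is_derive x (1 : R) (fun y => Num.sqrt (f y)) ((2 * Num.sqrt (f x))^-1 * a).
Proof. by move=> f0 hf; apply: dv_comp => //; apply: is_derive1_sqrt. Qed.

Lemma dv_continuous f x a : is_derive x (1 : R) f a -> {for x, continuous f}.
Proof.
by move=> [df _]; apply/differentiable_continuous/derivable1_diffP.
Qed.

Lemma mean_value f df a b : a < b ->
  (forall x, a <= x <= b -> is_derive x (1 : R) f (df x)) ->
  exists2 c, a < c < b & f b - f a = df c * (b - a).
Proof.
move=> ab dvf.
have [| |c cab ->] := @MVT R f df a b ab.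
- by move=> x /[!in_itv]/= /andP[ax xb]; apply: dvf; rewrite !ltW.
- apply: derivable_within_continuous => x; rewrite in_itv/= => xab.
  by have [] := dvf _ xab.
by exists c => //; move: cab; rewrite in_itv.
Qed.

Lemma nondecreasing_dv f df a b : a <= b ->
  (forall x, a <= x <= b -> is_derive x (1 : R) f (df x)) ->
  (forall x, a < x < b -> 0 <= df x) -> f a <= f b.
Proof.
rewrite le_eqVlt => /predU1P[-> //|ab] dvf df0.
have [c cab e] := mean_value _ _ _ _ ab dvf.
by rewrite -subr_ge0 e mulr_ge0 ?df0// subr_ge0 ltW.
Qed.

Lemma increasing_dv f df a b : a < b ->
  (forall x, a <= x <= b -> is_derive x (1 : R) f (df x)) ->
  (forall x, a < x < b -> 0 < df x) -> f a < f b.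
Proof.
move=> ab dvf df0.
have [c cab e] := mean_value _ _ _ _ ab dvf.
by rewrite -subr_gt0 e mulr_gt0 ?df0// subr_gt0.
Qed.

Lemma dv_increment_le f g df dg a b : a <= b ->
  (forall x, a <= x <= b -> is_derive x (1 : R) f (df x)) ->
  (forall x, a <= x <= b -> is_derive x (1 : R) g (dg x)) ->
  (forall x, a < x < b -> df x <= dg x) -> f b - f a <= g b - g a.
Proof.
move=> ab dvf dvg dfg.
rewrite -subr_ge0.
have -> : g b - g a - (f b - f a) = (g b - f b) - (g a - f a) by ring.
rewrite subr_ge0.
apply: (@nondecreasing_dv (fun x => g x - f x) (fun x => dg x - df x)) => // x xab.
  by apply: dvB; [exact: dvg|exact: dvf].
by rewrite subr_ge0; exact: dfg.
Qed.

Lemma dv_increment_norm_le f g df dg a b : a <= b ->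
  (forall x, a <= x <= b -> is_derive x (1 : R) f (df x)) ->
  (forall x, a <= x <= b -> is_derive x (1 : R) g (dg x)) ->
  (forall x, a < x < b -> `|df x| <= dg x) -> `|f b - f a| <= g b - g a.
Proof.
move=> ab dvf dvg dfg; rewrite ler_norml; apply/andP; split; last first.
  apply: (@dv_increment_le f g df dg) => // x /dfg; exact: le_trans (ler_norm _).
rewrite lerNl opprB.
have -> : f a - f b = (- f b) - (- f a) by ring.
apply: (@dv_increment_le (fun x => - f x) g (fun x => - df x) dg) => //.
  by move=> x /dvf; exact: dvN.
by move=> x /dfg; apply: le_trans; rewrite -normrN ler_norm.
Qed.

Lemma dv_cst_eq f a b :
  (forall x, a <= x <= b -> is_derive x (1 : R) f 0) -> a <= b -> f a = f b.
Proof.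
move=> dvf ab; apply/eqP; rewrite eq_le; apply/andP; split.
  exact: (@nondecreasing_dv f (fun=> 0)).
rewrite -lerN2; apply: (@nondecreasing_dv (fun x => - f x) (fun=> 0)) => // x /dvf.
by move=> /dvN; rewrite oppr0.
Qed.

(** The infimum of the points where [f] is nonpositive works: a nearby such point excludes
    [0 < f z], and positivity before [z] excludes [f z < 0]. *)
Lemma first_zero f a b : a <= b ->
  (forall x, a <= x <= b -> {for x, continuous f}) -> 0 < f a -> f b <= 0 ->
  exists z, [/\ a < z, z <= b, f z = 0 & forall x, a <= x < z -> 0 < f x].
Proof.
move=> ab cf fa fb.
pose E := [set x | a <= x <= b /\ f x <= 0]%classic.
have hE : has_inf E.
  split; first by exists b; split => //; rewrite ab lexx.
  by exists a => x [/andP[]].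
pose z := inf E.
have az : a <= z by apply: lb_le_inf; [case: hE|move=> x [/andP[]]].
have zb : z <= b by apply: ge_inf => //; [case: hE|split => //; rewrite ab lexx].
have pos x : a <= x < z -> 0 < f x.
  move=> /andP[ax xz]; rewrite ltNge; apply/negP => fx.
  have : z <= x.
    by apply: ge_inf; [case: hE|split => //; rewrite ax (le_trans (ltW xz))].
  by rewrite leNgt xz.
have cz : {for z, continuous f} by apply: cf; rewrite az zb.
have fz_le0 : f z <= 0.
  rewrite leNgt; apply/negP => fz.
  have : \forall y \near z, 0 < f y by exact: (cvgr_gt _ cz).
  move=> [e /= e0 he].
  have [x xE xz] := inf_adherent e0 hE.
  have zx : z <= x by apply: ge_inf; [case: hE|].
  have := he x; rewrite /= ler0_norm ?subr_le0// opprB ltrBlDl => /(_ xz).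
  by rewrite ltNge (proj2 xE).
have az' : a < z.
  rewrite lt_neqAle az andbT; apply/eqP => e; move: fz_le0; rewrite -e.
  by rewrite leNgt fa.
exists z; split => //; apply/eqP; rewrite eq_le fz_le0 /= leNgt; apply/negP => fz.
have : \forall y \near z, f y < 0 by exact: (cvgr_lt _ cz).
move=> [e /= e0 he].
pose y := Num.max a (z - e / 2).
have yz : y < z by rewrite gt_max az' /= ltrBlDr ltrDl divr_gt0.
have : 0 < f y by apply: pos; rewrite yz le_max lexx.
have := he y; rewrite /= ger0_norm ?subr_ge0 ?(ltW yz)// => hy.
rewrite ltNge ltW// hy//.
have : z - e / 2 <= y by rewrite le_max lexx orbT.
lra.
Qed.

End Calculus.

Ltac dv_step := lazymatch goal with
  | |- is_derive _ _ (fun _ => ?c) _ => notypeclasses refine (dv_cst c _)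
  | |- is_derive _ _ (fun y => y) _ => notypeclasses refine (dv_id _)
  | |- is_derive _ _ (fun y => @?f y - @?g y) _ =>
      notypeclasses refine (@dvB _ f g _ _ _ _ _)
  | |- is_derive _ _ (fun y => @?f y + @?g y) _ =>
      notypeclasses refine (@dvD _ f g _ _ _ _ _)
  | |- is_derive _ _ (fun y => - @?f y) _ => notypeclasses refine (@dvN _ f _ _ _)
  | |- is_derive _ _ (fun y => @?f y * @?g y) _ =>
      notypeclasses refine (@dvM _ f g _ _ _ _ _)
  | |- is_derive _ _ (fun y => @?f y ^+ ?n) _ =>
      notypeclasses refine (@dvX _ f n _ _ _)
  | |- is_derive _ _ (fun y => (@?f y)^-1) _ =>
      notypeclasses refine (@dvV _ f _ _ _ _)
  | |- is_derive _ _ (fun y => expR (@?f y)) _ =>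
      notypeclasses refine (@dv_expR _ f _ _ _)
  | |- is_derive _ _ (fun y => sin (@?f y)) _ =>
      notypeclasses refine (@dv_sin _ f _ _ _)
  | |- is_derive _ _ (fun y => cos (@?f y)) _ =>
      notypeclasses refine (@dv_cos _ f _ _ _)
  | |- is_derive _ _ (fun y => ln (@?f y)) _ =>
      notypeclasses refine (@dv_ln _ f _ _ _ _)
  | |- is_derive _ _ (fun y => Num.sqrt (@?f y)) _ =>
      notypeclasses refine (@dv_sqrt _ f _ _ _ _)
  | |- is_derive _ _ (fun y => ?h y) _ => change (fun y => h y) with h
  | |- is_derive _ _ (fun y => ?h (@?f y)) _ =>
      notypeclasses refine (@dv_comp _ h f _ _ _ _ _)
  end.

Ltac dv_hyp := match goal with
  | H : is_derive ?x _ ?f _ |- is_derive ?x _ ?f _ => exact H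
  | H : forall z, is_derive z _ ?f _ |- is_derive _ _ ?f _ => exact (H _)
  end.

(* Differentiates the head structure; derivatives of other functions are
   looked up in the context. *)
Ltac dv := notypeclasses refine (dv_eq _ _ _ _ _ _);
  [repeat (cbv beta; first [dv_hyp | dv_step])|cbv beta].

(** * The function 0F1 *)

Section Hypergeometric01.
Local Open Scope classical_set_scope.
Context {R : realType}.
Implicit Types (b x : R) (m n N : nat).

Definition h01_coef b m : R := (m`!%:R * \prod_(i < m) (b + i%:R))^-1.

(* The hypergeometric function 0F1(; b; x). *)
Definition h01 b x : R := limn (pseries (h01_coef b) x).

Lemma h01_coef0 b : h01_coef b 0 = 1.
Proof. by rewrite /h01_coef fact0 big_ord0 mulr1 invr1. Qed.

Lemma h01_coefS b m :
  h01_coef b m.+1 = h01_coef b m / (m.+1%:R * (b + m%:R)).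
Proof.
rewrite /h01_coef factS natrM big_ord_recr /= -invfM; congr (_^-1); ring.
Qed.

Lemma h01_coef_gt0 b m : 0 < b -> 0 < h01_coef b m.
Proof.
move=> b0; rewrite invr_gt0 mulr_gt0 ?ltr0n ?fact_gt0//.
by apply: prodr_gt0 => i _; rewrite ltr_wpDr.
Qed.

Lemma h01_coef_shift b m : 0 < b ->
  h01_coef b m.+1 * m.+1%:R = h01_coef (b + 1) m / b.
Proof.
move=> b0; elim: m => [|m IH].
  by rewrite h01_coefS !h01_coef0 addr0 !mul1r mulr1.
have m0 : m.+1%:R != 0 :> R by rewrite pnatr_eq0.
have m1 : m.+2%:R != 0 :> R by rewrite pnatr_eq0.
have bm : b + m.+1%:R != 0 by rewrite gt_eqF// ltr_wpDr.
have b1 : b != 0 by rewrite gt_eqF.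
have -> : h01_coef b m.+2 * m.+2%:R = (h01_coef b m.+1 * m.+1%:R) /
    (m.+1%:R * (b + m.+1%:R)).
  rewrite h01_coefS; move: m0 m1 bm; move: m.+1%:R m.+2%:R => u v u0 v0 bu.
  by field; rewrite bu u0 v0.
rewrite IH [in RHS]h01_coefS.
have -> : b + 1 + m%:R = b + m.+1%:R by rewrite -[m.+1%:R]natr1; ring.
by rewrite -!mulrA; congr (_ * _); rewrite mulrC.
Qed.

(** Comparison with the exponential series: in b (b + 1) ... (b + m - 1) every factor after the
    first is at least 1, so only [b^-1] is lost, and the summand 1 covers [m = 0]. *)
Lemma h01_coef_le b m : 0 < b -> h01_coef b m <= (1 + b^-1) / m`!%:R.
Proof.
move=> b0; rewrite /h01_coef invfM mulrC ler_pM2r ?invr_gt0 ?ltr0n ?fact_gt0//.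
case: m => [|m]; first by rewrite big_ord0 invr1 lerDl invr_ge0 ltW.
rewrite big_ord_recl /= addr0 invfM.
have : \prod_(i < m) (b + (bump 0 i)%:R) >= 1.
  elim/big_ind: _ => // [x y x1 y1|i _]; first exact: mulr_ege1.
  by rewrite /bump /= add1n -natr1 addrA lerDr addr_ge0// ltW.
move=> h; have p0 : 0 < \prod_(i < m) (b + (bump 0 i)%:R).
  exact: lt_le_trans h.
apply: (@le_trans _ _ b^-1); last by rewrite lerDr.
by rewrite ler_piMr ?invr_ge0 ?(ltW b0)// invf_le1.
Qed.

Lemma is_cvg_h01 b x : 0 < b -> cvgn (pseries (h01_coef b) x).
Proof.
move=> b0; apply: normed_cvg; rewrite /pseries.
apply: (@series_le_cvg _ _ (fun n => (1 + b^-1) *: exp_coeff `|x| n)).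
- by move=> n /=; rewrite normr_ge0.
- move=> n; rewrite /exp_coeff /= /GRing.scale /= mulr_ge0//.
    by rewrite addr_ge0// invr_ge0 ltW.
- move=> n; rewrite /= normrM normrX /exp_coeff /= /GRing.scale /= mulrCA.
  rewrite [leLHS]mulrC ler_wpM2l ?exprn_ge0//.
  by rewrite ger0_norm ?h01_coef_le// ltW// h01_coef_gt0.
- by apply: is_cvg_seriesZ; exact: is_cvg_series_exp_coeff.
Qed.

Lemma h01_diffs b : 0 < b ->
  pseries_diffs (h01_coef b) = (fun m => h01_coef (b + 1) m / b).
Proof.
by move=> b0; apply/funext => m; rewrite /pseries_diffs mulrC h01_coef_shift.
Qed.

Lemma pseriesZ (c : nat -> R) (a x : R) n :
  pseries (fun m => c m * a) x n = a * pseries c x n.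
Proof.
rewrite /pseries /series /= big_distrr /=; apply: eq_bigr => i _; ring.
Qed.

Lemma cvg_pseries_h01Z b a x : 0 < b ->
  pseries (fun m => h01_coef b m * a) x @ \oo --> a * h01 b x.
Proof.
move=> b0.
rewrite (_ : pseries _ x = fun n => a * pseries (h01_coef b) x n); last first.
  by apply/funext => n; rewrite pseriesZ.
by apply: cvgMr; exact: is_cvg_h01.
Qed.

Lemma is_derive_h01 b x : 0 < b -> is_derive x (1 : R) (h01 b) (h01 (b + 1) x / b).
Proof.
move=> b0; have b1 : 0 < b + 1 by rewrite addr_gt0.
have b2 : 0 < b + 1 + 1 by rewrite addr_gt0.
have e2 : pseries_diffs (pseries_diffs (h01_coef b)) =
    (fun m => h01_coef (b + 1 + 1) m * ((b + 1)^-1 / b)).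
  rewrite h01_diffs//; apply/funext => m.
  have := congr1 (fun f => f m) (h01_diffs _ b1).
  by rewrite /pseries_diffs /= => h; rewrite !mulrA h.
have := @pseries_snd_diffs R (h01_coef b) (`|x| + 1) x.
rewrite [`|_ + 1|]ger0_norm ?addr_ge0// ltrDl ltr01 e2 h01_diffs//.
move=> /(_ (is_cvg_h01 _ _ b0)).
move=> /(_ (cvgP _ (cvg_pseries_h01Z _ _ _ b1))).
move=> /(_ (cvgP _ (cvg_pseries_h01Z _ _ _ b2)) erefl).
have -> : h01 (b + 1) x / b = limn (pseries (fun m => h01_coef (b + 1) m / b) x).
  by rewrite mulrC; apply/esym/cvg_lim => //; exact: cvg_pseries_h01Z.
by [].
Qed.

Lemma h01_at0 b : h01 b 0 = 1.
Proof.
apply/cvg_lim => //; apply/cvgrPdist_le => e e0; near=> n.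
have n0 : (0 < n)%N by near: n; exists 1%N.
rewrite -(prednK n0) /pseries /series /= big_nat_recl//= big1_seq.
  by rewrite h01_coef0 expr0 mulr1 addr0 subrr normr0 ltW.
by move=> i _; rewrite exprS mul0r mulr0.
Unshelve. all: by end_near. Qed.

(** Compared coefficient by coefficient. Since differentiation shifts the parameter by 1, this
    relation plays the role of the differential equation: the Bessel, Airy and cosine systems below
    are derived from it. *)
Lemma h01_contiguous b x : 0 < b ->
  h01 b x = h01 (b + 1) x + x * h01 (b + 2) x / (b * (b + 1)).
Proof.
move=> b0; have b1 : 0 < b + 1 by rewrite addr_gt0.
have b2 : 0 < b + 2 by rewrite addr_gt0.
apply/cvg_lim => //; rewrite -cvg_shiftS.
rewrite (_ : (fun n => _) = fun n => pseries (h01_coef (b + 1)) x n.+1 +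
    x * ((b * (b + 1))^-1 * pseries (h01_coef (b + 2)) x n)).
  have -> : x * h01 (b + 2) x / (b * (b + 1)) =
      x * ((b * (b + 1))^-1 * h01 (b + 2) x) by ring.
  apply: cvgD; last by do 2 apply: cvgMr; exact: is_cvg_h01.
  by rewrite cvg_shiftS; exact: is_cvg_h01.
apply/funext => n; rewrite /pseries /series /= !big_nat_recl//= !big_distrr /=.
rewrite !h01_coef0 -addrA; congr (_ + _); rewrite -big_split /=.
apply: eq_bigr => i _.
have i0 : i.+1%:R != 0 :> R by rewrite pnatr_eq0.
have bN : b != 0 by rewrite gt_eqF.
have b1N : b + 1 != 0 by rewrite gt_eqF.
have e1 : h01_coef b i.+1 = h01_coef (b + 1) i / b / i.+1%:R.
  by rewrite -h01_coef_shift// mulfK.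
have e2 : h01_coef (b + 1) i.+1 = h01_coef (b + 2) i / (b + 1) / i.+1%:R.
  by rewrite (_ : b + 2 = b + 1 + 1) -?h01_coef_shift ?mulfK// -addrA.
have e3 : h01_coef (b + 1) i = h01_coef (b + 2) i * (b + 1 + i%:R) / (b + 1).
  rewrite /h01_coef; case: i {i0 e1 e2} => [|i].
    by rewrite !big_ord0 addr0 mulr1 fact0 invr1 mul1r mulfV.
  rewrite big_ord_recl big_ord_recr /= addr0.
  have -> : \prod_(j < i) (b + 1 + (bump 0 j)%:R) = \prod_(j < i) (b + 2 + j%:R).
    by apply: eq_bigr => j _; rewrite /bump /= add1n -natr1; ring.
  have pN : \prod_(j < i) (b + 2 + j%:R) != 0.
    by rewrite gt_eqF// prodr_gt0// => j _; rewrite ltr_wpDr.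
  have -> : b + 1 + i.+1%:R = b + 2 + i%:R by rewrite -natr1; ring.
  have bi : b + 2 + i%:R != 0 by rewrite gt_eqF// ltr_wpDr.
  have fN : (i.+1)`!%:R != 0 :> R by rewrite pnatr_eq0 -lt0n fact_gt0.
  by field; rewrite bi b1N fN pN.
rewrite e1 e2 e3 exprS -[i.+1%:R]natr1.
have i1 : i%:R + 1 != 0 :> R by rewrite natr1.
by field; rewrite b1N bN i1.
Qed.

Definition h01_sum b x N := \sum_(i < N) h01_coef b i * x ^+ i.

Lemma h01_sum_pseries b x N : h01_sum b x N = pseries (h01_coef b) x N.
Proof. by rewrite /h01_sum /pseries /series /= big_mkord. Qed.

(** The hypothesis makes the terms at least halve from index [N] on, so the tail is at most twice
    its first term. *)
Lemma h01_remainder b x N : 0 < b -> 2 * `|x| <= N.+1%:R * (b + N%:R) ->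
  `|h01 b x - h01_sum b x N| <= 2 * (h01_coef b N * `|x| ^+ N).
Proof.
move=> b0 xN.
pose T i := h01_coef b i * `|x| ^+ i.
have T0 i : 0 <= T i by rewrite mulr_ge0 ?exprn_ge0// ltW// h01_coef_gt0.
have Th i : (N <= i)%N -> T i.+1 <= T i / 2.
  move=> Ni; rewrite /T h01_coefS exprS.
  have p0 : 0 < i.+1%:R * (b + i%:R) by rewrite mulr_gt0// ltr_wpDr.
  have -> : h01_coef b i / (i.+1%:R * (b + i%:R)) * (`|x| * `|x| ^+ i) =
     h01_coef b i * `|x| ^+ i * (`|x| / (i.+1%:R * (b + i%:R))) by ring.
  apply: ler_wpM2l; first exact: T0.
  rewrite ler_pdivrMr// -ler_pdivrMl ?invr_gt0// invrK.
  apply: (le_trans xN); apply: ler_pM => //.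
  - by rewrite addr_ge0// ltW.
  - by rewrite ler_nat.
  - by rewrite lerD2l ler_nat.
(* As T halves at each index, T_i <= 2 T_i - 2 T_(i+1), and these bounds telescope. *)
have step j : `|h01_sum b x (N + j) - h01_sum b x N| <= 2 * T N - 2 * T (N + j)%N.
  elim: j => [|j IH]; first by rewrite addn0 !subrr normr0.
  rewrite addnS {1}/h01_sum big_ord_recr /= -/(h01_sum b x (N + j)) addrAC.
  apply: le_trans (ler_normD _ _) _.
  have -> : `|h01_coef b (N + j) * x ^+ (N + j)| = T (N + j)%N.
    by rewrite normrM normrX ger0_norm// ltW// h01_coef_gt0.
  by have := Th (N + j)%N (leq_addr _ _); lra.
have cv : h01_sum b x n - h01_sum b x N @[n --> \oo] --> h01 b x - h01_sum b x N.
  apply: cvgB; last exact: cvg_cst.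
  by under eq_cvg do rewrite h01_sum_pseries; exact: is_cvg_h01.
have cv' : `|h01_sum b x n - h01_sum b x N| @[n --> \oo] --> `|h01 b x - h01_sum b x N|.
  exact: cvg_norm cv.
rewrite -(cvg_lim _ cv')//.
apply: limr_le; first exact: cvgP cv'.
near=> n; have Nn : (N <= n)%N by near: n; exists N.
rewrite -(subnKC Nn); apply: le_trans (step _) _.
by rewrite gerBl mulr_ge0.
Unshelve. all: by end_near. Qed.

Lemma h01_gt0 b x : 0 < b -> 0 <= x -> 0 < h01 b x.
Proof.
move=> b0 x0; have cv := is_cvg_h01 _ x b0.
apply: (@lt_le_trans _ _ 1) => //.
apply: limr_ge => //; near=> n.
have n0 : (0 < n)%N by near: n; exists 1%N.
rewrite -(prednK n0) /pseries /series /= big_nat_recl//= h01_coef0 expr0 mulr1.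
rewrite lerDl sumr_ge0// => i _; rewrite mulr_ge0 ?exprn_ge0//.
by rewrite ltW// h01_coef_gt0.
Unshelve. all: by end_near. Qed.

End Hypergeometric01.

(** * Limits of Chebyshev derivatives *)

Section ChebyshevDerivatives.
Context {R : realType}.
Local Notation T := (@chebyT R).

Lemma chebyT_deriv_rec n :
  (1 - 'X^2) * (T n)^`() = n%:R *: ('X * T n - T n.+1).
Proof.
suff: (1 - 'X^2) * (T n)^`() = n%:R *: ('X * T n - T n.+1) /\
  (1 - 'X^2) * (T n.+1)^`() = n.+1%:R *: ('X * T n.+1 - T n.+2) by case.
elim: n => [|n [IH0 IH1]].
  split; first by rewrite /= derivC mulr0 scale0r.
  rewrite /= derivX scale1r mulr1 scaler_nat; ring.
split=> //; rewrite [in LHS]chebyT_rec derivB derivZ derivM derivX mul1r.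
have -> : (1 - 'X^2) * (2 *: (T n.+1 + 'X * (T n.+1)^`()) - (T n)^`()) =
   2 *: ((1 - 'X^2) * T n.+1) + 2 *: ('X * ((1 - 'X^2) * (T n.+1)^`()))
   - (1 - 'X^2) * (T n)^`() by rewrite -!mul_polyC; ring.
rewrite IH0 IH1 (chebyT_rec n.+1) (chebyT_rec n) -!mul_polyC.
rewrite -[n.+2%:R]natr1 -[n.+1%:R]natr1 !polyCD; ring.
Qed.

Lemma chebyT_deriv_succ n :
  n%:R *: (T n.+1)^`() = n.+1%:R *: ('X * (T n)^`() + n%:R *: T n).
Proof.
have X2N0 : (1 - 'X^2 : {poly R}) != 0.
  rewrite -oppr_eq0 opprB -size_poly_eq0.
  by rewrite -[1]/(1%:P) size_XnsubC.
apply: (mulfI X2N0); rewrite -scalerAr chebyT_deriv_rec.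
rewrite -scalerAr mulrDr mulrCA chebyT_deriv_rec chebyT_rec -!mul_polyC.
by rewrite -[n.+1%:R]natr1 !polyCD; ring.
Qed.

Lemma chebyT_ode n :
  (1 - 'X^2) * (T n)^`(2) = 'X * (T n)^`() - (n%:R ^+ 2) *: T n.
Proof.
have := congr1 deriv (chebyT_deriv_rec n).
rewrite derivM derivB derivC derivXn sub0r derivZ derivB derivM derivX mul1r.
rewrite [in RHS]scalerBr chebyT_deriv_succ /= => /(canRL (addKr _)) ->; rewrite -!mul_polyC -mulr_natl.
by rewrite -[n.+1%:R]natr1 !polyCD /= expr2 polyCM expr1; ring.
Qed.

Lemma chebyT_derivn_ode n i :
  (1 - 'X^2) * (T n)^`(i.+2) = (2 * i%:R + 1) *: ('X * (T n)^`(i.+1))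
    - (n%:R ^+ 2 - i%:R ^+ 2) *: (T n)^`(i).
Proof.
elim: i => [|i IH].
  rewrite chebyT_ode mulr0 add0r scale1r expr0n /= subr0; done.
have := congr1 deriv IH.
rewrite derivM derivB derivC derivXn sub0r derivB !derivZ derivM derivX mul1r.
rewrite -!derivnS => /(canRL (addKr _)) ->; rewrite -!mul_polyC -mulr_natl.
by rewrite -[i.+1%:R]natr1 !(polyCD, polyCM, polyCN, polyCB) /= expr1; ring.
Qed.

Lemma chebyT_at1 n : (T n).[1] = 1.
Proof. by have := chebyT_cos n (0 : R); rewrite mulr0 cos0. Qed.

(** At 1 the leading coefficient of the differentiated Chebyshev equation vanishes, which leaves a
    one-term recurrence for the Taylor coefficients at 1. The comparison with 0F1 rests on it. *)
Lemma chebyT_derivn_at1S n i :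
  (2 * i%:R + 1) * (T n)^`(i.+1).[1] = (n%:R ^+ 2 - i%:R ^+ 2) * (T n)^`(i).[1].
Proof.
have := congr1 (fun p => p.[1]) (chebyT_derivn_ode n i).
rewrite !hornerE expr1n subrr mul0r => /esym/eqP.
by rewrite subr_eq0 => /eqP <-; rewrite /= mulr1.
Qed.

Lemma chebyT_derivn_at1 n k m : (T n)^`(k + m).[1] =
  (T n)^`(k).[1] * \prod_(i < m) ((n%:R ^+ 2 - (k + i)%:R ^+ 2) / (2 * (k + i)%:R + 1)).
Proof.
elim: m => [|m IH]; first by rewrite addn0 big_ord0 mulr1.
have := chebyT_derivn_at1S n (k + m); rewrite addnS IH => h.
rewrite big_ord_recr /= mulrA.
have d0 : 2 * (k + m)%:R + 1 != 0 :> R by rewrite gt_eqF// ltr_wpDl.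
apply: (mulfI d0); rewrite h; field.
by move: d0; rewrite natrD.
Qed.

Lemma size_chebyT n : (size (T n) <= n.+1)%N.
Proof.
suff: (size (T n) <= n.+1)%N /\ (size (T n.+1) <= n.+2)%N by case.
elim: n => [|n [IH0 IH1]]; first by rewrite /= size_poly1 size_polyX.
split => //; rewrite chebyT_rec.
apply: (leq_trans (size_polyD _ _)); rewrite geq_max; apply/andP; split.
  apply: (leq_trans (size_scale_leq _ _)).
  by apply: (leq_trans (size_polyMleq _ _)); rewrite size_polyX.
by rewrite size_polyN (leq_trans IH0 (leqW (leqnSn _))).
Qed.

Lemma chebyT_derivn_ge0 n i : 0 <= (T n)^`(i).[1].
Proof.
have [ni|ni] := ltnP n i.
  rewrite (_ : (T n)^`(i) = 0) ?horner0//.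
  by apply: derivn_poly0; apply: leq_trans ni; exact: size_chebyT.
rewrite -[i]add0n chebyT_derivn_at1 derivn0 chebyT_at1 mul1r.
apply: prodr_ge0 => j _; rewrite add0n divr_ge0//.
by rewrite subr_ge0 lerXn2r ?nnegrE// ler_nat ltnW// (leq_trans (ltn_ord j)).
Qed.

Lemma chebyT_derivn_gt0 n i : (i <= n)%N -> 0 < (T n)^`(i).[1].
Proof.
move=> ni; rewrite -[i]add0n chebyT_derivn_at1 derivn0 chebyT_at1 mul1r.
apply: prodr_gt0 => j _; rewrite add0n divr_gt0//.
  by rewrite subr_gt0 ltrXn2r ?nnegrE// ltr_nat (leq_trans (ltn_ord j)).
Qed.

(** All Taylor coefficients at 1 are nonnegative and the first is positive. This keeps the largest
    root below 1, where the rescaled variable lives. *)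
Lemma chebyT_derivn_gt0_ge1 n i x : (i <= n)%N -> 1 <= x -> 0 < (T n)^`(i).[x].
Proof.
move=> ni x1; have -> : x = 1 + (x - 1) by rewrite addrC subrK.
have c : GRing.comm 1 (x - 1) by exact: mulrC.
rewrite (@nderiv_taylor_wide _ (size (T n)^`(i)).+1 _ _ _ c)// big_ord_recl.
rewrite nderivn0 expr0 mulr1 ltr_pwDl ?chebyT_derivn_gt0//.
apply: sumr_ge0 => j _; apply: mulr_ge0; last by rewrite exprn_ge0// subr_ge0.
have f0 : 0 < (lift ord0 j)`!%:R :> R by rewrite ltr0n fact_gt0.
rewrite -(pmulr_rge0 _ f0) mulr_natl -hornerMn -nderivn_def.
rewrite /derivn -iterD addnC; exact: chebyT_derivn_ge0.
Qed.

(** Quotient of the m-th Taylor coefficient of T_n^(k) in the rescaled variable z, normalised at z =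
    0, by its limit as n grows. *)
Definition bessel_defect n k m : R := \prod_(i < m) (1 - ((k + i)%:R / n%:R) ^+ 2).

Definition bessel_approx n k z : R :=
  \sum_(m < n.+1) h01_coef (k%:R + 2^-1) m * bessel_defect n k m * z ^+ m.

Lemma chebyT_bessel_approx n k z : (0 < n)%N ->
  (T n)^`(k).[1 + 2 * z / n%:R ^+ 2] = (T n)^`(k).[1] * bessel_approx n k z.
Proof.
move=> n0; set h := 2 * z / _.
have c : GRing.comm 1 h by exact: mulrC.
rewrite (@nderiv_taylor_wide _ n.+1 _ _ _ c); last first.
  apply: leq_trans (size_chebyT n).
  apply/leq_sizeP => j hj.
  by rewrite coef_derivn nth_default ?mul0rn// (leq_trans hj (leq_addl _ _)).
rewrite /bessel_approx big_distrr /=; apply: eq_bigr => m _.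
have f0 : (m : nat)`!%:R != 0 :> R by rewrite pnatr_eq0 -lt0n fact_gt0.
have -> : (T n)^`(k)^`N(m).[1] = (T n)^`(k + m).[1] / m`!%:R.
  have -> : (T n)^`(k + m) = (T n)^`(k)^`(m) by rewrite addnC /derivn iterD.
  by rewrite [in RHS]nderivn_def hornerMn -mulr_natr mulfK.
rewrite chebyT_derivn_at1 /h01_coef /bessel_defect -!mulrA; congr (_ * _).
rewrite mulrCA [in RHS]invfM -!mulrA; congr (_ * _).
have -> : h = z * (2 / n%:R ^+ 2) by rewrite /h; ring.
rewrite exprMn mulrA [RHS]mulrA [LHS]mulrAC; congr (_ * _).
have -> : (2 / n%:R ^+ 2) ^+ m = \prod_(i < m) (2 / n%:R ^+ 2) :> R.
  by rewrite prodr_const card_ord.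
rewrite -prodfV -!big_split /=.
apply: eq_bigr => i _.
have nN : n%:R != 0 :> R by rewrite pnatr_eq0 -lt0n.
have d0 : 2 * (k + i)%:R + 1 != 0 :> R by rewrite gt_eqF// ltr_wpDl.
have d1 : k%:R + 2^-1 + i%:R != 0 :> R by rewrite gt_eqF// -addrA ltr_wpDl// ltr_pwDl// invr_gt0.
have e : 2 * (k + i)%:R + 1 = 2 * (k%:R + 2^-1 + i%:R) :> R by rewrite natrD; field.
rewrite e; move: d1 nN; move: (_ + i%:R) (k + i)%:R n%:R => w q p w0 p0.
by field; rewrite w0 p0.
Qed.

End ChebyshevDerivatives.

(** * The scaling limit near 1 and the limit of tau *)

Section TauLimit.
Context {R : realType}.
Local Open Scope classical_set_scope.
Local Notation T := (@chebyT R).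
Local Notation half := (2^-1 : R).

Lemma bessel_defect_bounds n k m : (k <= n)%N -> (0 < n)%N ->
  0 <= @bessel_defect R n k m <= 1.
Proof.
move=> kn n0; rewrite /bessel_defect.
have [mn|nm] := leqP m (n - k).+1; last first.
  have h : (n - k < m)%N by apply: ltnW.
  (* The factor with k + i = n vanishes, so the later factors, which are negative, do no harm. *)
  rewrite (bigD1 (Ordinal h))//= subnKC// divff ?pnatr_eq0 -?lt0n//.
  by rewrite expr1n subrr mul0r lexx ler01.
have f i : (i < m)%N -> 0 <= 1 - ((k + i)%:R / n%:R : R) ^+ 2 <= 1.
  move=> im; rewrite gerBl sqr_ge0 andbT subr_ge0 expr_le1 ?divr_ge0//.
  rewrite ler_pdivrMr ?ltr0n// mul1r ler_nat -leq_subRL// -ltnS.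
  exact: leq_trans im mn.
apply: (big_ind (fun x : R => 0 <= x <= 1)); first by rewrite ler01 lexx.
  by move=> x y /andP[x0 x1] /andP[y0 y1]; rewrite mulr_ge0//= mulr_ile1.
by move=> i _; exact: f.
Qed.

Lemma bessel_defect_ge n k m : (k <= n)%N -> (0 < n)%N ->
  1 - @bessel_defect R n k m <= (k + m)%:R ^+ 3 / n%:R ^+ 2.
Proof.
move=> kn n0.
suff: 1 - @bessel_defect R n k m <= m%:R * (k + m)%:R ^+ 2 / n%:R ^+ 2.
  move/le_trans; apply; rewrite ler_pM2r ?invr_gt0 ?exprn_gt0 ?ltr0n//.
  by rewrite [leRHS]exprS ler_wpM2r ?exprn_ge0// ler_nat leq_addl.
elim: m => [|m IH]; first by rewrite /bessel_defect big_ord0 subrr !mul0r.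
have /andP[d0 d1] := bessel_defect_bounds n k m kn n0.
have -> : @bessel_defect R n k m.+1 =
   bessel_defect n k m * (1 - ((k + m)%:R / n%:R) ^+ 2).
  by rewrite /bessel_defect big_ord_recr.
set s := ((k + m)%:R / n%:R) ^+ 2.
have s0 : 0 <= s by rewrite sqr_ge0.
have h1 : bessel_defect n k m * s <= s by rewrite ler_piMl.
have h2 : s = (k + m)%:R ^+ 2 / n%:R ^+ 2 by rewrite /s expr_div_n.
have h3 : (k + m)%:R ^+ 2 <= (k + m.+1)%:R ^+ 2 :> R.
  by rewrite lerXn2r ?nnegrE// ler_nat leq_add2l.
have n2 : 0 < (n%:R ^+ 2)^-1 :> R by rewrite invr_gt0 exprn_gt0 ?ltr0n.
have h4 : m%:R * (k + m)%:R ^+ 2 / n%:R ^+ 2 <=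
    m%:R * (k + m.+1)%:R ^+ 2 / n%:R ^+ 2 :> R.
  by rewrite ler_pM2r// ler_wpM2l.
have h5 : s <= (k + m.+1)%:R ^+ 2 / n%:R ^+ 2 by rewrite h2 ler_pM2r.
rewrite -[m.+1%:R]natr1 2!mulrDl mul1r mulrBr mulr1.
lra.
Qed.

Lemma cube_le_expR (x : R) : 0 <= x -> x ^+ 3 <= 6 * expR x.
Proof.
move=> x0; have := expR_ge1Dxn 2 x0; rewrite (_ : 3`!%:R = 6 :> R)//.
by move=> h; have := x0; lra.
Qed.

(** The defect is at most (k + m)^3/n^2 <= 6 e^(k+m)/n^2, and the factor e^m only replaces Z by eZ
    in the exponential series that dominates the coefficients. The error is thus O(n^-2) uniformly
    in z. *)
Lemma bessel_approx_error k (Z : R) : 0 <= Z -> exists2 K : R, 0 <= K &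
  forall n z, (k <= n)%N -> (0 < n)%N -> `|z| <= Z ->
  `|h01_sum (k%:R + half) z n.+1 - bessel_approx n k z| <= K / n%:R ^+ 2.
Proof.
move=> Z0; have b0 : 0 < k%:R + half by rewrite ltr_wpDl// invr_gt0.
pose c := 1 + (k%:R + half)^-1.
have c0 : 0 <= c by rewrite addr_ge0// invr_ge0 ltW.
exists (6 * c * expR k%:R * expR (expR 1 * Z)).
  by rewrite !mulr_ge0// ?expR_ge0.
move=> n z kn n0 zZ.
have n2 : 0 <= (n%:R ^+ 2)^-1 :> R by rewrite invr_ge0 exprn_ge0.
rewrite /h01_sum /bessel_approx -sumrB.
apply: (le_trans (ler_norm_sum _ _ _)).
apply: (@le_trans _ _ (\sum_(i < n.+1)
    (6 * c * expR k%:R / n%:R ^+ 2) * ((expR 1 * Z) ^+ i / i`!%:R))).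
  apply: ler_sum => i _.
  have /andP[d0 d1] := bessel_defect_bounds n k i kn n0.
  have -> : h01_coef (k%:R + half) i * z ^+ i -
      h01_coef (k%:R + half) i * bessel_defect n k i * z ^+ i =
      h01_coef (k%:R + half) i * ((1 - bessel_defect n k i) * z ^+ i) by ring.
  rewrite !normrM normrX (ger0_norm (ltW (h01_coef_gt0 _ _ b0))).
  rewrite (@ger0_norm _ (1 - _)) ?subr_ge0//.
  have e3 := bessel_defect_ge n k i kn n0.
  have cub := @cube_le_expR (k + i)%:R (ler0n _ _).
  have eS : expR (k + i)%:R = expR k%:R * expR 1 ^+ i :> R.
    by rewrite natrD expRD -[i%:R]mulr1 expRM_natl.
  have zi : `|z| ^+ i <= Z ^+ i by rewrite lerXn2r ?nnegrE.
  have -> : 6 * c * expR k%:R / n%:R ^+ 2 * ((expR 1 * Z) ^+ i / i`!%:R) =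
     (c / i`!%:R) * ((6 * (expR k%:R * expR 1 ^+ i) / n%:R ^+ 2) * Z ^+ i).
    by rewrite exprMn; ring.
  apply: ler_pM => //.
  - by rewrite ltW// h01_coef_gt0.
  - by rewrite mulr_ge0 ?exprn_ge0// subr_ge0.
  - exact: h01_coef_le.
  - apply: ler_pM => //; rewrite ?exprn_ge0 ?subr_ge0//.
    by apply: (le_trans e3); rewrite ler_wpM2r// -eS.
rewrite -mulr_sumr [leRHS]mulrAC ler_wpM2l//.
  by rewrite !mulr_ge0 ?expR_ge0.
have x0 : 0 <= expR 1 * Z by rewrite mulr_ge0 ?expR_ge0.
rewrite /expR.
have := @nondecreasing_cvgn_le R (series (exp_coeff (expR 1 * Z))).
move=> h; have := h _ (is_cvg_series_exp_coeff _) n.+1.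
rewrite /series /= big_mkord; apply.
apply/nondecreasing_seqP => m; rewrite /series /= big_nat_recr //= lerDl.
by rewrite exp_coeff_ge0.
Qed.

Lemma bessel_approx_unif k (Z e : R) : 0 <= Z -> 0 < e ->
  \forall n \near \oo, forall z, `|z| <= Z ->
  `|h01 (k%:R + half) z - bessel_approx n k z| < e.
Proof.
move=> Z0 e0; have b0 : 0 < k%:R + half by rewrite ltr_wpDl// invr_gt0.
have [K K0 hK] := bessel_approx_error k Z Z0.
have cv : h01_coef (k%:R + half) n * Z ^+ n @[n --> \oo] --> 0.
  exact: (cvg_series_cvg_0 (is_cvg_h01 _ Z b0)).
have : \forall n \near \oo, `|h01_coef (k%:R + half) n * Z ^+ n| < e / 4.
  by apply: cvgr0_norm_lt => //; rewrite divr_gt0.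
move=> [N0 _ hN0].
near=> n => z zZ.
have kn : (k <= n)%N by near: n; exists k.
have n0 : (0 < n)%N by near: n; exists 1%N.
have Nn : (N0 <= n.+1)%N by apply: leqW; near: n; exists N0.
have nZ : 4 * Z <= n%:R by near: n; exact: nbhs_infty_ger.
have nK : 4 * (K + 1) / e <= n%:R by near: n; exact: nbhs_infty_ger.
have nR : 1 <= n%:R :> R by rewrite ler1n.
have := hK n z kn n0 zZ.
have h2 : K / n%:R ^+ 2 <= e / 4.
  rewrite ler_pdivrMr ?exprn_gt0 ?ltr0n// expr2.
  move: nK; rewrite ler_pdivrMr// => nK.
  have : n%:R * e <= n%:R * e * n%:R by rewrite ler_peMr// mulr_ge0// ltW.
  lra.
have := h01_remainder (k%:R + half) z n.+1 b0.
have : 2 * `|z| <= n.+2%:R * (k%:R + half + n.+1%:R).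
  apply: (@le_trans _ _ (n.+2%:R * 1)); last first.
    rewrite ler_wpM2l// -[n.+1%:R]natr1 addrA lerDr addr_ge0 ?(ltW b0)//.
  by rewrite mulr1 -[n.+2%:R]natr1 -[n.+1%:R]natr1; lra.
move=> hh /(_ hh).
have : h01_coef (k%:R + half) n.+1 * `|z| ^+ n.+1 < e / 4.
  have := hN0 n.+1 Nn; rewrite /= ger0_norm; last first.
    by rewrite mulr_ge0 ?exprn_ge0// ltW// h01_coef_gt0.
  apply: le_lt_trans; rewrite ler_wpM2l ?(ltW (h01_coef_gt0 _ _ b0))//.
  by rewrite lerXn2r ?nnegrE.
set A := h01 _ _; set B := h01_sum _ _ _; set C := bessel_approx _ _ _.
move=> h3 h4 h5.
have -> : A - C = (A - B) + (B - C) by ring.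
by apply: le_lt_trans (ler_normD _ _) _; lra.
Unshelve. all: by end_near. Qed.

Lemma bessel_approx_pos n k : (0 < n)%N -> (k <= n)%N -> 0 < @bessel_approx R n k 0.
Proof.
move=> n0 kn; have := chebyT_bessel_approx n k (0 : R) n0.
rewrite mulr0 mul0r addr0 => h; have p := @chebyT_derivn_gt0 R n k kn.
by have := p; rewrite {1}h pmulr_rgt0.
Qed.

Lemma bessel_approx_derivable n k z :
  exists d, is_derive z (1 : R) (@bessel_approx R n k) d.
Proof.
rewrite (_ : bessel_approx n k = horner (\poly_(m < n.+1)
   (h01_coef (k%:R + half) m * bessel_defect n k m))).
  by eexists; apply/derivableP; exact: derivable_horner.
by apply/funext => u; rewrite horner_poly.
Qed.

Lemma omega_bessel n k (y : R) : (k < n)%N -> 0 < y ->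
  bessel_approx n k.+1 (- y / 4) = 0 ->
  (forall u, 0 <= u < y -> 0 < bessel_approx n k.+1 (- u / 4)) ->
  omega n k = 1 - y / (2 * n%:R ^+ 2).
Proof.
move=> kn y0 hy hpos; have n0 : (0 < n)%N by exact: leq_ltn_trans kn.
have nN : n%:R != 0 :> R by rewrite pnatr_eq0 -lt0n.
have e u : 1 - u / (2 * n%:R ^+ 2) = 1 + 2 * (- u / 4) / n%:R ^+ 2 :> R by field.
apply: largest_rootE.
  by rewrite /root e chebyT_bessel_approx// hy mulr0.
move=> x; rewrite leNgt; apply: contraL => yx.
rewrite /root; have [x1|x1] := leP 1 x.
  by rewrite gt_eqF// chebyT_derivn_gt0_ge1.
pose u := (1 - x) * (2 * n%:R ^+ 2).
have -> : x = 1 - u / (2 * n%:R ^+ 2) by rewrite /u; field.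
have n2 : 0 < 2 * n%:R ^+ 2 :> R by rewrite mulr_gt0// exprn_gt0// ltr0n.
rewrite e chebyT_bessel_approx// gt_eqF// mulr_gt0 ?chebyT_derivn_gt0//.
apply: hpos; rewrite /u mulr_ge0 ?(ltW n2) ?subr_ge0 ?(ltW x1)//=.
by rewrite -ltr_pdivlMr//; lra.
Qed.

(** A Hurwitz argument: the last hypothesis says that the limit function crosses 0 at y with nonzero
    slope, so uniform convergence traps the first zero of the approximants near y, and tau is
    evaluated at rescaled points converging to y. *)
Lemma tau_star_h01 k (y : R) : 0 < y ->
  h01 (k.+1%:R + half) (- y / 4) = 0 ->
  (forall u, 0 <= u < y -> 0 < h01 (k.+1%:R + half) (- u / 4)) ->
  0 < h01 (k.+2%:R + half) (- y / 4) ->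
  tau_star k = `|h01 (k%:R + half) (- y / 4)|.
Proof.
move=> y0 hy hpos hd; apply/cvg_lim => //.
have b0 j : 0 < j%:R + half by rewrite ltr_wpDl// invr_gt0.
pose F j u := h01 (j%:R + half) (- u / 4).
have dF j u : is_derive u (1 : R) (F j) (- F j.+1 u / (4 * (j%:R + half))).
  rewrite /F; have h := is_derive_h01 _ (- u / 4) (b0 j).
  dv; rewrite (_ : j%:R + half + 1 = j.+1%:R + half); last first.
    by rewrite -[j.+1%:R]natr1 addrAC.
  by field; have := b0 j; apply: contraTneq => hh; rewrite -leNgt; lra.
have cF j u : {for u, continuous (F j)} by exact: dv_continuous (dF j u).
have ypos : \forall u \near y, 0 < F k.+2 u by exact: (cvgr_gt _ (cF k.+2 y)).
have [d /= d0 hdd] := ypos.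
have neg u : y < u < y + d -> F k.+1 u < 0.
  move=> /andP[yu ud].
  have := increasing_dv (fun u => - F k.+1 u) (fun u => F k.+2 u / (4 * (k.+1%:R + half))) y u yu.
  have hyF : F k.+1 y = 0 by exact: hy.
  rewrite hyF oppr0 oppr_gt0; apply => v /andP[yv vu].
    by have dF1 := dF k.+1; dv; rewrite mulNr opprK.
  apply: divr_gt0; last by rewrite mulr_gt0.
  by apply: hdd; rewrite /= ltr0_norm ?subr_lt0//; lra.
have close (e : R) : 0 < e -> \forall n \near \oo, exists yn,
    [/\ omega n k = 1 - yn / (2 * n%:R ^+ 2), 0 <= yn & `|y - yn| <= e].
  (* Within d/2 to the right of y the limit is strictly negative; the bound y/2 keeps y - e'
     positive. *)
  move=> e0; pose e' := Num.min (Num.min e (d / 2)) (y / 2).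
  have e'0 : 0 < e' by rewrite !lt_min e0 !divr_gt0.
  have e'e : e' <= e by rewrite !ge_min lexx.
  have e'd : e' <= d / 2 by rewrite !ge_min lexx orbT.
  have e'y : e' <= y / 2 by rewrite !ge_min lexx !orbT.
  have n1 : F k.+1 (y + e') < 0 by apply: neg; lra.
  have [m [mpos hm]] : exists m, 0 < m /\ forall u, 0 <= u <= y - e' -> m <= F k.+1 u.
    have [||c cin hc] := @EVT_min R (F k.+1) 0 (y - e'); first by lra.
      by apply: continuous_subspaceT => u; exact: cF.
    exists (F k.+1 c); split.
      by apply: hpos; move: cin; rewrite in_itv /=; lra.
    by move=> u hu; apply: hc; rewrite in_itv /=.
  have := @bessel_approx_unif k.+1 (y + e') (Num.min m (- F k.+1 (y + e'))).
  rewrite lt_min mpos oppr_gt0 n1 => /(_ ltac:(lra) isT) unif.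
  near=> n.
  have unifn : forall z, `|z| <= y + e' -> `|h01 (k.+1%:R + half) z - bessel_approx n k.+1 z| <
      Num.min m (- F k.+1 (y + e')) by near: n.
  have kn : (k < n)%N by near: n; exists k.+1.
  have n0 : (0 < n)%N by exact: leq_ltn_trans kn.
  have cl u : 0 <= u <= y + e' -> `|F k.+1 u - bessel_approx n k.+1 (- u / 4)| < Num.min m (- F k.+1 (y + e')).
    move=> /andP[u0 uy]; apply: unifn; rewrite normrM normrN (ger0_norm u0) ger0_norm ?invr_ge0//.
    by lra.
  have [z [z0 zy hz hzpos]] : exists z, [/\ 0 < z, z <= y + e', bessel_approx n k.+1 (- z / 4) = 0 &
       forall x, 0 <= x < z -> 0 < bessel_approx n k.+1 (- x / 4)].
    apply: (first_zero (fun u => bessel_approx n k.+1 (- u / 4))).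
    - lra.
    - move=> x _; have [D hD] := bessel_approx_derivable n k.+1 (- x / 4).
      have h : is_derive x (1 : R) (fun u => bessel_approx n k.+1 (- u / 4)) (D * (- 1 / 4)).
        by dv; ring.
      exact: dv_continuous h.
    - by rewrite oppr0 mul0r; exact: bessel_approx_pos.
    - have := cl (y + e'); rewrite lexx andbT lt_min => /(_ ltac:(lra))/andP[_].
      by rewrite ltr_norml => /andP[]; lra.
  exists z; split; [exact: omega_bessel|exact: ltW|].
  have : y - e' < z.
    rewrite ltNge; apply/negP => zye.
    have := cl z; rewrite hz subr0 lt_min => /(_ ltac:(lra))/andP[+ _].
    have := hm z; rewrite zye (ltW z0) => /(_ isT) h1.
    by rewrite ltNge; move/negP; apply; apply: le_trans (ler_norm _).
  by rewrite ler_norml; lra.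
apply/cvgrPdist_lt => /= e e0.
have : \forall u \near y, `|F k y - F k u| < e / 2.
  by have /cvgrPdist_lt := cF k y; apply; rewrite divr_gt0.
move=> [r /= r0 hr].
have := close (r / 2) ltac:(by rewrite divr_gt0).
have := @bessel_approx_unif k (y + r) (e / 2) ltac:(lra) ltac:(by rewrite divr_gt0).
move=> un cl; near=> n.
have unn : forall z, `|z| <= y + r -> `|h01 (k%:R + half) z - bessel_approx n k z| < e / 2 by near: n.
have [yn [om yn0 yyn]] : exists yn, [/\ omega n k = 1 - yn / (2 * n%:R ^+ 2), 0 <= yn & `|y - yn| <= r / 2] by near: n.
have kn : (k < n)%N by near: n; exists k.+1.
have n0 : (0 < n)%N by exact: leq_ltn_trans kn.
have nN : n%:R != 0 :> R by rewrite pnatr_eq0 -lt0n.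
rewrite /tau om (_ : 1 - yn / _ = 1 + 2 * (- yn / 4) / n%:R ^+ 2); last by field.
rewrite chebyT_bessel_approx// normrM (gtr0_norm (chebyT_derivn_gt0 _ _ (ltnW kn))).
rewrite mulrAC divff ?mul1r ?gt_eqF ?chebyT_derivn_gt0 ?(ltnW kn)//.
apply: le_lt_trans (ler_dist_dist _ _) _.
have h1 := hr yn; rewrite /= in h1; have {}h1 := h1 (le_lt_trans yyn _).
have h2 : `|F k y - F k yn| < e / 2 by apply: h1; lra.
have h3 : `|F k yn - bessel_approx n k (- yn / 4)| < e / 2.
  apply: unn; rewrite normrM normrN (ger0_norm yn0) ger0_norm ?invr_ge0//.
  by move: yyn; rewrite ler_norml; lra.
have -> : h01 (k%:R + half) (- y / 4) - bessel_approx n k (- yn / 4) =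
  (F k y - F k yn) + (F k yn - bessel_approx n k (- yn / 4)) by rewrite /F; ring.
by apply: le_lt_trans (ler_normD _ _) _; lra.
Unshelve. all: by end_near. Qed.

End TauLimit.

(** * The modulus of spherical Bessel functions *)

Section BesselModulus.
Context {R : realType}.
Variable k : nat.
Local Notation b := (k%:R + 2^-1 : R).

Lemma b_gt0 : 0 < b. Proof. by rewrite ltr_wpDl// invr_gt0. Qed.

(** The coefficient of x^(-2m) in |x h_k(x)|^2. For m = k it is ((2k-1)!!)^2. *)
Definition modulus_coef m : R :=
  \prod_(i < m) ((i%:R + 2^-1) / (i%:R + 1) * (b ^+ 2 - (i%:R + 2^-1) ^+ 2)).

(* y^k |x h_k(x)|^2 at y = x^2, for the spherical Hankel function h_k. *)
Definition modulus_poly : {poly R} := \poly_(i < k.+1) modulus_coef (k - i).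

(** The Euler operator y d/dy: it is diagonal on coefficients, so that differential equations become
    recurrences. *)
Definition theta (p : {poly R}) : {poly R} := 'X * p^`().

Lemma coef_theta p i : (theta p)`_i = i%:R * p`_i.
Proof.
rewrite /theta coefXM; case: i => [|i]; first by rewrite mul0r.
by rewrite /= coef_deriv mulr_natl.
Qed.

(** Products of two solutions of u'' + q u = 0 satisfy w''' + 4 q w' + 2 q' w = 0. This is that
    equation for q = 1 - k(k+1)/x^2 and w = y^(-k) S(y), y = x^2, in Euler form. Coefficientwise it
    is the ratio of consecutive [modulus_coef]. *)
Lemma modulus_ode : let S := modulus_poly in
  2 *: theta (theta (theta S)) - (6 * b) *: theta (theta S)
  + (4 * b ^+ 2) *: theta S + 2 *: ('X * theta S) + (1 - 2 * b) *: ('X * S) = 0.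
Proof.
move=> S; apply/polyP => i.
rewrite !coefD coefN !coefZ !coef_theta (coefXM (theta S)) (coefXM S) coef0.
case: i => [|i]; first by rewrite /= !mul0r !mulr0 oppr0 !addr0.
rewrite /= !coef_theta !coef_poly ltnS; case: (ltnP i k) => ik; last first.
  rewrite !mulr0 oppr0 !addr0; case: (ltnP i k.+1) => ik1; last first.
    by rewrite !mulr0 !addr0.
  have -> : i = k by apply/eqP; rewrite eqn_leq ik andbT -ltnS.
  by field.
rewrite ltnS (ltnW ik).
set j := (k - i.+1)%N; have kij : (k - i = j.+1)%N by rewrite /j -subSn// subSS.
have kj : (k = j + i.+1)%N by rewrite /j subnK.
have cS : modulus_coef j.+1 = modulus_coef j * ((j%:R + 2^-1) / (j%:R + 1) *
   (b ^+ 2 - (j%:R + 2^-1) ^+ 2)) by rewrite /modulus_coef big_ord_recr.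
have eb : k%:R = j%:R + i%:R + 1 :> R by rewrite {1}kj addnS -natr1 natrD.
rewrite kij cS eb; move: (modulus_coef j) => P; rewrite -[i.+1%:R]natr1.
have : j%:R + 1 != 0 :> R by rewrite natr1.
by move: j%:R i%:R => u v u1; field; rewrite u1.
Qed.

Lemma theta_horner p x : (theta p).[x] = x * p^`().[x].
Proof. by rewrite hornerM hornerX. Qed.

Lemma dv_horner (p : {poly R}) x : is_derive x (1 : R) (fun u => p.[u]) p^`().[x].
Proof.
have h := derivableP (@derivable_horner _ p x).
by apply: (dv_eq _ _ _ _ h); rewrite -derive1E -derivE.
Qed.

Definition besselB (y : R) : R := h01 (b + 1) (- y / 4).
Definition besselQ (y : R) : R := h01 (b + 2) (- y / 4).
(* The Euler derivative y B'(y). *)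
Definition besselN (y : R) : R := - y * besselQ y / (4 * (b + 1)).

Lemma b1_neq0 : b + 1 != 0.
Proof. by rewrite gt_eqF// addr_gt0// b_gt0. Qed.

Lemma is_derive_besselB y :
  is_derive y (1 : R) besselB (- besselQ y / (4 * (b + 1))).
Proof.
rewrite /besselB; have b1 : 0 < b + 1 by rewrite addr_gt0// b_gt0.
have h := is_derive_h01 (b + 1) (- y / 4) b1.
dv; rewrite (_ : b + 1 + 1 = b + 2); last by rewrite -addrA.
rewrite -/(besselQ y); move: b1_neq0; move: (b + 1) => c c0; by field.
Qed.

Lemma is_derive_besselQ y :
  is_derive y (1 : R) besselQ (- h01 (b + 3) (- y / 4) / (4 * (b + 2))).
Proof.
rewrite /besselQ; have b1 : 0 < b + 2 by rewrite addr_gt0// b_gt0.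
have h := is_derive_h01 (b + 2) (- y / 4) b1.
dv; rewrite (_ : b + 2 + 1 = b + 3); last by ring.
by have : b + 2 != 0 by [rewrite gt_eqF]; move: (b + 2) => c c0; field.
Qed.

Lemma is_derive_besselN y : exists2 d, is_derive y (1 : R) besselN d &
  y * d = - b * besselN y - y * besselB y / 4.
Proof.
eexists; first by rewrite /besselN; have h := is_derive_besselQ y; dv; reflexivity.
have b1 : 0 < b + 1 by rewrite addr_gt0// b_gt0.
have := h01_contiguous (b + 1) (- y / 4) b1.
rewrite -/(besselB y) (_ : b + 1 + 1 = b + 2); last by ring.
rewrite -/(besselQ y) (_ : b + 1 + 2 = b + 3); last by ring.
rewrite /besselN => ->.
have : b + 2 != 0 by rewrite gt_eqF// addr_gt0// b_gt0.
move: b1_neq0; move: (h01 _ _) (besselQ y) => u q.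
move: b => c c1 c2; by field; rewrite c1 c2.
Qed.

(** The squared modulus of the Wronskian of x^(k+1) B(x^2) and x h_k(x), two solutions of one
    equation, expanded in B, N and the Euler derivatives of S; hence it is constant. In this form
    h_k itself need not be constructed. *)
Definition bessel_invariant (y : R) : R :=
  let S := modulus_poly in let B := besselB y in let N := besselN y in
  4 * S.[y] * N ^+ 2 + 4 * B * N * (2 * b * S.[y] - (theta S).[y])
  + B ^+ 2 * ((4 * b ^+ 2 + y) * S.[y] - 6 * b * (theta S).[y]
              + 2 * (theta (theta S)).[y]).

(** The derivative of the invariant is known only through [y * d = 0], which says nothing at 0;
    vanishing in the interior is enough. *)
Lemma dv_zero_cst (f df : R -> R) (x z : R) : x <= z ->
  (forall u, x <= u <= z -> is_derive u (1 : R) f (df u)) ->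
  (forall u, x < u < z -> df u = 0) -> f x = f z.
Proof.
move=> xz df1 df0; apply/eqP; rewrite eq_le; apply/andP; split.
  by apply: (@nondecreasing_dv _ f df) => // u /df0 ->.
rewrite -lerN2; apply: (@nondecreasing_dv _ (fun u => - f u) (fun u => - df u)) => //.
  by move=> u /df1; exact: dvN.
by move=> u /df0 ->; rewrite oppr0.
Qed.

Lemma bessel_invariant_derive y : exists2 d, is_derive y (1 : R) bessel_invariant d &
  y * d = 0.
Proof.
have [d hN hd] := is_derive_besselN y.
have hB := is_derive_besselB y.
have h1 := dv_horner modulus_poly.
have h2 := dv_horner (theta modulus_poly).
have h3 := dv_horner (theta (theta modulus_poly)).
eexists; first by rewrite /bessel_invariant; dv; reflexivity.
have := congr1 (fun p => p.[y]) modulus_ode.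
rewrite /= !(hornerD, hornerN, hornerZ, hornerM, hornerX) horner0.
rewrite -!theta_horner.
have e1 := theta_horner modulus_poly y.
have e2 := theta_horner (theta modulus_poly) y.
have e3 := theta_horner (theta (theta modulus_poly)) y.
have eN : y * (- besselQ y / (4 * (b + 1))) = besselN y by rewrite /besselN; ring.
move: e1 e2 e3 eN hd.
move: (- besselQ y / _) => dB.
move: (modulus_poly^`()).[y] (theta modulus_poly)^`().[y].
move: (theta (theta modulus_poly))^`().[y] => d3 d1 d2.
move: (theta (theta (theta modulus_poly))).[y] => S3.
move: (theta (theta modulus_poly)).[y] => S2.
move: (theta modulus_poly).[y] => S1.
move: modulus_poly.[y] (besselB y) (besselN y) => S B N.
move: b => c e1 e2 e3 eN hd ode.
rewrite !expr1.
transitivity (4 * (y * d1) * N ^+ 2 + 8 * S * N * (y * d)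
  + (4 * (y * dB) * N + 4 * B * (y * d)) * (2 * c * S - S1)
  + 4 * B * N * (2 * c * (y * d1) - y * d2)
  + 2 * B * (y * dB) * ((4 * c ^+ 2 + y) * S - 6 * c * S1 + 2 * S2)
  + B ^+ 2 * (y * S + (4 * c ^+ 2 + y) * (y * d1) - 6 * c * (y * d2) + 2 * (y * d3))).
  by ring.
rewrite -e1 -e2 -e3 eN hd.
transitivity (B ^+ 2 * (2 * S3 - 6 * c * S2 + 4 * c ^+ 2 * S1 + 2 * (y * S1) + (1 - 2 * c) * (y * S))).
  by field.
by rewrite ode mulr0.
Qed.

Lemma modulus_coef_gt0 m : (m <= k)%N -> 0 < modulus_coef m.
Proof.
move=> mk; apply: prodr_gt0 => i _; rewrite mulr_gt0//.
rewrite subr_gt0 ltrXn2r// ?nnegrE ?addr_ge0// ?invr_ge0//.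
by rewrite ltrD2r ltr_nat (leq_trans (ltn_ord i)).
Qed.

Lemma modulus_poly_ge y : 0 <= y -> 0 < modulus_poly.[y].
Proof.
move=> y0; rewrite horner_poly big_ord_recl expr0 mulr1 ltr_pwDl ?modulus_coef_gt0 ?leq_subr//.
apply: sumr_ge0 => i _; rewrite mulr_ge0 ?exprn_ge0// ltW// modulus_coef_gt0//.
exact: leq_subr.
Qed.

(** At 0 only 4 b^2 S(0) survives in the invariant, at a zero of B only 4 S N^2. *)
Lemma bessel_modulus y : 0 <= y -> besselB y = 0 ->
  modulus_poly.[y] * besselN y ^+ 2 = b ^+ 2 * modulus_coef k.
Proof.
move=> y0 By.
have eP : bessel_invariant 0 = bessel_invariant y.
  pose df u := s2val (cid2 (bessel_invariant_derive u)).
  have h1 u : is_derive u (1 : R) bessel_invariant (df u).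
    exact: s2valP (cid2 (bessel_invariant_derive u)).
  have h2 u : u * df u = 0 by exact: s2valP' (cid2 (bessel_invariant_derive u)).
  apply: (dv_zero_cst bessel_invariant df _ _ y0) => // u /andP[u0 _].
  by apply/eqP; have /eqP := h2 u; rewrite mulf_eq0 gt_eqF.
move: eP; rewrite /bessel_invariant By /= {1 2}/besselN oppr0 !mul0r.
rewrite !theta_horner !mul0r /besselB oppr0 mul0r h01_at0 => h.
have e0 : modulus_poly.[0] = modulus_coef k.
  rewrite horner_coef0 coef_poly ltnS leq0n subn0; done.
by move: h; rewrite e0; move: (modulus_coef k) (besselN y) => c n h; lra.
Qed.

Lemma h01_besselN y : besselB y = 0 -> h01 b (- y / 4) = besselN y / b.
Proof.
move=> By; rewrite (h01_contiguous _ _ b_gt0) -/(besselB y) By add0r /besselN.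
rewrite -/(besselQ y).
have : b != 0 by rewrite gt_eqF// b_gt0.
by move: b1_neq0; move: b => c c1 c0; field; rewrite c1 c0.
Qed.

Lemma h01_modulus y : 0 <= y -> besselB y = 0 ->
  h01 b (- y / 4) ^+ 2 = modulus_coef k / modulus_poly.[y].
Proof.
move=> y0 By; rewrite h01_besselN// expr_div_n.
have h := bessel_modulus y y0 By.
have S0 := modulus_poly_ge y y0.
have : b != 0 by rewrite gt_eqF// b_gt0.
have SN : modulus_poly.[y] != 0 by rewrite gt_eqF.
move=> bN; apply/eqP; rewrite eqr_div// ?expf_neq0//; apply/eqP.
by rewrite [RHS]mulrC -h mulrC.
Qed.

Lemma besselN_neq0 y : 0 <= y -> besselB y = 0 -> besselN y != 0.
Proof.
move=> y0 By; have := bessel_modulus y y0 By; apply: contra_eq_neq => ->.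
rewrite expr0n /= mulr0 eq_sym gt_eqF// mulr_gt0 ?exprn_gt0 ?b_gt0//.
exact: modulus_coef_gt0.
Qed.

(** [besselQ] is a negative multiple of the derivative of B. By the invariant it cannot vanish at
    the zero, and a negative value would make B increase to 0 from below. *)
Lemma besselQ_first_zero y : 0 < y -> besselB y = 0 ->
  (forall u, 0 <= u < y -> 0 < besselB u) -> 0 < besselQ y.
Proof.
move=> y0 By pos.
have QN : besselQ y != 0.
  have := besselN_neq0 y (ltW y0) By; apply: contra_neq.
  by rewrite /besselN => ->; rewrite mulr0 mul0r.
rewrite lt_neqAle eq_sym QN /= leNgt; apply/negP => Q0.
have cQ := dv_continuous _ _ _ (is_derive_besselQ y).
have : \forall u \near y, besselQ u < 0 by exact: (cvgr_lt _ cQ).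
move=> [d /= d0 hd].
pose u := Num.max (y / 2) (y - d / 2).
have uy : u < y by rewrite gt_max; apply/andP; split; lra.
have u0 : 0 < u by rewrite lt_max; apply/orP; left; lra.
have ud : y - d / 2 <= u by rewrite le_max lexx orbT.
have := increasing_dv besselB (fun y => - besselQ y / (4 * (b + 1))) u y uy.
have b1 := b_gt0.
rewrite By => h; have : besselB u < 0.
  apply: h => [x _|x /andP[ux xy]]; first exact: is_derive_besselB.
  apply: divr_gt0; last by rewrite mulr_gt0// addr_gt0.
  by rewrite oppr_gt0; apply: hd; rewrite /= ger0_norm ?subr_ge0 ?(ltW xy)//; lra.
by rewrite ltNge ltW// pos// uy ltW.
Qed.

End BesselModulus.

(** * Sturm comparison for the first zero *)

Section SturmComparison.
Context {R : realType}.
Variables (k : nat) (V V1 : R -> R) (a : R).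
Hypothesis dV : forall s, is_derive s (1 : R) V (V1 s).
Hypothesis dV1 : forall s, is_derive s (1 : R) V1 (- 2 * s * V s).
Hypothesis a0 : 0 < a.
Hypothesis Va : V a = 0.
Hypothesis Vpos : forall s, s < a -> 0 < V s.
Hypothesis V1a : V1 a < 0.
Local Notation b := (k%:R + 2^-1 : R).
Local Notation B := (@besselB R k).
Local Notation N := (@besselN R k).

Lemma besselB_bound y : 0 <= y <= 1 -> `|B y| <= 2 /\ `|N y| <= 2.
Proof.
move=> /andP[y0 y1]; have b0 := @b_gt0 R k.
have z : 2 * `|- y / 4| <= 1.
  by rewrite normrM normrN (ger0_norm y0) ger0_norm ?invr_ge0//; lra.
have := h01_remainder (b + 1) (- y / 4) 0 (addr_gt0 b0 ltr01).
have := h01_remainder (b + 2) (- y / 4) 0 (addr_gt0 b0 (ltr0n _ 2)).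
rewrite /h01_sum !big_ord0 !subr0 !expr0 !h01_coef0 !mulr1 !addr0 !mul1r.
rewrite -/(besselB k y) -/(besselQ k y).
move=> /(_ ltac:(lra)) Q2 /(_ ltac:(lra)) B2; split=> //.
rewrite /besselN normrM normrM normrN (ger0_norm y0).
have q0 : 0 < 4 * (b + 1) by rewrite mulr_gt0// addr_gt0.
rewrite (@ger0_norm _ (_^-1)) ?invr_ge0 ?(ltW q0)// ler_pdivrMr//.
apply: (@le_trans _ _ (1 * 2)); first exact: ler_pM.
by lra.
Qed.

(** U(t) = e^(bt) B(e^(2t)) solves U'' = (b^2 - e^(2t)) U. The condition c^3 = b^2 makes the Airy
    potential 2 b^2 (t - ln b) the tangent of e^(2t) - b^2 at t = ln b, and convexity puts it below:
    U oscillates faster. If B stayed positive up to the bound, the Wronskian [W] = U V' - U' V,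
    which starts from 0 at minus infinity, would increase to a negative value. *)
Lemma bessel_first_zero_le c C : 0 < c -> c ^+ 3 = b ^+ 2 ->
  (forall s, s <= 0 -> `|V s| <= C /\ `|V1 s| <= C) ->
  exists z, [/\ 0 < z, z <= expR (2 * (ln b + a / c)), B z = 0 &
    forall u, 0 <= u < z -> 0 < B u].
Proof.
move=> c0 c3 VC; have b0 := @b_gt0 R k.
set Y := expR _; have Y0 : 0 < Y by exact: expR_gt0.
have cB u : {for u, continuous B} by exact: dv_continuous (is_derive_besselB _ _).
have B0 : B 0 = 1 by rewrite /besselB oppr0 mul0r h01_at0.
have [[u [u0 uY Bu]]|allpos] := pselect (exists u, [/\ 0 <= u, u <= Y & B u <= 0]).
  have [|||z [z0 zu Bz zpos]] := first_zero B 0 u u0; rewrite ?B0//.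
  by exists z; split => //; exact: le_trans uY.
have Bpos u : 0 <= u <= Y -> 0 < B u.
  move=> /andP[u0 uY]; rewrite ltNge; apply/negP => Bu; apply: allpos.
  by exists u.
exfalso.
pose W t := expR (b * t) * (B (expR (2 * t)) * (c * V1 (c * (t - ln b)))
   - (b * B (expR (2 * t)) + 2 * N (expR (2 * t))) * V (c * (t - ln b))).
pose dW t := expR (b * t) * B (expR (2 * t)) * V (c * (t - ln b)) *
   (expR (2 * t) - b ^+ 2 - 2 * b ^+ 2 * (t - ln b)).
have hW t : is_derive t (1 : R) W (dW t).
  have hB := is_derive_besselB k (expR (2 * t)).
  have [d hN hd] := is_derive_besselN k (expR (2 * t)).
  rewrite /W; dv; rewrite /dW.
  have eN : expR (2 * t) * (- besselQ k (expR (2 * t)) / (4 * (b + 1))) =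
    N (expR (2 * t)) by rewrite /besselN; ring.
  move: eN hd.
  move: (- besselQ k _ / _) => dB.
  move: (expR (2 * t)) (expR (b * t)) => y E.
  move: (N y) (B y) => n B'.
  move: (V _) (V1 _) => v v1.
  move: (ln b) => l eN hd.
  transitivity (E * (b * (B' * (c * v1) - (b * B' + 2 * n) * v)
    + (2 * (y * dB) * (c * v1) + B' * (- 2 * c ^+ 3 * (t - l) * v))
    - (2 * b * (y * dB) + 4 * (y * d)) * v - (b * B' + 2 * n) * (c * v1))).
    by ring.
  by rewrite eN hd c3; field.
have W_ge0 t1 : expR (2 * t1) <= Y -> 0 <= W t1.
  move=> t1Y.
  have Wt t : t <= t1 -> W t <= W t1.
    move=> tt1; apply: (nondecreasing_dv W dW) => // u /andP[tu ut1].
    have uY : expR (2 * u) <= Y.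
      by apply: le_trans t1Y; rewrite ler_expR; lra.
    rewrite /dW mulr_ge0//.
      apply: mulr_ge0; last first.
        move: uY; rewrite /Y ler_expR => uY.
        have : c * (u - ln b) <= a.
          have : u - ln b <= a / c by lra.
          by rewrite ler_pdivlMr// mulrC.
        by rewrite le_eqVlt => /predU1P[->|/Vpos/ltW//]; rewrite Va.
      by rewrite mulr_ge0 ?expR_ge0// ltW// Bpos// uY expR_ge0.
    (* The tangent inequality e^v >= 1 + v, at v = 2 (u - ln b). *)
    have -> : expR (2 * u) = b ^+ 2 * expR (2 * (u - ln b)).
      rewrite mulrBr expRD expRN [2 * ln b]mulr_natl -lnXn// lnK ?posrE ?exprn_gt0//.
      by rewrite mulrCA divff ?mulr1// expf_neq0// gt_eqF.
    have := expR_ge1Dx (2 * (u - ln b)).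
    have b2 : 0 <= b ^+ 2 by rewrite exprn_ge0// ltW.
    rewrite -subr_ge0 => /(mulr_ge0 b2).
    by rewrite !mulrBr => h; lra.
  rewrite leNgt; apply/negP => Wneg.
  have [C0|C0] := leP 0 C; last first.
    have [h _] := VC 0 (lexx _); move: C0; rewrite ltNge => /negP; apply.
    exact: le_trans h.
  pose K := 2 * c * C + (2 * b + 4) * C + 1.
  have K0 : 0 < K by rewrite /K ltr_wpDl// addr_ge0// !mulr_ge0// ?(ltW c0)// addr_ge0// mulr_ge0// ltW.
  have bound t : t <= 0 -> t <= ln b -> - (K * expR (b * t)) <= W t.
    move=> t0 tb.
    have [hB hN] : `|B (expR (2 * t))| <= 2 /\ `|N (expR (2 * t))| <= 2.
      apply: besselB_bound; rewrite expR_ge0 /= -[leRHS]expR0 ler_expR; lra.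
    have cs : c * (t - ln b) <= 0 by rewrite mulr_ge0_le0 ?subr_le0// ltW.
    have [hV hV1] := VC _ cs.
    rewrite lerNl; apply: le_trans (ler_norm _) _; rewrite normrN /W normrM mulrC.
    rewrite (ger0_norm (expR_ge0 _)) ler_wpM2r ?expR_ge0//.
    apply: le_trans (ler_normB _ _) _; rewrite !normrM /K (gtr0_norm c0).
    have h1 : `|B (expR (2 * t))| * (c * `|V1 (c * (t - ln b))|) <= 2 * (c * C).
      by apply: ler_pM => //; rewrite ?mulr_ge0 ?(ltW c0)// ler_wpM2l// ltW.
    have h2 : `|b * B (expR (2 * t)) + 2 * N (expR (2 * t))| <= 2 * b + 4.
      apply: le_trans (ler_normD _ _) _.
      rewrite (normrM b) (normrM 2) (gtr0_norm b0) (@gtr0_norm _ 2)//.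
      have : b * `|B (expR (2 * t))| <= b * 2 by rewrite ler_wpM2l// ltW.
      lra.
    have h3 : `|b * B (expR (2 * t)) + 2 * N (expR (2 * t))| *
      `|V (c * (t - ln b))| <= (2 * b + 4) * C by apply: ler_pM.
    by lra.
  (* So far to the left that K e^(bt) is at most half of -W(t1), against W(t) <= W(t1). *)
  pose t := Num.min (Num.min 0 (ln b)) (Num.min t1 (ln (- W t1 / (2 * K)) / b)).
  have q0 : 0 < - W t1 / (2 * K) by rewrite divr_gt0 ?oppr_gt0// mulr_gt0.
  have := bound t; rewrite /t !ge_min !lexx !orbT /= => /(_ isT isT).
  rewrite -/t => h.
  have := Wt t; rewrite /t !ge_min lexx !orbT -/t => /(_ isT) h2.
  have : expR (b * t) <= - W t1 / (2 * K).
    rewrite -[leRHS](@lnK R) ?posrE// ler_expR mulrC -ler_pdivlMr//.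
    by rewrite /t !ge_min lexx !orbT.
  rewrite ler_pdivlMr ?mulr_gt0// => h3.
  by move: h3; rewrite [2 * K]mulrC mulrA [_ * K]mulrC; lra.
pose t1 := ln b + a / c.
have := W_ge0 t1 (lexx _).
have e1 : c * (t1 - ln b) = a by rewrite /t1 addrAC subrr add0r mulrC divfK// gt_eqF.
rewrite /W e1 Va mulr0 subr0 leNgt => /negP; apply.
rewrite pmulr_rlt0 ?expR_gt0// pmulr_rlt0; last by rewrite Bpos// expR_ge0 /Y /t1 lexx.
by rewrite pmulr_rlt0.
Qed.

(** Here u(x) = x^(k+1) B(x^2) solves u'' = (mu^2/x^2 - 1) u, and c^3 mu = 1 makes the Airy
    potential 2 (x - mu)/mu the tangent of 1 - mu^2/x^2 at mu. Concavity puts it above: u oscillates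
    slower, and its zero cannot precede that of V. *)
Lemma bessel_first_zero_ge mu c z : (0 < k)%N -> 0 < mu -> mu ^+ 2 = k%:R * (k%:R + 1) ->
  0 < c -> c ^+ 3 * mu = 1 -> 0 < z -> B z = 0 ->
  (forall u, 0 <= u < z -> 0 < B u) -> a <= c * (Num.sqrt z - mu).
Proof.
move=> k0 mu0 mu2 c0 c3 z0 Bz Bpos; set j := Num.sqrt z.
have j0 : 0 < j by rewrite sqrtr_gt0.
have jz : j ^+ 2 = z by rewrite sqr_sqrtr// ltW.
rewrite leNgt; apply/negP => ja.
pose W x := x ^+ k * (x * B (x ^+ 2) * (c * V1 (c * (x - mu)))
   - ((k%:R + 1) * B (x ^+ 2) + 2 * N (x ^+ 2)) * V (c * (x - mu))).
have hW x : exists2 d, is_derive x (1 : R) W d & x * d = x ^+ k * B (x ^+ 2) *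
   V (c * (x - mu)) * (x ^+ 2 - mu ^+ 2 - 2 * c ^+ 3 * (x - mu) * x ^+ 2).
  have hB := is_derive_besselB k (x ^+ 2).
  have [d hN hd] := is_derive_besselN k (x ^+ 2).
  eexists; first by rewrite /W; dv; reflexivity.
  have eN : x ^+ 2 * (- besselQ k (x ^+ 2) / (4 * (b + 1))) =
    N (x ^+ 2) by rewrite /besselN; ring.
  move: eN hd.
  move: (- besselQ k _ / _) => dB.
  move: (N (x ^+ 2)) (B (x ^+ 2)) => n B'.
  move: (V _) (V1 _) => v v1 eN hd.
  rewrite mu2 -(prednK k0) exprS /= expr1.
  have -> : (k.-1.+1)%:R = k%:R :> R by rewrite prednK.
  move: (x ^+ _) => E; move: k%:R hd => K hd.
  transitivity (E * x * (K * (x * B' * (c * v1) - ((K + 1) * B' + 2 * n) * v)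
    + (x * B' * (c * v1) + 2 * (x ^+ 2 * dB) * x * (c * v1)
       + x ^+ 2 * B' * (- 2 * c ^+ 3 * (x - mu) * v))
    - (2 * (K + 1) * (x ^+ 2 * dB) + 4 * (x ^+ 2 * d)) * v
    - ((K + 1) * B' + 2 * n) * (c * v1) * x)).
    by ring.
  by rewrite eN hd; field.
have W0 : W 0 = 0 by rewrite /W expr0n gtn_eqF// mul0r.
pose dW x := s2val (cid2 (hW x)).
have h1 x : is_derive x (1 : R) W (dW x) by exact: s2valP (cid2 (hW x)).
have h2 x : x * dW x = _ := s2valP' (cid2 (hW x)).
have : - W 0 <= - W j.
  apply: (nondecreasing_dv (fun x => - W x) (fun x => - dW x) _ _ (ltW j0)).
  move=> x /andP[x0 xj]; rewrite oppr_ge0 -(pmulr_rle0 _ x0) h2.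
  have x2 : 0 <= x ^+ 2 < z.
    by rewrite exprn_ge0 ?(ltW x0)//= -jz ltrXn2r ?nnegrE ?ltW.
  rewrite mulr_ge0_le0//.
    rewrite mulr_ge0 ?ltW// ?mulr_gt0 ?exprn_gt0 ?Bpos// Vpos//.
    by apply: le_lt_trans ja; rewrite ler_pM2l// lerD2r ltW.
  have muN : mu != 0 by rewrite gt_eqF.
  (* x^2 times the gap between the potential and its tangent, with a double zero at mu. *)
  have -> : x ^+ 2 - mu ^+ 2 - 2 * c ^+ 3 * (x - mu) * x ^+ 2 =
     - ((x - mu) ^+ 2 * (2 * x + mu) / mu).
    have -> : c ^+ 3 = mu^-1 by apply: (mulIf muN); rewrite c3 mulVf.
    by field.
  rewrite oppr_le0 divr_ge0 ?(ltW mu0)// mulr_ge0 ?sqr_ge0//.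
  by rewrite addr_ge0 ?(ltW mu0)// mulr_ge0// ltW.
rewrite W0 oppr0 oppr_ge0 leNgt => /negP; apply.
have -> : W j = j ^+ k * - (2 * N z * V (c * (j - mu))).
  by rewrite /W jz Bz; ring.
rewrite mulr_gt0 ?exprn_gt0//.
rewrite oppr_gt0 nmulr_rlt0 ?Vpos//.
have Q0 := besselQ_first_zero k z z0 Bz Bpos.
have b0 := @b_gt0 R k.
have q0 : 0 < 4 * (b + 1) by rewrite mulr_gt0// (addr_gt0 b0).
rewrite /besselN pmulr_rlt0// nmulr_rlt0 ?invr_gt0//.
by rewrite nmulr_rlt0// oppr_lt0.
Qed.

End SturmComparison.

(** * Airy functions *)

Section Antiderivatives.
Context {R : realType}.
Local Open Scope classical_set_scope.
Implicit Types f F : R -> R.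

Lemma continuous_integrable_segment f (x y : R) : continuous f ->
  (@lebesgue_measure R).-integrable `[x, y] (EFin \o f).
Proof.
move=> cf; apply: continuous_compact_integrable; first exact: segment_compact.
exact: continuous_subspaceT.
Qed.

Lemma Rintegral_dv f F (x y : R) : x <= y -> continuous f ->
  (forall u, x <= u <= y -> is_derive u (1 : R) F (f u)) ->
  (\int[lebesgue_measure]_(t in `[x, y]) f t)%R = F y - F x.
Proof.
move=> xy cf dF; have [->|xNy] := eqVneq x y.
  by rewrite set_itv1 Rintegral_set1 subrr.
have {}xy : x < y by rewrite lt_neqAle xNy.
rewrite /Rintegral (@continuous_FTC2 _ f F)//=.
- exact: continuous_subspaceT.
- have cF u : x <= u <= y -> {for u, continuous F}.
    by move=> /dF; exact: dv_continuous.
  split.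
  + by move=> u /[!in_itv]/= /andP[xu uy]; have [] := dF u; rewrite ?ltW.
  + by apply: cvg_at_right_filter; apply: cF; rewrite lexx ltW.
  + by apply: cvg_at_left_filter; apply: cF; rewrite lexx ltW.
- move=> u /[!in_itv]/= /andP[xu uy]; rewrite derive1E.
  have xuy : x <= u <= y by rewrite !ltW.
  by have [_ ->] := dF u xuy.
Qed.

(** Based at -1, so that the primitive is differentiable at 0 from both sides. *)
Lemma exists_antiderivative f : continuous f ->
  exists F, forall x : R, -1 < x -> is_derive x (1 : R) F (f x).
Proof.
move=> cf.
exists (fun x => (\int[lebesgue_measure]_(t in `[(-1)%R, x]) f t)%R) => x x1.
have xx : x < x + 1 by rewrite ltrDl.
have [d e] := @continuous_FTC1_closed _ f (-1) x (x + 1) xx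
  (continuous_integrable_segment _ _ _ cf) x1 (cf x).
by apply: (dv_eq _ _ _ _ (derivableP d)); rewrite -derive1E.
Qed.

Lemma cauchy_cvg_pinfty f (m C : R) :
  (forall x y : R, m <= x -> x <= y -> `|f y - f x| <= C / x) ->
  exists l : R, f x @[x --> +oo] --> l.
Proof.
move=> fC; suff: cvg (f x @[x --> +oo]) by move=> h; exists (lim (f x @[x --> +oo])).
apply/cauchy_cvgP; apply: cauchy_exP => e e0.
pose x0 := Num.max 1 (Num.max m (2 * (`|C| + 1) / e)).
exists (f x0); rewrite /fmap /=; exists x0; split; first exact: num_real.
move=> y xy /=; rewrite -ball_normE /= distrC.
have x01 : 1 <= x0 by rewrite le_max lexx.
have x0p : 0 < x0 by apply: lt_le_trans x01.
have mx : m <= x0 by rewrite !le_max lexx orbT.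
apply: le_lt_trans (fC _ _ mx (ltW xy)) _.
rewrite ltr_pdivrMr//.
have : 2 * (`|C| + 1) / e <= x0 by rewrite !le_max lexx !orbT.
rewrite ler_pdivrMr// mulrC; have := ler_norm C; have := normr_ge0 C.
lra.
Qed.

End Antiderivatives.

(** * Power series solutions of the Airy equation *)

Section AirySeries.
Context {R : realType}.
Variable l : R.
Implicit Types x : R.

(* The solutions of Y'' = l x Y with initial values (1, 0) and (0, 1). *)
Definition airyF x := h01 (2 / 3) (l * x ^+ 3 / 9).
Definition airyF1 x := l * x ^+ 2 / 2 * h01 (5 / 3) (l * x ^+ 3 / 9).
Definition airyG x := x * h01 (4 / 3) (l * x ^+ 3 / 9).
Definition airyG1 x := h01 (1 / 3) (l * x ^+ 3 / 9).

Let p13 : 0 < 1 / 3 :> R. Proof. lra. Qed.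
Let p23 : 0 < 2 / 3 :> R. Proof. lra. Qed.
Let p43 : 0 < 4 / 3 :> R. Proof. lra. Qed.
Let p53 : 0 < 5 / 3 :> R. Proof. lra. Qed.

Lemma is_derive_airyF x : is_derive x (1 : R) airyF (airyF1 x).
Proof.
have h := is_derive_h01 _ (l * x ^+ 3 / 9) p23.
rewrite /airyF; dv; rewrite /airyF1 (_ : 2 / 3 + 1 = 5 / 3); last by field.
by move: (h01 _ _) => u; field.
Qed.

Lemma is_derive_airyF1 x : is_derive x (1 : R) airyF1 (l * x * airyF x).
Proof.
have h := is_derive_h01 _ (l * x ^+ 3 / 9) p53.
rewrite /airyF1; dv.
rewrite /airyF (h01_contiguous _ _ p23) (_ : 2 / 3 + 1 = 5 / 3); last by field.
rewrite (_ : 2 / 3 + 2 = 5 / 3 + 1); last by field.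
by move: (h01 _ _) (h01 _ _) => u v; field.
Qed.

Lemma is_derive_airyG x : is_derive x (1 : R) airyG (airyG1 x).
Proof.
have h := is_derive_h01 _ (l * x ^+ 3 / 9) p43.
rewrite /airyG; dv.
rewrite /airyG1 (h01_contiguous _ _ p13) (_ : 1 / 3 + 1 = 4 / 3); last by field.
rewrite (_ : 1 / 3 + 2 = 4 / 3 + 1); last by field.
by move: (h01 _ _) (h01 _ _) => u v; field.
Qed.

Lemma is_derive_airyG1 x : is_derive x (1 : R) airyG1 (l * x * airyG x).
Proof.
have h := is_derive_h01 _ (l * x ^+ 3 / 9) p13.
rewrite /airyG1; dv; rewrite /airyG (_ : 1 / 3 + 1 = 4 / 3); last by field.
by move: (h01 _ _) => u; field.
Qed.

Lemma airy_at0 : [/\ airyF 0 = 1, airyF1 0 = 0, airyG 0 = 0 & airyG1 0 = 1].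
Proof.
rewrite /airyF /airyF1 /airyG /airyG1 !expr0n /= !mulr0 !mul0r.
by rewrite !h01_at0.
Qed.

Lemma airy_wronskian x : airyF x * airyG1 x - airyF1 x * airyG x = 1.
Proof.
have [e1 e2 e3 e4] := airy_at0.
rewrite -[RHS](_ : airyF 0 * airyG1 0 - airyF1 0 * airyG 0 = 1); last first.
  by rewrite e1 e2 e4 mul0r subr0 mulr1.
apply: (@is_derive_0_is_cst _ (fun x => airyF x * airyG1 x - airyF1 x * airyG x)) => u.
have h1 := is_derive_airyF; have h2 := is_derive_airyF1.
have h3 := is_derive_airyG; have h4 := is_derive_airyG1.
by dv; ring.
Qed.

End AirySeries.

(** * The truncated Airy integral and variation of constants *)

Section AiryIntegral.
Context {R : realType}.
Local Open Scope classical_set_scope.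
Local Notation F := (@airyF R 1).
Local Notation F1 := (@airyF1 R 1).
Local Notation G := (@airyG R 1).
Local Notation G1 := (@airyG1 R 1).
Implicit Types x t M : R.

Definition airy_phase x t := t ^+ 3 / 3%:R + x * t.

Lemma continuous_dv (f : R -> R) : (forall x, exists d, is_derive x (1 : R) f d) ->
  continuous f.
Proof. by move=> h x; have [d hd] := h x; exact: dv_continuous hd. Qed.

(* Integration by parts once: cos(phase) = (sin(phase)/phase')' + O(phase''/phase'^2). *)
Lemma airy_by_parts (P : R -> R) x M M' : 0 <= M -> M <= M' -> 0 < M ^+ 2 + x ->
  (forall t, M <= t <= M' -> is_derive t (1 : R) P (cos (airy_phase x t))) ->
  `|P M' - P M - (sin (airy_phase x M') / (M' ^+ 2 + x)
                  - sin (airy_phase x M) / (M ^+ 2 + x))|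
    <= (M ^+ 2 + x)^-1 - (M' ^+ 2 + x)^-1.
Proof.
move=> M0 MM' Mx dP.
have pos t : M <= t <= M' -> 0 < t ^+ 2 + x.
  move=> /andP[Mt _]; apply: lt_le_trans Mx _; rewrite lerD2r lerXn2r// nnegrE//.
  exact: le_trans Mt.
pose f t := P t - sin (airy_phase x t) / (t ^+ 2 + x).
pose df t := 2 * t * sin (airy_phase x t) / (t ^+ 2 + x) ^+ 2.
pose dg t := 2 * t / (t ^+ 2 + x) ^+ 2.
rewrite [X in `|X|](_ : _ = f M' - f M); last by rewrite /f; ring.
rewrite [leRHS](_ : _ = - (M' ^+ 2 + x)^-1 - - (M ^+ 2 + x)^-1); last by ring.
apply: (dv_increment_norm_le f (fun t => - (t ^+ 2 + x)^-1) df dg) => //.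
- move=> t tM; have tN : t ^+ 2 + x != 0 by rewrite gt_eqF// pos.
  have h := dP t tM.
  rewrite /f /airy_phase; dv => //; rewrite /df /airy_phase.
  by rewrite /= expr1; field.
- move=> t tM; have tN : t ^+ 2 + x != 0 by rewrite gt_eqF// pos.
  by dv => //; rewrite /dg /= expr1; field.
- move=> t /andP[Mt tM']; have t0 : 0 <= t by apply: le_trans (ltW Mt).
  rewrite /df /dg !normrM (@ger0_norm _ 2)// (ger0_norm t0).
  rewrite (@ger0_norm _ (_^-1)) ?invr_ge0 ?sqr_ge0//.
  rewrite ler_wpM2r ?invr_ge0 ?sqr_ge0//.
  by rewrite ler_piMr ?mulr_ge0// ler_norml sin_geN1 sin_le1.
Qed.

(** The kernel of variation of constants: in [s], the solution of Y'' = s Y that vanishes at [s = x]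
    with slope -1. *)
Definition airy_kernel x s := G x * F s - F x * G s.
Definition airy_kernel1 x s := G x * F1 s - F x * G1 s.

Lemma is_derive_airy_kernel x s : is_derive s (1 : R) (airy_kernel x) (airy_kernel1 x s).
Proof.
have h1 := @is_derive_airyF R 1; have h3 := @is_derive_airyG R 1.
by rewrite /airy_kernel; dv; rewrite /airy_kernel1; ring.
Qed.

Lemma is_derive_airy_kernel1 x s :
  is_derive s (1 : R) (airy_kernel1 x) (s * airy_kernel x s).
Proof.
have h1 := @is_derive_airyF1 R 1; have h3 := @is_derive_airyG1 R 1.
by rewrite /airy_kernel1; dv; rewrite /airy_kernel; ring.
Qed.

(** The integral of cos(t^3/3 + x t) over [0, M] satisfies Y'' - x Y = - sin(M^3/3 + x M). This is
    the kernel times that sine, integrated over [0, x] and rescaled to [0, 1], so that x may have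
    either sign. *)
Definition airy_defect x M :=
  (\int[lebesgue_measure]_(r in `[0%R, 1%R])
     (x * airy_kernel x (x * r) * sin (M ^+ 3 / 3%:R + x * r * M)))%R.

(** Differentiating in M replaces two differentiations in x: as the kernel solves the Airy equation,
    the M-derivative of the integrand is an exact derivative in r, with primitive [Q]. *)
Lemma airy_defect_derive x M : is_derive M (1 : R) (airy_defect x)
  (cos (M ^+ 3 / 3%:R) * F x - M * sin (M ^+ 3 / 3%:R) * G x
   - cos (airy_phase x M)).
Proof.
have hK := is_derive_airy_kernel x; have hK1 := is_derive_airy_kernel1 x.
pose f m r := x * airy_kernel x (x * r) * sin (m ^+ 3 / 3%:R + x * r * m).
pose f1 m r := x * airy_kernel x (x * r) * (cos (m ^+ 3 / 3%:R + x * r * m) * (m ^+ 2 + x * r)).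
have df m r : is_derive m (1 : R) (f ^~ r) (f1 m r).
  rewrite /f /=; dv; rewrite /f1.
  by move: (airy_kernel _ _) (cos _) (sin _) => u v w; field.
have cf m : continuous (f m).
  by apply: continuous_dv => r; eexists; rewrite /f; dv; reflexivity.
have cf1 m : continuous (f1 m).
  by apply: continuous_dv => r; eexists; rewrite /f1; dv; reflexivity.
have ck : continuous (fun r => airy_kernel x (x * r)).
  by apply: continuous_dv => r; eexists; dv; reflexivity.
have [c c01 hc] := @EVT_max R (fun r => `|airy_kernel x (x * r)|) 0 1 ler01
  (continuous_subspaceT (fun r => continuous_comp (ck r) (@norm_continuous _ _ _))).
pose C := `|x| * `|airy_kernel x (x * c)| * ((`|M| + 1) ^+ 2 + `|x|).
have C0 : 0 <= C by rewrite !mulr_ge0// addr_ge0// sqr_ge0.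
have p1 m r : partial1of2 f m r = f1 m r.
  by rewrite partial1of2E; have [_ ->] := df m r.
have II : `](M - 1)%R, (M + 1)%R[ M by rewrite /= in_itv /=; lra.
have mB : measurable (`[0%R, 1%R] : set R) by [].
have H1 m : `](M - 1)%R, (M + 1)%R[ m ->
    (@lebesgue_measure R).-integrable `[0%R, 1%R] (EFin \o f m).
  by move=> _; exact: continuous_integrable_segment.
have H2 m r : `](M - 1)%R, (M + 1)%R[ m -> `[0%R, 1%R] r -> derivable (f ^~ r) m 1.
  by move=> _ _; have [] := df m r.
have H3 : (@lebesgue_measure R).-integrable `[0%R, 1%R] (EFin \o (fun=> C)).
  by apply: continuous_integrable_segment; exact: cst_continuous.
have H4 m r : `](M - 1)%R, (M + 1)%R[ m -> `[0%R, 1%R] r -> `|partial1of2 f m r| <= C.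
  rewrite /= !in_itv /= => /andP[m1 m2] /andP[r0 r1].
  rewrite p1 /f1 /C !normrM; apply: ler_pM => //; rewrite ?mulr_ge0//.
    by rewrite ler_wpM2l// hc// in_itv /= r0.
  apply: (@le_trans _ _ (1 * `|m ^+ 2 + x * r|)).
    by rewrite ler_wpM2r// ler_norml cos_geN1 cos_le1.
  rewrite mul1r; apply: le_trans (ler_normD _ _) _; apply: lerD.
    rewrite normrX lerXn2r ?nnegrE ?addr_ge0//.
    have -> : m = M + (m - M) by ring.
    apply: le_trans (ler_normD _ _) _; rewrite lerD2l ler_norml; lra.
  by rewrite normrM ler_piMr// ger0_norm.
have hd := @derivable_under_integral R _ (measurableTypeR R) (@lebesgue_measure R) f _
  mB M (M - 1) (M + 1) II H1 H2 (fun=> C) (fun=> C0) H3 H4.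
have he := @differentiation_under_integral R _ (measurableTypeR R) (@lebesgue_measure R) f _
  mB M (M - 1) (M + 1) II H1 H2 (fun=> C) (fun=> C0) H3 H4.
apply: (dv_eq _ _ _ _ (derivableP hd)); rewrite -derive1E he.
under eq_Rintegral do rewrite p1.
have [e1 e2 e3 e4] := @airy_at0 R 1.
have wr := airy_wronskian 1 x.
pose Q r := - (airy_kernel x (x * r) * (- M * sin (M ^+ 3 / 3%:R + x * r * M))
   - airy_kernel1 x (x * r) * cos (M ^+ 3 / 3%:R + x * r * M)).
have dQ r : is_derive r (1 : R) Q (f1 M r).
  rewrite /Q; dv; rewrite /f1.
  by move: (airy_kernel _ _) (airy_kernel1 _ _) (cos _) (sin _) => u u1 v w; ring.
rewrite (Rintegral_dv (f1 M) Q 0 1 ler01 (cf1 M) (fun r _ => dQ r)) /Q.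
rewrite !mulr1 !mulr0 !mul0r addr0 /airy_kernel /airy_kernel1.
rewrite /airy_phase e1 e2 e3 e4.
have wr' : G x * F1 x - F x * G1 x = - 1 by rewrite -[in RHS]wr; ring.
rewrite wr'; move: (cos _) (sin _) (cos _) (sin _) => u v w q; ring.
Qed.

(** In r the sine oscillates with frequency x M, so one integration by parts gains a factor 1/M. *)
Lemma airy_defect_bound x : exists C, forall M, 0 < M -> `|airy_defect x M| <= C / M.
Proof.
have hK := is_derive_airy_kernel x; have hK1 := is_derive_airy_kernel1 x.
have ck : continuous (fun r => x * airy_kernel1 x (x * r)).
  by apply: continuous_dv => r; eexists; dv; reflexivity.
have [c c01 hc] := @EVT_max R (fun r => `|x * airy_kernel1 x (x * r)|) 0 1 ler01
  (continuous_subspaceT (fun r => continuous_comp (ck r) (@norm_continuous _ _ _))).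
pose C := `|x * airy_kernel1 x (x * c)|.
exists (C + `|airy_kernel x x| + `|airy_kernel x 0|) => M M0.
pose f r := x * airy_kernel x (x * r) * sin (M ^+ 3 / 3%:R + x * r * M).
have cf : continuous f.
  by apply: continuous_dv => r; eexists; rewrite /f; dv; reflexivity.
have [P hP] := exists_antiderivative _ cf.
have -> : airy_defect x M = P 1 - P 0.
  apply: Rintegral_dv => // u /andP[u0 _]; apply: hP.
  by apply: lt_le_trans u0; rewrite oppr_lt0.
have MN : M != 0 by rewrite gt_eqF.
pose q r := airy_kernel x (x * r) * cos (M ^+ 3 / 3%:R + x * r * M) / M.
have : `|(P 1 + q 1) - (P 0 + q 0)| <= C / M * 1 - C / M * 0.
  apply: (dv_increment_norm_le (fun r => P r + q r) (fun r => C / M * r)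
    (fun r => x * airy_kernel1 x (x * r) * cos (M ^+ 3 / 3%:R + x * r * M) / M)
    (fun=> C / M)) => //.
  - move=> r /andP[r0 r1]; have h : is_derive r (1 : R) P (f r).
      by apply: hP; apply: lt_le_trans r0; rewrite oppr_lt0.
    rewrite /q; dv; rewrite /f.
    by move: (airy_kernel _ _) (airy_kernel1 _ _) (cos _) (sin _) => u u1 v w; field.
  - by move=> r _; dv; ring.
  - move=> r /andP[r0 r1]; rewrite normrM (@ger0_norm _ M^-1) ?invr_ge0 ?(ltW M0)//.
    rewrite ler_pM2r ?invr_gt0// normrM.
    apply: (@le_trans _ _ `|x * airy_kernel1 x (x * r)|).
      by rewrite ler_piMr// ler_norml cos_geN1 cos_le1.
    by apply: hc; rewrite in_itv /= !ltW.
rewrite mulr1 mulr0 subr0 => h.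
have -> : P 1 - P 0 = (P 1 + q 1 - (P 0 + q 0)) - q 1 + q 0 by ring.
have hq y z : `|airy_kernel x y * cos z / M| <= `|airy_kernel x y| / M.
  rewrite !normrM (@ger0_norm _ M^-1) ?invr_ge0 ?(ltW M0)// ler_pM2r ?invr_gt0//.
  by rewrite ler_piMr// ler_norml cos_geN1 cos_le1.
apply: le_trans (ler_normD _ _) _; rewrite !mulrDl; apply: lerD; last first.
  by rewrite /q mulr0; exact: hq.
apply: le_trans (ler_normB _ _) _; apply: lerD => //.
by rewrite /q mulr1; exact: hq.
Qed.

End AiryIntegral.

(** * The Airy integral as a combination of the series solutions *)

Section AiryRepresentation.
Context {R : realType}.
Local Open Scope classical_set_scope.
Local Notation F := (@airyF R 1).
Local Notation F1 := (@airyF1 R 1).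
Local Notation G := (@airyG R 1).
Local Notation G1 := (@airyG1 R 1).
Implicit Types x t M : R.

Lemma cos_ge_quadratic x : 0 <= x -> 1 - x ^+ 2 / 2 <= cos x.
Proof.
move=> x0.
have hs t : 0 <= t -> sin t <= t.
  move=> t0; have := @dv_increment_le R sin (fun y => y) cos (fun=> 1) 0 t t0.
  rewrite sin0 !subr0; apply => u _; exact: cos_le1.
have := @dv_increment_le R (fun y => - (y ^+ 2 / 2)) cos (fun y => - y) (fun y => - sin y) 0 x x0.
rewrite cos0 => h.
suff : - (x ^+ 2 / 2) - - (0 ^+ 2 / 2) <= cos x - 1 by rewrite expr0n /= mul0r oppr0 subr0; lra.
apply: h => u.
- by move=> _; dv; rewrite /= expr1; field.
- by move=> /andP[u0 _]; rewrite lerN2 hs// ltW.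
Qed.

(** The coefficients are the improper integrals of cos(t^3/3) and of -t sin(t^3/3), the value and
    the formal slope at 0. The last clause, from one integration by parts on [0, M], is the decay
    that singles out this solution. *)
Lemma airy_representation : exists al be : R, [/\ 0 < al,
  (forall x, pi * Ai x = al * F x + be * G x) &
  (forall x, 0 < x -> `|al * F x + be * G x| <= x^-1)].
Proof.
have cf x : continuous (fun t => cos (airy_phase x t)).
  by apply: continuous_dv => r; eexists; rewrite /airy_phase; dv; reflexivity.
pose P x := sval (cid (exists_antiderivative _ (cf x))).
have hP x t : -1 < t -> is_derive t (1 : R) (P x) (cos (airy_phase x t)).
  exact: (svalP (cid (exists_antiderivative _ (cf x))) t).
have cq : continuous (fun t => - t * sin (airy_phase 0 t)).
  by apply: continuous_dv => r; eexists; rewrite /airy_phase; dv; reflexivity.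
have [q hq] := exists_antiderivative _ cq.
have m1 t : 0 <= t -> -1 < t by apply: lt_le_trans; rewrite oppr_lt0.
pose Ph x M := P x M - P x 0.
have s1 t : `|sin t| <= 1 by rewrite ler_norml sin_geN1 sin_le1.
have byp x M M' : 0 <= M -> M <= M' -> 0 < M ^+ 2 + x ->
    `|Ph x M' - Ph x M| <= 2 / (M ^+ 2 + x).
  move=> M0 MM' Mx.
  have M'x : 0 < M' ^+ 2 + x.
    by apply: lt_le_trans Mx _; rewrite lerD2r lerXn2r// nnegrE// (le_trans M0).
  have := @airy_by_parts R (P x) x M M' M0 MM' Mx.
  move=> /(_ (fun t ht => hP x t (m1 t (le_trans M0 (proj1 (andP ht)))))).
  set A := sin _ / (M' ^+ 2 + x); set B := sin _ / _ => h.
  have hA : `|A| <= (M' ^+ 2 + x)^-1.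
    rewrite /A normrM (@ger0_norm _ (_^-1)) ?invr_ge0 ?(ltW M'x)//.
    by rewrite ler_piMl// invr_ge0 ltW.
  have hB : `|B| <= (M ^+ 2 + x)^-1.
    rewrite /B normrM (@ger0_norm _ (_^-1)) ?invr_ge0 ?(ltW Mx)//.
    by rewrite ler_piMl// invr_ge0 ltW.
  have -> : Ph x M' - Ph x M = (P x M' - P x M - (A - B)) + (A - B).
    by rewrite /Ph; ring.
  apply: le_trans (ler_normD _ _) _.
  have := ler_normB A B; lra.
have ale1 M : 1 <= M -> 2 / (M ^+ 2 + 0) <= 2 / M.
  move=> M1; have M0 : 0 < M by apply: lt_le_trans M1.
  rewrite addr0 ler_pM2l// lef_pV2 ?posrE ?exprn_gt0// expr2.
  by rewrite ler_pMl.
have [al hal] : exists l : R, Ph 0 M @[M --> +oo] --> l.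
  apply: (@cauchy_cvg_pinfty _ _ 1 2) => M M' M1 MM'.
  apply: le_trans (ale1 _ M1); apply: byp => //.
    exact: le_trans M1.
  by rewrite addr0 exprn_gt0// (lt_le_trans _ M1).
have [be hbe] : exists l : R, q M - q 0 @[M --> +oo] --> l.
  apply: (@cauchy_cvg_pinfty _ _ 1 2) => M M' M1 MM'.
  have M0 : 0 < M by apply: lt_le_trans M1.
  have M'0 : 0 < M' by apply: lt_le_trans MM'.
  (* -t sin(t^3/3) = (cos(t^3/3)/t)' + cos(t^3/3)/t^2, whose last term is integrable at infinity. *)
  pose u t := cos (airy_phase 0 t) / t.
  have : `|(q M' - u M') - (q M - u M)| <= - M'^-1 - - M^-1.
    apply: (dv_increment_norm_le (fun t => q t - u t) (fun t => - t^-1)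
       (fun t => cos (airy_phase 0 t) / t ^+ 2) (fun t => 1 / t ^+ 2)) => // t.
    - move=> /andP[Mt _]; have t0 : 0 < t by apply: lt_le_trans Mt.
      have tN : t != 0 by rewrite gt_eqF.
      have h : is_derive t (1 : R) q (- t * sin (airy_phase 0 t)).
        by apply: hq; apply: m1; exact: ltW.
      rewrite /u /airy_phase; dv => //; rewrite /airy_phase.
      by move: (sin _) (cos _) => a b; field.
    - move=> /andP[Mt _]; have t0 : 0 < t by apply: lt_le_trans Mt.
      have tN : t != 0 by rewrite gt_eqF.
      by dv => //; field.
    - move=> /andP[Mt _]; have t0 : 0 < t by apply: lt_trans Mt.
      rewrite normrM (@ger0_norm _ (_^-1)) ?invr_ge0 ?sqr_ge0//.
      by rewrite ler_wpM2r ?invr_ge0 ?sqr_ge0// ler_norml cos_geN1 cos_le1.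
  have hu t : 0 < t -> `|u t| <= t^-1.
    move=> t0; rewrite normrM (@ger0_norm _ (_^-1)) ?invr_ge0 ?(ltW t0)//.
    by rewrite ler_piMl ?invr_ge0 ?(ltW t0)// ler_norml cos_geN1 cos_le1.
  move=> h; have -> : q M' - q 0 - (q M - q 0) =
     (q M' - u M') - (q M - u M) + (u M' - u M) by ring.
  apply: le_trans (ler_normD _ _) _.
  have := ler_normB (u M') (u M); have := hu _ M0; have := hu _ M'0; lra.
have eqD x M : 0 <= M -> Ph x M = Ph 0 M * F x + (q M - q 0) * G x - airy_defect x M.
  move=> M0.
  (* D is constant: by [airy_defect_derive] the derivatives of its four terms cancel. *)
  pose D t := P x t - P 0 t * F x - q t * G x + airy_defect x t.
  have : D 0 = D M.
    apply: dv_cst_eq => // t /andP[t0 _].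
    have h1 := hP x t (m1 t t0); have h2 := hP 0 t (m1 t t0).
    have h3 := hq t (m1 t t0); have h4 := airy_defect_derive x t.
    rewrite /D; dv; rewrite /airy_phase mul0r addr0.
    by move: (sin _) (cos _) (cos _) => a b c; ring.
  have d0 : airy_defect x 0 = 0.
    rewrite /airy_defect -[RHS](subrr (0 : R)).
    have c0 : continuous (fun r => x * airy_kernel x (x * r) * sin ((0 : R) ^+ 3 / 3%:R + x * r * 0)).
      have hK := is_derive_airy_kernel x.
      by apply: continuous_dv => r; eexists; dv; reflexivity.
    apply: (Rintegral_dv _ (fun=> 0) 0 1 ler01 c0) => u _.
    apply: (dv_eq _ _ _ _ (dv_cst 0 u)).
    by rewrite expr0n /= mul0r mulr0 addr0 sin0 mulr0.
  by rewrite /D d0 /Ph addr0; lra.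
have cvx x : Ph x M @[M --> +oo] --> al * F x + be * G x.
  have [C hC] := airy_defect_bound x.
  have d0 : airy_defect x M @[M --> +oo] --> (0 : R).
    apply/cvgrPdist_le => e e0; near=> M.
    have M0 : 0 < M by near: M; apply: nbhs_pinfty_gt; exact: num_real.
    have MC : (`|C| + 1) / e <= M by near: M; apply: nbhs_pinfty_ge; exact: num_real.
    rewrite sub0r normrN; apply: le_trans (hC M M0) _.
    rewrite ler_pdivrMr//; move: MC; rewrite ler_pdivrMr//.
    have := ler_norm C; lra.
  have : Ph 0 M * F x + (q M - q 0) * G x - airy_defect x M @[M --> +oo] --> al * F x + be * G x - 0.
    apply: cvgB d0; apply: cvgD; exact: cvgMl.
  rewrite subr0; apply: cvg_trans; apply: near_eq_cvg; near=> M.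
  apply/esym/eqD; near: M; apply: nbhs_pinfty_ge; exact: num_real.
exists al, be; split.
(* Positivity of [al]: the integral over [0, 3/2] is at least that of 1 - t^6/18, about 1.364, and
   the rest is at most 2/(3/2)^2 = 8/9 in absolute value. *)
- have lb : Ph 0 (3 / 2) - 8 / 9 <= al.
    rewrite -(cvg_lim _ hal)//; apply: limr_ge; first exact: cvgP hal.
    near=> M.
    have MM : 3 / 2 <= M by near: M; apply: nbhs_pinfty_ge; exact: num_real.
    have := byp 0 (3 / 2) M ltac:(lra) MM ltac:(lra).
    rewrite ler_norml => /andP[+ _].
    have -> : 2 / ((3 / 2) ^+ 2 + 0) = 8 / 9 :> R by field.
    lra.
  have h : (3 / 2 - (3 / 2) ^+ 7 / 126) - (0 - 0 ^+ 7 / 126) <= P 0 (3 / 2) - P 0 0.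
    apply: (dv_increment_le (fun t => t - t ^+ 7 / 126) (P 0) (fun t => 1 - t ^+ 6 / 18)
       (fun t => cos (airy_phase 0 t))); first lra.
    + by move=> t _; dv; rewrite /=; field.
    + by move=> t /andP[t0 _]; apply: hP; exact: m1.
    + move=> t /andP[t0 _]; rewrite /airy_phase mul0r addr0.
      have t3 : 0 <= t ^+ 3 / 3%:R by rewrite divr_ge0// exprn_ge0// ltW.
      by have := cos_ge_quadratic _ t3; have -> : (t ^+ 3 / 3%:R) ^+ 2 / 2 = t ^+ 6 / 18 by field.
  move: h; rewrite expr0n /= mul0r subr0 subr0 -/(Ph 0 (3 / 2)); lra.
- move=> x; rewrite /Ai mulrA divff ?gt_eqF ?pi_gt0// mul1r.
  apply/cvg_lim => //; have := cvx x; apply: cvg_trans; apply: near_eq_cvg; near=> M.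
  have M0 : 0 <= M by near: M; apply: nbhs_pinfty_ge; exact: num_real.
  apply/esym/Rintegral_dv => //; first exact: cf.
  by move=> t /andP[t0 _]; apply: hP; exact: m1.
- move=> x x0; have cn : `|Ph x M| @[M --> +oo] --> `|al * F x + be * G x|.
    exact: cvg_norm (cvx x).
  rewrite -(cvg_lim _ cn)//; apply: limr_le; first exact: cvgP cn.
  near=> M; have M0 : 0 <= M by near: M; apply: nbhs_pinfty_ge; exact: num_real.
  have x00 : 0 < 0 ^+ 2 + x by rewrite expr0n add0r.
  have := @airy_by_parts R (P x) x 0 M (lexx _) M0 x00.
  move=> /(_ (fun t ht => hP x t (m1 t (proj1 (andP ht))))).
  have z1 : airy_phase x 0 = 0 by rewrite /airy_phase expr0n /= mul0r mulr0 addr0.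
  have z2 : 0 ^+ 2 + x = x by rewrite expr0n add0r.
  rewrite z1 z2 sin0 mul0r subr0 -/(Ph x M).
  set A := sin _ / _.
  have Mx : 0 < M ^+ 2 + x by rewrite ltr_wpDl// sqr_ge0.
  have hA : `|A| <= (M ^+ 2 + x)^-1.
    rewrite /A normrM (@ger0_norm _ (_^-1)) ?invr_ge0 ?(ltW Mx)//.
    by rewrite ler_piMl// invr_ge0 ltW.
  move=> h; have -> : Ph x M = (Ph x M - A) + A by ring.
  by apply: le_trans (ler_normD _ _) _; lra.
Unshelve. all: by end_near. Qed.

End AiryRepresentation.

(** * The solution bounded on the negative half-line *)

Section AiryDecaying.
Context {R : realType}.
Local Notation r := (2 `^ (1 / 3) : R).
Local Notation F := (@airyF R (- 2)).
Local Notation F1 := (@airyF1 R (- 2)).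
Local Notation G := (@airyG R (- 2)).
Local Notation G1 := (@airyG1 R (- 2)).
Implicit Types s x : R.

Lemma cbrt2_gt0 : 0 < r. Proof. exact: powR_gt0. Qed.

Lemma cbrt2_cube : r ^+ 3 = 2.
Proof.
by rewrite -powR_mulrn ?powR_ge0// -powRrM mul1r mulVf// powRr1.
Qed.

Definition airyV (sg s : R) := F s + sg * G s.
Definition airyV1 (sg s : R) := F1 s + sg * G1 s.

Lemma is_derive_airyV sg s : is_derive s (1 : R) (airyV sg) (airyV1 sg s).
Proof.
have h1 := @is_derive_airyF R (- 2); have h2 := @is_derive_airyG R (- 2).
by rewrite /airyV; dv; rewrite /airyV1; ring.
Qed.

Lemma is_derive_airyV1 sg s : is_derive s (1 : R) (airyV1 sg) (- 2 * s * airyV sg s).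
Proof.
have h1 := @is_derive_airyF1 R (- 2); have h2 := @is_derive_airyG1 R (- 2).
by rewrite /airyV1; dv; rewrite /airyV; ring.
Qed.

Lemma airyV_neq0 sg s : airyV sg s = 0 -> airyV1 sg s != 0.
Proof.
move=> V0; apply/eqP => V10; have := airy_wronskian (- 2) s.
have e1 : F s = - sg * G s by move: V0; rewrite /airyV; lra.
have e2 : F1 s = - sg * G1 s by move: V10; rewrite /airyV1; lra.
rewrite e1 e2 => h.
have : (0 : R) = 1 by rewrite -h; ring.
by move/eqP; rewrite eq_sym oner_eq0.
Qed.

(** For s < 0, (V V')' = V'^2 - 2 s V^2 > 0. If V V' were nonpositive at some s <= 0, it would stay
    below a negative constant further left, and V^2 would be unbounded there. *)
Lemma airyV_bounded_pos sg C : (forall s, s <= - 1 -> `|airyV sg s| <= C) ->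
  forall s, s <= 0 -> 0 < airyV sg s /\ 0 < airyV1 sg s.
Proof.
move=> hC; set V := airyV sg; set V1 := airyV1 sg.
have hV := is_derive_airyV sg; have hV1 := is_derive_airyV1 sg.
have dVV s : is_derive s (1 : R) (fun s => V s * V1 s) (V1 s ^+ 2 - 2 * s * V s ^+ 2).
  by rewrite /V /V1; dv; ring.
have dV2 s : is_derive s (1 : R) (fun s => - V s ^+ 2) (- (2 * (V s * V1 s))).
  by rewrite /V /V1; dv; rewrite /= expr1; ring.
have pos s : s <= 0 -> 0 < V s * V1 s.
  move=> s0; rewrite ltNge; apply/negP => VV.
  have incr u v : u < v -> v <= 0 -> V u * V1 u < V v * V1 v.
    move=> uv v0; apply: (increasing_dv (fun s => V s * V1 s) _ u v uv) => // w /andP[uw wv].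
    have w0 : w < 0 by apply: lt_le_trans v0.
    have [e|e] := eqVneq (V w) 0.
      by rewrite e expr0n /= mulr0 subr0 exprn_even_gt0//= airyV_neq0.
    rewrite ltr_wpDl ?sqr_ge0// oppr_gt0 nmulr_rlt0 ?exprn_even_gt0//; lra.
  have s1 : s - 1 < s by lra.
  have := incr (s - 1) s s1 s0; set d := _ * _ => hd.
  have d0 : d < 0 by apply: lt_le_trans hd _.
  (* Left of s - 1 the function - V^2 has slope at least -2d > 0, so over this length V^2 would
     exceed C^2. *)
  pose t := Num.min (s - 2) (s - 1 + (C ^+ 2 + 1) / (2 * d)).
  have ts : t <= s - 2 by rewrite /t ge_min lexx.
  have tC : t <= s - 1 + (C ^+ 2 + 1) / (2 * d) by rewrite /t ge_min lexx orbT.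
  have ts1 : t <= s - 1 by lra.
  have : (- (2 * d)) * (s - 1) - (- (2 * d)) * t <= - V (s - 1) ^+ 2 - - V t ^+ 2.
    apply: (dv_increment_le (fun u => - (2 * d) * u) (fun u => - V u ^+ 2)
      (fun=> - (2 * d)) (fun u => - (2 * (V u * V1 u)))) => //.
    + by move=> u _; dv; ring.
    + move=> u /andP[tu us]; rewrite lerN2 ler_pM2l// ltW// incr//; lra.
  have hV2 : V t ^+ 2 <= C ^+ 2.
    have := hC t ltac:(lra); rewrite -/(V t) => h.
    rewrite -[leLHS](real_normK (num_real _)) lerXn2r ?nnegrE//.
    exact: le_trans h.
  have := sqr_ge0 (V (s - 1)).
  have : - (2 * d) * (s - 1 - t) >= C ^+ 2 + 1.
    rewrite mulrC -ler_pdivrMr ?oppr_gt0; last by lra.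
    rewrite invrN mulrN; lra.
  lra.
have V0 : V 0 = 1.
  have [e1 e2 e3 e4] := @airy_at0 R (- 2).
  by rewrite /V /airyV e1 e3 mulr0 addr0.
move=> s s0; have Vs : 0 < V s.
  rewrite ltNge; apply/negP => Vs.
  have [||||z [z0 zu Vz _]] := first_zero (fun u => V (- u)) 0 (- s).
  - by rewrite oppr_ge0.
  - move=> u _; have h : is_derive u (1 : R) (fun u => V (- u)) (- V1 (- u)).
      by rewrite /V; dv; rewrite mulrN1.
    exact: dv_continuous h.
  - by rewrite oppr0 V0.
  - by rewrite opprK.
  - by have := pos (- z) ltac:(lra); rewrite Vz mul0r ltxx.
by split => //; have := pos s s0; rewrite pmulr_rgt0.
Qed.

Lemma airy_decaying : exists sg, (forall x, Ai x = 0 <-> airyV sg (- x / r) = 0) /\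
  (forall s, s <= 0 -> 0 < airyV sg s /\ 0 < airyV1 sg s).
Proof.
have [al [be [al0 hAi hb]]] := @airy_representation R.
have r0 := cbrt2_gt0; have r3 := cbrt2_cube.
have rN : r != 0 by rewrite gt_eqF.
have alN : al != 0 by rewrite gt_eqF.
pose sg := - be * r / al; exists sg.
have e x : al * airyF 1 x + be * airyG 1 x = al * airyV sg (- x / r).
  have ez : 1 * x ^+ 3 / 9 = - 2 * (- x / r) ^+ 3 / 9.
    by rewrite expr_div_n r3; field.
  rewrite /airyV /airyF /airyG ez /sg.
  move: (h01 _ _) (h01 _ _) => u v; move: rN; move: r => c cN.
  by field; rewrite cN alN.
split=> [x|].
  have pN : pi != 0 :> R by rewrite gt_eqF// pi_gt0.
  have := hAi x; rewrite e => h; split => h0.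
    move: h; rewrite h0 mulr0 => /esym/eqP; rewrite mulf_eq0 (negbTE alN) /= => /eqP.
    by [].
  by move: h; rewrite h0 mulr0 => /eqP; rewrite mulf_eq0 (negbTE pN) /= => /eqP.
(* For s <= -1 the point x = - r s is at least r, so the bound 1/x on al V(s) becomes 1/r. *)
apply: (airyV_bounded_pos _ (al * r)^-1) => s s1.
have x0 : 0 < - (r * s) by rewrite oppr_gt0 pmulr_rlt0//; lra.
have := hb (- (r * s)) x0; rewrite e.
have -> : - - (r * s) / r = s by rewrite opprK mulrAC divff// mul1r.
rewrite normrM (gtr0_norm al0) -ler_pdivlMl// => h; apply: (le_trans h).
rewrite -invfM lef_pV2 ?posrE ?mulr_gt0//.
rewrite ler_pM2l// -mulrN ler_peMr ?(ltW r0)//; lra.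
Qed.

End AiryDecaying.

(** * Interval enclosures and the constant a *)

(* Locked, so that unification never unfolds a binary literal into unary. *)
HB.lock Definition zr {R : realType} (z : Z) : R := (int_of_Z z)%:~R.

Section IntervalArithmetic.
Context {R : realType}.
Local Notation zr := (@zr R).

Lemma zrD x y : zr (x + y)%Z = zr x + zr y.
Proof. by rewrite !zr.unlock -intrD; congr (_%:~R); lia. Qed.

Lemma zrN x : zr (- x)%Z = - zr x.
Proof. by rewrite !zr.unlock -mulrNz; congr (_%:~R); lia. Qed.

Lemma zrM x y : zr (x * y)%Z = zr x * zr y.
Proof. by rewrite !zr.unlock -intrM; congr (_%:~R); lia. Qed.

Lemma zr_le x y : (x <= y)%Z -> zr x <= zr y.
Proof. by move=> xy; rewrite !zr.unlock ler_int; lia. Qed.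

Lemma zr_gt0 x : (0 < x)%Z -> 0 < zr x.
Proof. by move=> x0; rewrite zr.unlock ltr0z; lia. Qed.

Lemma zr_nat m : zr (Z.of_nat m) = m%:R.
Proof. by rewrite zr.unlock (_ : int_of_Z _ = m) //; lia. Qed.

Lemma zr_lit p n : Pos.to_nat p = n -> zr (Zpos p) = n%:R.
Proof. by move=> <-; rewrite zr.unlock. Qed.

Lemma zr0 : zr 0 = 0. Proof. exact: (zr_nat 0). Qed.
Lemma zr1 : zr 1 = 1. Proof. exact: (zr_nat 1). Qed.
Lemma zr2 : zr 2 = 2. Proof. exact: (zr_nat 2). Qed.

(* Intervals with endpoints in S^-1 Z, rounded outwards. *)
Variable iv_scale : Z.
Hypothesis iv_scale_gt0 : (0 < iv_scale)%Z.

Definition iv_mem (x : R) (i : Z * Z) : Prop :=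
  zr i.1 <= x * zr iv_scale /\ x * zr iv_scale <= zr i.2.

Definition iv_cst (n : Z) : Z * Z := (n * iv_scale, n * iv_scale)%Z.

Definition iv_add (i j : Z * Z) : Z * Z := (i.1 + j.1, i.2 + j.2)%Z.

(** Division in Z rounds down, so the upper endpoint is rounded up by negating twice; a negative p
    exchanges the endpoints. *)
Definition iv_mulq (p q : Z) (i : Z * Z) : Z * Z :=
  if (0 <=? p)%Z then (i.1 * p / q, - (- (i.2 * p) / q))%Z
  else (i.2 * p / q, - (- (i.1 * p) / q))%Z.

Lemma iv_cstP n : iv_mem (zr n) (iv_cst n).
Proof. by rewrite /iv_mem /iv_cst /= zrM. Qed.

Lemma iv_cst1P : iv_mem 1 (iv_cst 1).
Proof. by rewrite -{1}zr1; exact: iv_cstP. Qed.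

Lemma iv_addP x y i j : iv_mem x i -> iv_mem y j -> iv_mem (x + y) (iv_add i j).
Proof. by move=> [x1 x2] [y1 y2]; rewrite /iv_mem /iv_add /= !zrD mulrDl !lerD. Qed.

Lemma zr_div_le x q : (0 < q)%Z -> zr (x / q)%Z <= zr x / zr q.
Proof.
move=> q0; rewrite ler_pdivlMr ?zr_gt0// -zrM; apply: zr_le.
by rewrite Z.mul_comm; apply: Z.mul_div_le.
Qed.

Lemma iv_mulqP p q x i : (0 < q)%Z -> iv_mem x i ->
  iv_mem (x * (zr p / zr q)) (iv_mulq p q i).
Proof.
move=> q0 [x1 x2]; have q1 := zr_gt0 q q0.
have up y : zr y / zr q <= zr (- (- y / q))%Z.
  by rewrite zrN lerNr; have := zr_div_le (- y) q q0; rewrite zrN mulNr.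
have e : x * (zr p / zr q) * zr iv_scale = (x * zr iv_scale) * zr p / zr q by ring.
rewrite /iv_mem /iv_mulq e; case: (Z.leb_spec 0 p) => p0 /=; split.
- apply: le_trans (zr_div_le _ _ q0) _; rewrite zrM ler_pM2r ?invr_gt0//.
  by rewrite ler_wpM2r// -zr0; apply: zr_le.
- apply: le_trans (up _); rewrite zrM ler_pM2r ?invr_gt0//.
  by rewrite ler_wpM2r// -zr0; apply: zr_le.
- apply: le_trans (zr_div_le _ _ q0) _; rewrite zrM ler_pM2r ?invr_gt0//.
  by rewrite ler_wnM2r// -zr0; apply: zr_le; lia.
- apply: le_trans (up _); rewrite zrM ler_pM2r ?invr_gt0//.
  by rewrite ler_wnM2r// -zr0; apply: zr_le; lia.
Qed.

Lemma zr_scale_gt0 : 0 < zr iv_scale.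
Proof. exact: zr_gt0 iv_scale_gt0. Qed.

Lemma iv_mem_ge x i p q : iv_mem x i -> (0 < q)%Z ->
  (p * iv_scale <= i.1 * q)%Z -> zr p / zr q <= x.
Proof.
move=> [x1 _] q0 h; have s0 := zr_scale_gt0.
rewrite ler_pdivrMr ?zr_gt0// -(ler_pM2r s0) -zrM; apply: le_trans (zr_le _ _ h) _.
by rewrite zrM mulrAC ler_wpM2r// ltW// zr_gt0.
Qed.

Lemma iv_mem_le x i p q : iv_mem x i -> (0 < q)%Z ->
  (i.2 * q <= p * iv_scale)%Z -> x <= zr p / zr q.
Proof.
move=> [_ x2] q0 h; have s0 := zr_scale_gt0.
rewrite ler_pdivlMr ?zr_gt0// -(ler_pM2r s0) -zrM; apply: le_trans (zr_le _ _ h).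
by rewrite zrM mulrAC ler_wpM2r// ltW// zr_gt0.
Qed.

End IntervalArithmetic.

(** * Enclosures of 0F1 with a certified tail *)

Section Hypergeometric01Enclosure.
Context {R : realType}.
Variable S : Z.
Hypothesis S0 : (0 < S)%Z.
Implicit Types (b z : R) (m n : nat).

(** The partial sum from index m, divided by its first coefficient; each step costs one
    multiplication by a rational. *)
Fixpoint h01_horner b z m n : R :=
  if n is n'.+1 then 1 + h01_horner b z m.+1 n' * (z / (m.+1%:R * (b + m%:R))) else 1.

Lemma h01_horner_sum b z m n : 0 < b ->
  h01_coef b m * h01_horner b z m n = \sum_(i < n.+1) h01_coef b (m + i) * z ^+ i.
Proof.
move=> b0; elim: n m => [|n IH] m.
  by rewrite big_ord_recl big_ord0 addr0 expr0 addn0.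
rewrite /= mulrDr mulr1 big_ord_recl addn0 expr0 mulr1; congr (_ + _).
have -> : h01_coef b m * (h01_horner b z m.+1 n * (z / (m.+1%:R * (b + m%:R)))) =
   z * (h01_coef b m.+1 * h01_horner b z m.+1 n) by rewrite h01_coefS; ring.
rewrite IH big_distrr /=; apply: eq_bigr => i _.
by rewrite /bump /= add1n addnS addSn exprS; ring.
Qed.

Variables bp bq zp zq : Z.

Fixpoint h01_iv_sum (m : Z) n : Z * Z :=
  if n is n'.+1 then
    iv_add (iv_cst S 1) (iv_mulq (zp * bq) (zq * ((m + 1) * (bp + m * bq)))
      (h01_iv_sum (m + 1) n'))
  else iv_cst S 1.

Fixpoint h01_iv_term (m : Z) n : Z * Z :=
  if n is n'.+1 then
    iv_mulq (Z.abs zp * bq) (zq * ((m + 1) * (bp + m * bq))) (h01_iv_term (m + 1) n')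
  else iv_cst S 1.

(** The enlargement [t] is the tail bound of [h01_remainder], twice the first omitted term. *)
Definition h01_iv n : Z * Z :=
  let s := h01_iv_sum 0 n in let t := (2 * (h01_iv_term 0 n.+1).2)%Z in
  (s.1 - t, s.2 + t)%Z.

Local Notation b := (zr bp / zr bq : R).
Local Notation z := (zr zp / zr zq : R).

Hypotheses (bp0 : (0 < bp)%Z) (bq0 : (0 < bq)%Z) (zq0 : (0 < zq)%Z).

Let den m : zr (zq * ((Z.of_nat m + 1) * (bp + Z.of_nat m * bq))) =
  zr zq * (m.+1%:R * (zr bp + m%:R * zr bq)) :> R.
Proof. by rewrite !(zrM, zrD) !zr_nat zr1 -natr1. Qed.

Let mult m (y : R) : zr bq != 0 :> R -> (zr zq != 0 :> R) ->
  zr bp + m%:R * zr bq != 0 :> R ->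
  y / zr zq / (m.+1%:R * (b + m%:R)) = y * zr bq / (zr zq * (m.+1%:R * (zr bp + m%:R * zr bq))).
Proof.
move=> q1 z1 d1; have m1 : m.+1%:R != 0 :> R by rewrite pnatr_eq0.
have -> : b + m%:R = (zr bp + m%:R * zr bq) / zr bq by field.
have alg (u v w q : R) : u != 0 -> v != 0 -> w != 0 -> q != 0 ->
  y / w / (q * (u / v)) = y * v / (w * (q * u)).
  by move=> u0 v0 w0 q0; field; rewrite v0 w0 u0 q0.
exact: alg.
Qed.

Let denN m : zr bp + m%:R * zr bq != 0 :> R.
Proof. by rewrite gt_eqF// ltr_wpDr ?zr_gt0// mulr_ge0// ltW// zr_gt0. Qed.

Let den0 (m : nat) : (0 < zq * ((Z.of_nat m + 1) * (bp + Z.of_nat m * bq)))%Z.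
Proof. by apply: Z.mul_pos_pos => //; apply: Z.mul_pos_pos; lia. Qed.

Let succ m : (Z.of_nat m + 1)%Z = Z.of_nat m.+1. Proof. lia. Qed.

Lemma h01_iv_sumP m n : iv_mem S (h01_horner b z m n) (h01_iv_sum (Z.of_nat m) n).
Proof.
have q1 : zr bq != 0 :> R by rewrite gt_eqF// zr_gt0.
have z1 : zr zq != 0 :> R by rewrite gt_eqF// zr_gt0.
elim: n m => [|n IH] m; first exact: iv_cst1P.
rewrite [h01_iv_sum _ _]/= [h01_horner _ _ _ _]/=.
apply: iv_addP; first exact: iv_cst1P.
rewrite mult ?denN// -zrM -den; apply: iv_mulqP => //.
by rewrite succ.
Qed.

Lemma h01_iv_termP m n : 
  iv_mem S (h01_coef b (m + n) * `|z| ^+ n / h01_coef b m) (h01_iv_term (Z.of_nat m) n).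
Proof.
have q1 : zr bq != 0 :> R by rewrite gt_eqF// zr_gt0.
have z1 : zr zq != 0 :> R by rewrite gt_eqF// zr_gt0.
have b0 : 0 < b by rewrite divr_gt0 ?zr_gt0.
elim: n m => [|n IH] m.
  rewrite addn0 mulr1 divff; last by rewrite gt_eqF// h01_coef_gt0.
  exact: iv_cst1P.
rewrite [h01_iv_term _ _]/=.
have -> : h01_coef b (m + n.+1) * `|z| ^+ n.+1 / h01_coef b m =
  (h01_coef b (m.+1 + n) * `|z| ^+ n / h01_coef b m.+1) * (`|z| / (m.+1%:R * (b + m%:R))).
  have e := h01_coefS b m; rewrite addnS addSn exprS.
  have cN : h01_coef b m != 0 by rewrite gt_eqF// h01_coef_gt0.
  have dN : m.+1%:R * (b + m%:R) != 0 by rewrite mulf_neq0// gt_eqF// ltr_wpDr.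
  rewrite e; move: cN dN; move: (h01_coef b m) (_ * (b + _)) (h01_coef _ _) => c d u c0 d0.
  by field; rewrite c0 d0.
have -> : `|z| = zr (Z.abs zp) / zr zq.
  rewrite normrM (@gtr0_norm _ (_^-1)) ?invr_gt0 ?zr_gt0//; congr (_ / _).
  have [p0|p0] := Z.le_gt_cases 0 zp.
    by rewrite Z.abs_eq// ger0_norm// -(@zr0 R); exact: zr_le.
  rewrite Z.abs_neq; last lia.
  by rewrite zrN ler0_norm// -(@zr0 R); apply: zr_le; lia.
rewrite mult ?denN// -zrM -den; apply: iv_mulqP => //.
rewrite succ; have := IH m.+1; rewrite normrM (@gtr0_norm _ (_^-1)) ?invr_gt0 ?zr_gt0//.
have -> // : `|zr zp| = zr (Z.abs zp) :> R.
have [p0|p0] := Z.le_gt_cases 0 zp.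
  by rewrite Z.abs_eq// ger0_norm// -(@zr0 R); exact: zr_le.
rewrite Z.abs_neq; last lia.
by rewrite zrN ler0_norm// -(@zr0 R); apply: zr_le; lia.
Qed.

Lemma h01_ivP n :
  (2 * Z.abs zp * bq <= Z.of_nat n.+2 * (bp + Z.of_nat n.+1 * bq) * zq)%Z ->
  iv_mem S (h01 b z) (h01_iv n).
Proof.
move=> hn; have b0 : 0 < b by rewrite divr_gt0 ?zr_gt0.
have q1 : 0 < zr bq :> R by rewrite zr_gt0.
have z1 : 0 < zr zq :> R by rewrite zr_gt0.
have nz : `|z| = zr (Z.abs zp) / zr zq.
  rewrite normrM (@gtr0_norm _ (_^-1)) ?invr_gt0 ?zr_gt0//; congr (_ / _).
  have [p0|p0] := Z.le_gt_cases 0 zp.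
    by rewrite Z.abs_eq// ger0_norm// -(@zr0 R); exact: zr_le.
  rewrite Z.abs_neq; last lia.
  by rewrite zrN ler0_norm// -(@zr0 R); apply: zr_le; lia.
have := h01_remainder b z n.+1 b0.
have -> : 2 * `|z| <= n.+2%:R * (b + n.+1%:R).
  rewrite nz.
  have -> : b + n.+1%:R = (zr bp + n.+1%:R * zr bq) / zr bq.
    by have q1N := lt0r_neq0 q1; field.
  rewrite [leLHS]mulrA [leRHS]mulrA ler_pdivrMr// mulrAC ler_pdivlMr//.
  by have := @zr_le R _ _ hn; rewrite !(zrM, zrD) !zr_nat zr2.
move=> /(_ isT); set A := h01 _ _ => h.
have [s1 s2] := h01_iv_sumP 0 n.
have [t1 t2] := h01_iv_termP 0 n.+1.
have s0 := @zr_scale_gt0 R S S0.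
have e : h01_sum b z n.+1 = h01_horner b z 0 n.
  have := h01_horner_sum b z 0 n b0; rewrite h01_coef0 mul1r => ->.
  by apply: eq_bigr => i _.
move: t2; rewrite h01_coef0 invr1 mulr1 add0n => t2.
move: h; rewrite e ler_norml => /andP[h1 h2].
have h3 := ler_wpM2r (ltW s0) h1; have h4 := ler_wpM2r (ltW s0) h2.
rewrite /iv_mem /h01_iv; split; cbv beta zeta; cbn [fst snd].
  rewrite zrD zrN zrM zr2.
  by move: s1 t2 h3; rewrite mulrBl; lra.
rewrite zrD zrM zr2.
by move: s2 t2 h4; rewrite mulrBl; lra.
Qed.

End Hypergeometric01Enclosure.

(** The last clause is the ratio condition of [h01_remainder] with denominators cleared. *)
Definition h01_iv_valid (S : Z) (bp bq : nat) (zp zq : Z) (n : nat) : bool :=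
  [&& 0 <? S, 0 <? Z.of_nat bp, 0 <? Z.of_nat bq, 0 <? zq &
   2 * Z.abs zp * Z.of_nat bq <=?
     Z.of_nat n.+2 * (Z.of_nat bp + Z.of_nat n.+1 * Z.of_nat bq) * zq]%Z.

Lemma h01_ge (R : realType) (S : Z) (bp bq : nat) (zp zq : Z) n p q :
  h01_iv_valid S bp bq zp zq n && (0 <? q)%Z &&
    (p * S <=? (h01_iv S (Z.of_nat bp) (Z.of_nat bq) zp zq n).1 * q)%Z ->
  zr p / zr q <= h01 (bp%:R / bq%:R : R) (zr zp / zr zq).
Proof.
case/andP => /andP[/and5P[/Z.ltb_spec0 h1 /Z.ltb_spec0 h2 /Z.ltb_spec0 h3
  /Z.ltb_spec0 h4 /Z.leb_spec0 h5]] /Z.ltb_spec0 h6 /Z.leb_spec0 h7.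
by rewrite -!zr_nat; apply: iv_mem_ge h6 h7 => //; exact: h01_ivP.
Qed.

Lemma h01_le (R : realType) (S : Z) (bp bq : nat) (zp zq : Z) n p q :
  h01_iv_valid S bp bq zp zq n && (0 <? q)%Z &&
    ((h01_iv S (Z.of_nat bp) (Z.of_nat bq) zp zq n).2 * q <=? p * S)%Z ->
  h01 (bp%:R / bq%:R : R) (zr zp / zr zq) <= zr p / zr q.
Proof.
case/andP => /andP[/and5P[/Z.ltb_spec0 h1 /Z.ltb_spec0 h2 /Z.ltb_spec0 h3
  /Z.ltb_spec0 h4 /Z.leb_spec0 h5]] /Z.ltb_spec0 h6 /Z.leb_spec0 h7.
by rewrite -!zr_nat; apply: iv_mem_le h6 h7 => //; exact: h01_ivP.
Qed.

(** Turns binary integer constants into natural literals, the form read by [lra] and [field]. *)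
Ltac zr_simpl := rewrite ?(zrD, zrM, zrN, zr0);
  repeat match goal with |- context [@zr ?R (Zpos ?p)] =>
    let n := eval vm_compute in (Pos.to_nat p) in
    rewrite (@zr_lit R p n (erefl n)) end.

(** * Location of the first Airy zero *)

Section AiryZero.
Context {R : realType}.
Local Notation r := (2 `^ (1 / 3) : R).
Implicit Types s x sg : R.
Local Notation S := (1000000000000000)%Z.

(** At s = -9/2, where -2 s^3/9 = 81/4, V > 0 bounds the slope from above and V' > 0 bounds it from
    below. Both series solutions are large there while V is small, so the bounds agree to six
    digits. Numbers are written in base 100 to keep the natural literals small. *)
Lemma airyV_ratio_bounds sg :
  (forall s, s <= 0 -> 0 < airyV sg s /\ 0 < airyV1 sg s) ->
  (((9 * 100 + 18) * 100 + 49) * 100 + 63) / (10 * 100 * 100 * 100) <= sg <= (((9 * 100 + 18) * 100 + 49) * 100 + 66) / (10 * 100 * 100 * 100).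
Proof.
move=> pos; have [V0 V10] := pos (- (9 / 2)) ltac:(lra).
have z : - 2 * (- (9 / 2)) ^+ 3 / 9 = zr 81 / zr 4 :> R by zr_simpl; field.
have b1 : h01 (1 / 3) (zr 81 / zr 4) <= zr ((((7 * 100 + 77) * 100 + 84) * 100 + 11) * 100 + 10) / zr (10 * 100 * 100) :> R.
  by apply: (h01_le R S 1 3 81 4 40); vm_compute.
have b1' : 0 <= h01 (1 / 3) (zr 81 / zr 4) :> R by zr_simpl; rewrite ltW// h01_gt0.
have b2 : h01 (2 / 3) (zr 81 / zr 4) <= zr ((((2 * 100 + 42) * 100 + 88) * 100 + 25) * 100 + 50) / zr (10 * 100 * 100) :> R.
  by apply: (h01_le R S 2 3 81 4 40); vm_compute.
have b4 : zr (((58 * 100 + 76) * 100 + 33) * 100 + 16) / zr (10 * 100 * 100) <= h01 (4 / 3) (zr 81 / zr 4) :> R.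
  by apply: (h01_ge R S 4 3 81 4 40); vm_compute.
have b5 : zr (((35 * 100 + 28) * 100 + 11) * 100 + 99) / zr (10 * 100 * 100) <= h01 (5 / 3) (zr 81 / zr 4) :> R.
  by apply: (h01_ge R S 5 3 81 4 40); vm_compute.
move: V0 V10 b1 b1' b2 b4 b5; rewrite /airyV /airyV1 /airyF /airyF1 /airyG /airyG1 z.
move: (h01 (1 / 3) _) (h01 (2 / 3) _) (h01 (4 / 3) _) (h01 (5 / 3) _).
move=> h1 h2 h4 h5 V0 V10; zr_simpl => b1 b1' b2 b4 b5.
have h50 : 0 < h5 by lra.
have sg0 : 0 < sg.
  by rewrite ltNge; apply/negP => sg0; have := mulr_le0_ge0 sg0 b1'; lra.
have h1s := ler_wpM2l (ltW sg0) b1; have h4s := ler_wpM2l (ltW sg0) b4.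
by apply/andP; split; lra.
Qed.

(** The two points are 1.85575 and 1.85585, that is 1.8558 with exactly the precision claimed for
    a. *)
Lemma airyV_sign_change sg : (((9 * 100 + 18) * 100 + 49) * 100 + 63) / (10 * 100 * 100 * 100) <= sg <= (((9 * 100 + 18) * 100 + 49) * 100 + 66) / (10 * 100 * 100 * 100) ->
  0 < airyV sg ((74 * 100 + 23) / (40 * 100)) /\ airyV sg (((3 * 100 + 71) * 100 + 17) / (2 * 100 * 100)) < 0.
Proof.
move=> /andP[sg1 sg2].
pose p1 := (- (2 * ((74 * 100 + 23) * ((74 * 100 + 23) * (74 * 100 + 23)))))%Z; pose q1 := (9 * ((40 * 100) * ((40 * 100) * (40 * 100))))%Z.
pose p2 := (- (2 * (((3 * 100 + 71) * 100 + 17) * (((3 * 100 + 71) * 100 + 17) * ((3 * 100 + 71) * 100 + 17)))))%Z; pose q2 := (9 * ((2 * 100 * 100) * ((2 * 100 * 100) * (2 * 100 * 100))))%Z.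
have z1 : - 2 * ((74 * 100 + 23) / (40 * 100)) ^+ 3 / 9 = zr p1 / zr q1 :> R.
  by rewrite /p1 /q1; zr_simpl; field.
have z2 : - 2 * (((3 * 100 + 71) * 100 + 17) / (2 * 100 * 100)) ^+ 3 / 9 = zr p2 / zr q2 :> R.
  by rewrite /p2 /q2; zr_simpl; field.
have a1 : zr (- (((3 * 100 + 69) * 100 + 9) * 100 + 52)) / zr (10 * 100 * 100 * 100) <= h01 (2 / 3) (zr p1 / zr q1) :> R.
  by apply: (h01_ge R S 2 3 p1 q1 15); vm_compute.
have a2 : zr (((2 * 100 + 16) * 100 + 55) * 100 + 18) / zr (10 * 100 * 100 * 100) <= h01 (4 / 3) (zr p1 / zr q1) :> R.
  by apply: (h01_ge R S 4 3 p1 q1 15); vm_compute.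
have a3 : h01 (2 / 3) (zr p2 / zr q2) <= zr (- (((3 * 100 + 69) * 100 + 21) * 100 + 47)) / zr (10 * 100 * 100 * 100) :> R.
  by apply: (h01_le R S 2 3 p2 q2 15); vm_compute.
have a4 : h01 (4 / 3) (zr p2 / zr q2) <= zr (((2 * 100 + 16) * 100 + 46) * 100 + 45) / zr (10 * 100 * 100 * 100) :> R.
  by apply: (h01_le R S 4 3 p2 q2 15); vm_compute.
have a5 : zr 0 / zr 1 <= h01 (4 / 3) (zr p2 / zr q2) :> R.
  by apply: (h01_ge R S 4 3 p2 q2 15); vm_compute.
rewrite /airyV /airyF /airyG z1 z2.
move: a1 a2 a3 a4 a5; move: (h01 (2 / 3) (zr p1 / _)) (h01 (4 / 3) (zr p1 / _)).
move: (h01 (2 / 3) (zr p2 / _)) (h01 (4 / 3) (zr p2 / _)) => u2 v2 u1 v1; zr_simpl.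
move=> a1 a2 a3 a4; rewrite mul0r => a5.
have sg0 : 0 <= sg by lra.
have h1 := ler_wpM2l sg0 a2; have h2 := ler_wpM2r a5 sg2.
by split; lra.
Qed.

(* Two zeros of V in [0, 2] would be at distance less than pi/2, while
   V'' + 4 V has the sign of V there. *)
Lemma airyV_first_zero sg s1 s2 : 9 / 10 <= sg -> sg <= 1 ->
  0 < s1 -> s1 < s2 -> s1 < 2 -> 0 < airyV sg s1 -> airyV sg s2 < 0 ->
  (forall s, s <= 0 -> 0 < airyV sg s /\ 0 < airyV1 sg s) -> exists a,
  [/\ s1 <= a <= s2, airyV sg a = 0, airyV1 sg a < 0 &
    forall s, s < a -> 0 < airyV sg s].
Proof.
move=> sg1 sg2 S0 S12 S2 Vs1 Vs2 pos.
set V := airyV sg; set V1 := airyV1 sg.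
have hV s : is_derive s (1 : R) V (V1 s) by exact: is_derive_airyV.
have hV1 s : is_derive s (1 : R) V1 (- 2 * s * V s) by exact: is_derive_airyV1.
have cV s : {for s, continuous V} by exact: dv_continuous (hV s).
have cV1 s : {for s, continuous V1} by exact: dv_continuous (hV1 s).
have [e1 e2 e3 e4] := @airy_at0 R (- 2).
have V0 : V 0 = 1 by rewrite /V /airyV e1 e3 mulr0 addr0.
have V10 : V1 0 = sg by rewrite /V1 /airyV1 e2 e4 mulr1 add0r.
have [||||a [a0 a2 Va Vpos]] := first_zero V 0 (s2).
- lra.
- by move=> s _.
- by rewrite V0.
- exact: ltW.
have Vall s : s < a -> 0 < V s.
  move=> sa; have [s0|s0] := leP s 0; first by have [] := pos s s0.
  by apply: Vpos; rewrite sa ltW.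
have V1a : V1 a < 0.
  have V1N : V1 a != 0 by exact: airyV_neq0.
  rewrite lt_neqAle V1N /= leNgt; apply/negP => V1p.
  have : \forall s \near a, 0 < V1 s by exact: (cvgr_gt _ (cV1 a)).
  move=> [d /= d0 hd].
  have : V (a - d / 2) < V a.
    apply: (increasing_dv V V1) => [|s /andP[t1 t2]]; first by lra.
    by apply: hd; rewrite /= gtr0_norm; lra.
  rewrite Va ltNge ltW// Vall//; lra.
exists a; split => //; rewrite a2 andbT leNgt; apply/negP => as1.
(* Below 1, integrate V'' = -2 s V repeatedly: V' <= sg gives V <= 2, then V' >= sg - 2 s^2, then V
   >= 1 + sg s - 2 s^3/3 > 0. *)
have a1 : 1 <= a.
  rewrite leNgt; apply/negP => a1.
  have Vle s : 0 <= s <= a -> V s <= 1 + sg.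
    move=> /andP[s0 sa].
    have V1le u : 0 <= u <= s -> V1 u <= sg.
      move=> /andP[u0 us].
      have := @dv_increment_le R V1 (fun=> 0) (fun s => - 2 * s * V s) (fun=> 0) 0 u u0.
      rewrite V10 subr0 subr_le0; apply => // v /andP[v0 vu].
      have : 0 <= v * V v by rewrite mulr_ge0 ?ltW// Vall//; lra.
      lra.
    have := @dv_increment_le R V (fun u => sg * u) V1 (fun=> sg) 0 s s0.
    rewrite V0 mulr0 subr0 => h.
    have : V s - 1 <= sg * s.
      apply: h => [u _|u /andP[u0 us]] //; first by dv; ring.
      by apply: V1le; rewrite !ltW.
    have : sg * s <= sg by rewrite ler_piMr//; lra.
    lra.
  have V1ge u : 0 <= u <= a -> sg - 2 * u ^+ 2 <= V1 u.
    move=> /andP[u0 ua].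
    have := @dv_increment_le R (fun u => - 2 * u ^+ 2) V1 (fun u => - 4 * u)
       (fun s => - 2 * s * V s) 0 u u0.
    rewrite V10 expr0n /= mulr0 subr0 => h.
    have : - 2 * u ^+ 2 <= V1 u - sg.
      apply: h => [v _|v /andP[v0 vu]] //; first by dv; rewrite /= expr1; ring.
      have Vv : V v <= 2 by have := Vle v ltac:(lra); lra.
      have := ler_wpM2l (ltW v0) Vv; lra.
    lra.
  have := @dv_increment_le R (fun u => sg * u - 2 / 3 * u ^+ 3) V
    (fun u => sg - 2 * u ^+ 2) V1 0 a (ltW a0).
  rewrite Va V0 expr0n /= !mulr0 !subr0 sub0r => h.
  have : sg * a - 2 / 3 * a ^+ 3 <= - 1.
    apply: h => [v _|v /andP[v0 vu]] //; first by dv; rewrite /=; field.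
    by apply: V1ge; rewrite !ltW.
  have : 0 <= sg * a by rewrite mulr_ge0 ?ltW//; lra.
  have : a ^+ 3 <= 1 by rewrite exprn_ile1// ltW.
  lra.
have [d d0 hd] : exists2 d, 0 < d & forall s, a < s -> s <= a + d -> V1 s < 0.
  have : \forall s \near a, V1 s < 0 by exact: (cvgr_lt _ (cV1 a)).
  move=> [d /= d0 hd]; exists (d / 2); first by rewrite divr_gt0.
  by move=> s t1 t2; apply: hd; rewrite /= ltr0_norm; lra.
have Vneg s : a < s -> s <= a + d -> V s < 0.
  move=> t1 t2; rewrite -Va.
  have := increasing_dv (fun s => - V s) (fun s => - V1 s) a s t1.
  rewrite ltrN2; apply => u /andP[u1 u2].
  by rewrite oppr_gt0 hd//; lra.
pose b := Num.min (a + d) ((a + s1) / 2).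
have ab : a < b by rewrite lt_min; apply/andP; split; lra.
have bd : b <= a + d by rewrite ge_min lexx.
have bs : b < s1.
  by apply: (@le_lt_trans _ _ ((a + s1) / 2)); [rewrite ge_min lexx orbT|lra].
have [||||c [bc cs Vc Vpos2]] := first_zero (fun s => - V s) b (s1).
- exact: ltW.
- by move=> s _; apply: (dv_continuous _ _ (- V1 s)); exact: dvN.
- by rewrite oppr_gt0 Vneg.
- by rewrite oppr_le0 ltW.
have {}Vc : V c = 0 by apply/eqP; rewrite -oppr_eq0 Vc.
have Vneg2 s : a < s < c -> V s < 0.
  move=> /andP[t1 t2]; have [sb|sb] := leP s b; first by apply: Vneg => //; lra.
  by rewrite -oppr_gt0 Vpos2// t2 ltW.
have ac : a < c by lra.
(* As u'' = -4 u, the Wronskian W = V u' - V' u has derivative (2 s - 4) V u, positive between a and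
   c, where V < 0 and s < 2. Since c - a < 1, u is positive up to c, and W(a) < W(c) gives V'(c) <
   0, impossible where V rises to 0. *)
pose u s : R := sin (2 * (s - a)).
pose W s := V s * (2 * cos (2 * (s - a))) - V1 s * u s.
have upos s : a < s -> s <= c -> 0 < u s.
  by move=> t1 t2; apply: sin2_gt0; lra.
have : W a < W c.
  apply: (increasing_dv W (fun s => (2 * s - 4) * V s * u s)) => // s.
    by move=> _; rewrite /W /u; dv; ring.
  move=> /andP[t1 t2]; rewrite pmulr_lgt0 ?upos ?(ltW t2)//.
  by rewrite nmulr_lgt0 ?Vneg2 ?t1//; lra.
rewrite /W Va Vc !mul0r !sub0r ltrN2 [u a]/u subrr mulr0 sin0 mulr0.
rewrite pmulr_llt0 ?upos// => V1c.
have [d' d'0 hd'] : exists2 d', 0 < d' & forall s, s < c -> c - d' <= s -> V1 s < 0.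
  have : \forall s \near c, V1 s < 0 by exact: (cvgr_lt _ (cV1 c)).
  move=> [e /= e0 he]; exists (e / 2); first by rewrite divr_gt0.
  by move=> s t3 t4; apply: he; rewrite /= gtr0_norm; lra.
pose s := Num.max (c - d') ((a + c) / 2).
have t1 : c - d' <= s by rewrite le_max lexx.
have t2 : a < s by rewrite lt_max; apply/orP; right; lra.
have t3 : s < c by rewrite gt_max; apply/andP; split; lra.
have := increasing_dv (fun s => - V s) (fun s => - V1 s) s c t3.
rewrite ltrN2 Vc => h.
have : 0 < V s.
  apply: h => v /andP[v1 v2].
  by rewrite oppr_gt0 hd'//; lra.
by rewrite ltNge ltW// Vneg2// t2.
Qed.

Lemma a_const_airyV : exists sg, [/\ (forall s, s <= 0 -> 0 < airyV sg s /\ 0 < airyV1 sg s),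
  (74 * 100 + 23) / (40 * 100) <= (a_const : R) <= ((3 * 100 + 71) * 100 + 17) / (2 * 100 * 100), airyV sg a_const = 0,
  airyV1 sg a_const < 0 & forall s, s < a_const -> 0 < airyV sg s].
Proof.
have [sg [hAi pos]] := @airy_decaying R; exists sg.
have sgb := airyV_ratio_bounds _ pos; have [v1 v2] := airyV_sign_change _ sgb.
have [|||||a [ab Va V1a Vpos]] := airyV_first_zero sg _ _ _ _ _ _ _ v1 v2 pos; [lra..|].
have r0 := @cbrt2_gt0 R; have rN : r != 0 by rewrite gt_eqF.
have a0 : 0 < a by lra.
have ra0 : 0 < r * a by rewrite mulr_gt0.
have h1 : Ai (- (r * a)) = 0 by apply/hAi; rewrite opprK mulrAC divff// mul1r.
have h2 y : y < 0 -> Ai y = 0 -> r * a <= `|y|.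
  move=> y0 /hAi Vy; rewrite (ltr0_norm y0) leNgt; apply/negP => h.
  have : 0 < airyV sg (- y / r) by apply: Vpos; rewrite ltr_pdivrMr// mulrC.
  by rewrite Vy ltxx.
have z : (airy_zero1 : R) = - (r * a).
  apply: get_unique.
    split; [by rewrite oppr_lt0|exact: h1|move=> y y0 Ay].
    by rewrite normrN (gtr0_norm ra0); exact: h2.
  move=> y [y0 Ay ymin].
  have := ymin (- (r * a)); rewrite oppr_lt0 ra0 => /(_ isT h1).
  rewrite normrN (gtr0_norm ra0) => h3.
  have := h2 y y0 Ay => h4; have e : `|y| = r * a by apply/eqP; rewrite eq_le h3 h4.
  by rewrite -e ltr0_norm// opprK.
have -> : (a_const : R) = a.
  rewrite /a_const z normrN (gtr0_norm ra0) mulrA -powRD; last by rewrite pnatr_eq0 implybT.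
  by rewrite addNr powRr0 mul1r.
by [].
Qed.

End AiryZero.

(** * The constant A *)

Section ImproperIntegral.
Context {R : realType}.
Local Open Scope classical_set_scope.

(** The integrand may be unbounded at 0: the fundamental theorem is applied on [1/(n+1), +oo[, and
    monotone convergence exhausts the half-line. *)
Lemma Rintegral_0y_dv (f F : R -> R) (l : R) :
  (forall x : R, 0 < x -> is_derive x (1 : R) F (f x)) ->
  (forall x : R, 0 < x -> {for x, continuous f}) -> (forall x : R, 0 < x -> 0 <= f x) ->
  {for 0, continuous F} -> F x @[x --> +oo] --> l ->
  (\int[lebesgue_measure]_(x in `]0%R, +oo[) f x)%R = l - F 0.
Proof.
move=> dF cf f0 cF Fl.
pose D n := `[(n.+1%:R^-1 : R), +oo[%classic.
have n0 n : 0 < n.+1%:R^-1 :> R by rewrite invr_gt0.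
have iD n : (\int[lebesgue_measure]_(x in D n) (f x)%:E = (l - F n.+1%:R^-1)%:E)%E.
  rewrite EFinB; apply: ge0_continuous_FTC2y => //.
  - by move=> x nx; apply: f0; apply: lt_le_trans nx.
  - apply/continuous_within_itvcyP; split.
      by move=> x; rewrite in_itv/= andbT => nx; apply: cf; exact: lt_trans nx.
    by apply: cvg_at_right_filter; exact: cf.
  - by move=> x nx; have [] := dF x (lt_trans (n0 n) nx).
  - by apply: cvg_at_right_filter; exact: (dv_continuous _ _ _ (dF _ (n0 n))).
  - move=> x; rewrite in_itv/= andbT => nx.
    by have [] := dF x (lt_trans (n0 n) nx); rewrite derive1E.
have eU : `]0%R, +oo[ = \bigcup_n D n.
  apply/seteqP; split=> x /=; rewrite in_itv/= andbT => x0.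
    exists (Num.trunc x^-1) => //; rewrite /D /= in_itv/= andbT.
    by rewrite invf_ple ?posrE// ltW// Num.Theory.truncnS_gt.
  by case: x0 => n _; rewrite /D /= in_itv/= andbT => /(lt_le_trans (n0 n)).
have mf : measurable_fun (`](0 : R), +oo[ : set (measurableTypeR R)) f.
  apply: measurable_realfun.open_continuous_measurable_fun; first exact: interval_open.
  by move=> x; rewrite inE/= in_itv/= andbT; exact: cf.
have cv : (\int[lebesgue_measure]_(x in D n) (f x)%:E)%E @[n --> \oo] -->
          (\int[lebesgue_measure]_(x in `]0%R, +oo[) (f x)%:E)%E.
  rewrite eU; apply: ge0_nondecreasing_set_cvg_integral => //.
  - move=> m n mn; apply/subsetPset => x; rewrite /D /= !in_itv/= !andbT.
    by apply: le_trans; rewrite lef_pV2 ?posrE ?ltr0n// ler_nat.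
  - by move=> n; exact: measurable_itv.
  - move=> n; apply/measurable_realfun.measurable_EFinP.
    apply: measurable_funS mf; first exact: measurable_itv.
    by move=> x; rewrite /D /= !in_itv/= !andbT; exact: lt_le_trans.
  - by move=> n x; rewrite /D /= in_itv/= andbT lee_fin => nx; apply: f0; exact: lt_le_trans nx.
have cv2 : (\int[lebesgue_measure]_(x in D n) (f x)%:E)%E @[n --> \oo] --> (l - F 0)%:E.
  under eq_fun do rewrite iD.
  apply: cvg_EFin; first exact: nearW.
  apply: cvgB; first exact: cvg_cst.
  by apply: continuous_cvg => //; exact: cvg_harmonic.
by rewrite /Rintegral; move: cv => /cvg_lim <-//; move: cv2 => /cvg_lim ->.
Qed.

End ImproperIntegral.

(** * The integral defining A, after the substitution x = s^2 *)

Section LimitDensity.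
Context {R : realType}.
Local Open Scope classical_set_scope.
Variable a : R.
Hypothesis a1 : 1 <= 2 * a.

(** The integrand of A after x = s^2, up to the factor 2/sqrt pi; the singularity at 0 has
    disappeared. *)
Definition gauss6 (s : R) : R := expR (- (s ^+ 6 / 3 + 2 * a * s ^+ 2)).

Definition limit_density (x : R) : R := expR (- (x ^+ 3 / 3%:R) - 2%:R * a * x) / Num.sqrt (pi * x).

Lemma gauss6_le s : 0 < s -> gauss6 s <= s ^- 2.
Proof.
move=> s0; rewrite /gauss6 expRN lef_pV2 ?posrE ?expR_gt0 ?exprn_gt0//.
apply: le_trans (expR_ge1Dx _); have := ler_wpM2r (sqr_ge0 s) a1.
have : 0 <= s ^+ 6 by apply: exprn_ge0; exact: ltW.
by lra.
Qed.

Lemma exists_gauss6_integral : exists (P : R -> R) (g : R),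
  [/\ (forall s : R, -1 < s -> is_derive s (1 : R) P (gauss6 s)), P 0 = 0 & P s @[s --> +oo] --> g].
Proof.
have cg : continuous gauss6.
  apply: continuous_dv => x; eexists; rewrite /gauss6; dv; reflexivity.
have [P0 dP0] := exists_antiderivative _ cg.
have [|g hg] := @cauchy_cvg_pinfty _ P0 1 1.
  move=> x y x1 xy; have x0 : 0 < x by apply: lt_le_trans x1.
  have := dv_increment_norm_le P0 (fun s => - s^-1) gauss6 (fun s => s ^- 2) x y xy.
  move=> /(_ _ _ _)/le_trans; apply.
  - by move=> s /andP[xs _]; apply: dP0; lra.
  - move=> s /andP[xs _]; have s0 : s != 0 by rewrite gt_eqF//; apply: lt_le_trans xs.
    by dv => //; field.
  - move=> s /andP[xs _]; rewrite ger0_norm ?expR_ge0//; apply: gauss6_le.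
    exact: lt_trans xs.
  rewrite opprK addrC div1r gerBl invr_ge0; exact: le_trans (ltW x0) xy.
exists (fun s => P0 s - P0 0), (g - P0 0); split.
- move=> s s1; have h := dP0 s s1; dv; exact: subr0.
- exact: subrr.
- by apply: cvgB => //; exact: cvg_cst.
Qed.

Variables (P : R -> R) (g : R).
Hypothesis dP : forall s : R, -1 < s -> is_derive s (1 : R) P (gauss6 s).
Hypothesis P0 : P 0 = 0.
Hypothesis Pg : P s @[s --> +oo] --> g.

Definition density_primitive x := 2 / Num.sqrt pi * P (Num.sqrt x).

Local Notation Psi := density_primitive.
Local Notation phi := limit_density.

Lemma sqrt_pi_gt0 : 0 < Num.sqrt pi :> R.
Proof. by rewrite sqrtr_gt0 pi_gt0. Qed.

Lemma limit_density_gt0 x : 0 < x -> 0 < phi x.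
Proof. by move=> x0; rewrite divr_gt0 ?expR_gt0// sqrtr_gt0 mulr_gt0 ?pi_gt0. Qed.

Lemma is_derive_density_primitive (x : R) : 0 < x -> is_derive x (1 : R) Psi (phi x).
Proof.
move=> x0; have s0 : 0 < Num.sqrt x by rewrite sqrtr_gt0.
have h := dP (Num.sqrt x) (lt_trans (ltrN10 R) s0).
rewrite /density_primitive; dv => //.
have e : Num.sqrt x ^+ 2 = x by rewrite sqr_sqrtr// ltW.
rewrite /gauss6 (_ : _ ^+ 6 = x ^+ 3); last by rewrite -[in RHS]e -exprM.
rewrite e /phi sqrtrM ?pi_ge0// opprD mulr1 mul0r add0r.
have p0 := sqrt_pi_gt0; move: (expR _) => E.
by field; rewrite !gt_eqF.
Qed.

Lemma density_primitive0 : Psi 0 = 0.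
Proof. by rewrite /density_primitive sqrtr0 P0 mulr0. Qed.

Lemma continuous_density_primitive0 : {for 0, continuous Psi}.
Proof.
apply: cvgM; first exact: cvg_cst.
have : {for Num.sqrt 0, continuous P}.
  by rewrite sqrtr0; apply: (dv_continuous _ _ (gauss6 0)); apply: dP; lra.
apply: continuous_comp; exact: sqrt_continuous.
Qed.

Lemma density_primitive_cvg : Psi x @[x --> +oo] --> 2 / Num.sqrt pi * g.
Proof.
apply: cvgM; first exact: cvg_cst.
apply: (cvg_comp _ _ _ Pg).
apply/cvgryPge => A; near=> x.
apply: (@le_trans _ _ (Num.sqrt (A ^+ 2))); first by rewrite sqrtr_sqr ler_norm.
rewrite ler_sqrt; last by near: x; apply: nbhs_pinfty_ge; exact: num_real.
by near: x; apply: nbhs_pinfty_ge; exact: num_real.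
Unshelve. all: by end_near.
Qed.

(** Controls the first cell of the Riemann sum, where the density is unbounded. *)
Lemma density_primitive_bounds x : 0 < x -> 0 <= Psi x <= 2 * Num.sqrt x.
Proof.
move=> x0; set s := Num.sqrt x; have s0 : 0 <= s by exact: sqrtr_ge0.
have p1 : 1 <= Num.sqrt pi :> R.
  by rewrite -[X in X <= _]sqrtr1 ler_sqrt ?pi_ge0//; apply: le_trans (pi_ge2 _); lra.
have h1 : 0 <= P s.
  rewrite -P0; apply: (nondecreasing_dv P gauss6) => // u; last by move=> _; exact: expR_ge0.
  by move=> /andP[u0 _]; apply: dP; lra.
have h2 : P s <= s.
  have := dv_increment_le P (fun u => u) gauss6 (fun=> 1) 0 s s0.
  rewrite P0 !subr0; apply.
  - by move=> u /andP[u0 _]; apply: dP; lra.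
  - move=> u _; rewrite /gauss6 -[X in _ <= X]expR0 ler_expR oppr_le0 addr_ge0//.
      by rewrite divr_ge0// (exprM u 3 2) sqr_ge0.
    by rewrite mulr_ge0 ?sqr_ge0//; apply: le_trans ler01 a1.
have c2 : 2 / Num.sqrt pi <= 2 :> R by rewrite ler_pdivrMr ?sqrt_pi_gt0//; lra.
have c0 : 0 <= 2 / Num.sqrt pi :> R by rewrite divr_ge0// ltW// sqrt_pi_gt0.
rewrite /density_primitive -/s mulr_ge0//=.
by apply: le_trans (ler_wpM2r h1 c2) _; rewrite ler_pM2l.
Qed.

Lemma density_primitive_le x : 0 < x -> Psi x <= 2 / Num.sqrt pi * g.
Proof.
move=> x0; apply: (cvgr_to_ge density_primitive_cvg); near=> y.
apply: (nondecreasing_dv Psi phi).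
- by near: y; apply: nbhs_pinfty_ge; exact: num_real.
- by move=> u /andP[xu _]; apply: is_derive_density_primitive; exact: lt_le_trans xu.
- by move=> u /andP[xu _]; apply/ltW/limit_density_gt0; exact: lt_trans xu.
Unshelve. all: by end_near.
Qed.

(** For u >= 1 the density is at most e^(-u), because sqrt(pi u) >= 1 and 2 a >= 1. *)
Lemma density_primitive_tail x : 1 <= x -> 2 / Num.sqrt pi * g - Psi x <= expR (- x).
Proof.
move=> x1; rewrite lerBlDl.
have p1 (u : R) : 1 <= u -> 1 <= Num.sqrt (pi * u).
  move=> u1; rewrite -[X in X <= _]sqrtr1 ler_sqrt; last first.
    by rewrite mulr_ge0 ?pi_ge0//; lra.
  by rewrite -[X in X <= _]mulr1 ler_pM//; have := pi_ge2 R; lra.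
have phile (u : R) : 1 <= u -> phi u <= expR (- u).
  move=> u1; rewrite /phi ler_pdivrMr; last exact: lt_le_trans (p1 _ u1).
  apply: (@le_trans _ _ (expR (- u))); last by rewrite ler_peMr ?expR_ge0// p1.
  rewrite ler_expR.
  have u3 : 0 <= u ^+ 3 by apply: exprn_ge0; lra.
  by have := ler_wpM2r (_ : 0 <= u) a1; rewrite mul1r => /(_ ltac:(lra)); lra.
apply: (cvgr_to_le density_primitive_cvg); near=> y.
have xy : x <= y by near: y; apply: nbhs_pinfty_ge; exact: num_real.
rewrite -lerBlDl; apply: (@le_trans _ _ (- expR (- y) - - expR (- x))); last first.
  by rewrite opprK gerDr oppr_le0 expR_ge0.
apply: (dv_increment_le Psi (fun y => - expR (- y)) phi (fun y => expR (- y))) => //.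
- by move=> u /andP[xu _]; apply: is_derive_density_primitive; lra.
- by move=> u _; dv; ring.
- by move=> u /andP[xu _]; apply: phile; lra.
Unshelve. all: by end_near.
Qed.

Lemma Rintegral_limit_density :
  (\int[lebesgue_measure]_(x in `]0%R, +oo[) phi x)%R = 2 / Num.sqrt pi * g.
Proof.
have -> : 2 / Num.sqrt pi * g = 2 / Num.sqrt pi * g - Psi 0.
  by rewrite density_primitive0 subr0.
apply: Rintegral_0y_dv.
- exact: is_derive_density_primitive.
- move=> x x0; have px : 0 < pi * x by rewrite mulr_gt0 ?pi_gt0.
  have [d hd] : exists d, is_derive x (1 : R) phi d.
    by eexists; rewrite /phi; dv; [rewrite gt_eqF// sqrtr_gt0|exact: px|reflexivity].
  exact: dv_continuous hd.
- by move=> x /limit_density_gt0/ltW.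
- exact: continuous_density_primitive0.
- exact: density_primitive_cvg.
Qed.

Lemma gauss6_gt0 s : 0 < gauss6 s. Proof. exact: expR_gt0. Qed.

Lemma gauss6_integral_ge L : 0 <= L -> P L <= g.
Proof.
move=> L0; apply: (cvgr_to_ge Pg); near=> s.
apply: (nondecreasing_dv P gauss6).
- by near: s; apply: nbhs_pinfty_ge; exact: num_real.
- by move=> x /andP[Lx _]; apply: dP; lra.
- by move=> x _; apply: ltW; exact: gauss6_gt0.
Unshelve. all: by end_near.
Qed.

(** For s >= L the logarithmic derivative of [gauss6] is at most -m, so the integrand is at most the
    derivative of - gauss6/m. *)
Lemma gauss6_integral_le L m : 0 <= L -> 0 < m -> m <= 2 * L ^+ 5 + 4 * a * L ->
  g <= P L + gauss6 L / m.
Proof.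
move=> L0 m0 hm; have a4 : 0 <= 4 * a by move: a1; lra.
apply: (cvgr_to_le Pg); near=> s.
have Ls : L <= s by near: s; apply: nbhs_pinfty_ge; exact: num_real.
rewrite -lerBlDl.
apply: (@le_trans _ _ (- (gauss6 s / m) - (- (gauss6 L / m)))); last first.
  by rewrite opprK gerDr oppr_le0 divr_ge0// ltW// gauss6_gt0.
apply: (dv_increment_le P (fun s => - (gauss6 s / m)) gauss6
         (fun s => gauss6 s * (2 * s ^+ 5 + 4 * a * s) / m)) => //.
- by move=> x /andP[Lx _]; apply: dP; lra.
- move=> x _; rewrite /gauss6; dv; rewrite /gauss6; have mN : m != 0 by rewrite gt_eqF.
  by move: (expR _) => E; field.
- move=> x /andP[Lx _]; rewrite -mulrA ler_peMr ?(ltW (gauss6_gt0 _))//.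
  rewrite ler_pdivlMr// mul1r; apply: le_trans hm _; apply: lerD.
    by rewrite ler_pM2l// lerXn2r ?nnegrE// ?ltW// (le_lt_trans L0).
  exact: ler_wpM2l a4 _ _ (ltW Lx).
Unshelve. all: by end_near.
Qed.

End LimitDensity.

(** * Decimal bounds for pi *)

Section PiBounds.
Context {R : realType}.
Local Notation S := (1000000000000000)%Z.

(** The series u, v and cos, sin solve the same rotation system, so (u - cos)^2 + (v - sin)^2 is
    constant, and it vanishes at 0. *)
Lemma cos_h01 (x : R) : cos x = h01 (1 / 2) (- x ^+ 2 / 4).
Proof.
have p1 : 0 < 1 / 2 :> R by lra. have p3 : 0 < 3 / 2 :> R by lra.
pose u (y : R) := h01 (1 / 2) (- y ^+ 2 / 4); pose v (y : R) := y * h01 (3 / 2) (- y ^+ 2 / 4).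
have du (y : R) : is_derive y (1 : R) u (- v y).
  have h := is_derive_h01 _ (- y ^+ 2 / 4) p1.
  rewrite /u; dv; rewrite /v (_ : 1 / 2 + 1 = 3 / 2); last by field.
  by move: (h01 _ _) => w; field.
have dv (y : R) : is_derive y (1 : R) v (u y).
  have h := is_derive_h01 _ (- y ^+ 2 / 4) p3.
  rewrite /v; dv; rewrite /u (h01_contiguous _ _ p1) (_ : 1 / 2 + 1 = 3 / 2); last by field.
  rewrite (_ : 1 / 2 + 2 = 3 / 2 + 1); last by field.
  by move: (h01 _ _) (h01 _ _) => w z; field.
pose W (y : R) := (u y - cos y) ^+ 2 + (v y - sin y) ^+ 2.
have W0 : W x = W 0.
  apply: (@is_derive_0_is_cst _ W) => y; rewrite /W; dv; rewrite expr1 /=; ring.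
move: W0; rewrite /W /u /v cos0 sin0 (_ : - 0 ^+ 2 / 4 = 0 :> R); last by ring.
rewrite !h01_at0 (_ : (1 - 1) ^+ 2 + (0 * 1 - 0) ^+ 2 = 0 :> R); last by ring.
move/eqP; rewrite paddr_eq0 ?sqr_ge0// => /andP[]; rewrite sqrf_eq0 subr_eq0 => /eqP <- _.
by [].
Qed.

(** The signs of cos at 1.57075 and 1.571, read off its series, place pi/2 between them by
    monotonicity. *)
Lemma pi_bounds : (62 * 100 + 83) / (20 * 100) <= (pi : R) <= (15 * 100 + 71) / (5 * 100).
Proof.
have p0 := @pi_gt0 R; have p2 := @pihalf_lt2 R; have p1 := @pihalf_ge1 R.
pose c1 : R := (62 * 100 + 83) / (40 * 100); pose c2 : R := (15 * 100 + 71) / (10 * 100).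
pose n1 := (- (6283 * 6283))%Z; pose q1 := (4 * 4000 * 4000)%Z.
pose n2 := (- (1571 * 1571))%Z; pose q2 := (4 * 1000 * 1000)%Z.
have z1 : - c1 ^+ 2 / 4 = zr n1 / zr q1 :> R.
  rewrite /c1 /n1 /q1 (_ : 6283 = 62 * 100 + 83)%Z// (_ : 4000 = 40 * 100)%Z//.
  by zr_simpl; field.
have z2 : - c2 ^+ 2 / 4 = zr n2 / zr q2 :> R.
  rewrite /c2 /n2 /q2 (_ : 1571 = 15 * 100 + 71)%Z// (_ : 1000 = 10 * 100)%Z//.
  by zr_simpl; field.
have C1 : 0 < cos c1.
  have : zr 1 / zr 100000 <= h01 (1 / 2) (zr n1 / zr q1) :> R.
    by apply: (h01_ge R S 1 2 n1 q1 15); vm_compute.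
  by rewrite -z1 -cos_h01; apply: lt_le_trans; rewrite divr_gt0 ?zr_gt0.
have C2 : cos c2 < 0.
  have : h01 (1 / 2) (zr n2 / zr q2) <= zr (- 1) / zr 100000 :> R.
    by apply: (h01_le R S 1 2 n2 q2 15); vm_compute.
  rewrite -z2 -cos_h01; move/le_lt_trans; apply.
  by rewrite (zrN 1) zr1 mulN1r oppr_lt0 invr_gt0 zr_gt0.
have cm x y : 0 <= x <= pi -> 0 <= y <= pi -> x <= y -> cos y <= cos x :> R.
  move=> /andP[hx _] /andP[_ hy] xy; rewrite -lerN2.
  apply: (nondecreasing_dv (fun x => - cos x) sin) => // u; first by move=> _; dv; ring.
  by move=> /andP[xu uy]; rewrite sin_ge0_pi// (le_trans hx (ltW xu)) (le_trans (ltW uy)).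
apply/andP; split; rewrite leNgt; apply/negP => h.
  have := cm (pi / 2) c1; rewrite cos_pihalf; move: C1 => /[swap]; rewrite ltNge => -> //.
  - by apply/andP; split; lra.
  - by rewrite /c1; apply/andP; split; lra.
  - by rewrite /c1; lra.
have := cm c2 (pi / 2); rewrite cos_pihalf; move: C2 => /[swap]; rewrite ltNge => -> //.
- by rewrite /c2; apply/andP; split; lra.
- by apply/andP; split; lra.
- by rewrite /c2; lra.
Qed.

End PiBounds.

(** * Alternating Taylor polynomials of the exponential *)

Section ExpTaylor.
Context {R : realType}.
Implicit Types u : R.

Definition exp_taylor n u : R := \sum_(i < n.+1) (- u) ^+ i / i`!%:R.

Lemma is_derive_exp_taylor n u : is_derive u (1 : R) (exp_taylor n.+1) (- exp_taylor n u).
Proof.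
elim: n => [|n IH].
  have e : exp_taylor 1 = fun v => 1 - v :> R.
    by apply/funext => v; rewrite /exp_taylor big_ord_recr big_ord1 /= expr0 expr1 !divr1.
  rewrite e; dv; rewrite /exp_taylor big_ord1 expr0 divr1; ring.
have e : exp_taylor n.+2 = fun v => exp_taylor n.+1 v + (- v) ^+ n.+2 / n.+2`!%:R :> R.
  by apply/funext => v; rewrite /exp_taylor big_ord_recr.
rewrite e; dv; rewrite [in RHS]/exp_taylor big_ord_recr /= -/(exp_taylor n u) opprD.
rewrite mulr0 addr0; congr (_ + _); rewrite factS natrM.
have f0 : n.+1`!%:R != 0 :> R by rewrite pnatr_eq0 -lt0n fact_gt0.
have n0 : n.+2%:R != 0 :> R by rewrite pnatr_eq0.
by move: f0 n0; move: (n.+1)`!%:R (n.+2%:R) => x y x0 y0; field; rewrite x0 y0.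
Qed.

Lemma exp_taylor0 n : exp_taylor n 0 = 1.
Proof.
rewrite /exp_taylor big_ord_recl /= expr0 divr1 big1 ?addr0// => i _.
by rewrite oppr0 expr0n mul0r.
Qed.

(* Taylor polynomials of exp (-u) alternate around it, by induction through the derivative. *)
Lemma exp_taylor_alternating n u : 0 <= u ->
  0 <= (-1) ^+ n * (exp_taylor n u - expR (- u)).
Proof.
elim: n u => [|n IH] u u0.
  by rewrite expr0 mul1r subr_ge0 /exp_taylor big_ord1 expr0 divr1 -expR0 ler_expR oppr_le0.
have := nondecreasing_dv (fun v => (-1) ^+ n.+1 * (exp_taylor n.+1 v - expR (- v)))
  (fun v => (-1) ^+ n * (exp_taylor n v - expR (- v))) 0 u u0.
rewrite exp_taylor0 oppr0 expR0 subrr mulr0; apply.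
  by move=> v _; have h := is_derive_exp_taylor n; dv; rewrite exprS; ring.
by move=> v /andP[v0 _]; apply: IH; exact: ltW.
Qed.

Fixpoint exp_horner u m n : R :=
  if n is n'.+1 then 1 + (- u) / m.+1%:R * exp_horner u m.+1 n' else 1.

Lemma exp_horner_sum u m n : exp_horner u m n = \sum_(i < n.+1) (- u) ^+ i * m`!%:R / (m + i)`!%:R.
Proof.
elim: n m => [|n IH] m.
  by rewrite big_ord1 addn0 expr0 mul1r divff// pnatr_eq0 -lt0n fact_gt0.
rewrite /= IH [RHS]big_ord_recl expr0 mul1r addn0 divff ?pnatr_eq0 -?lt0n ?fact_gt0//.
congr (_ + _); rewrite big_distrr; apply: eq_bigr => i _.
have -> : lift ord0 i = i.+1 :> nat by rewrite lift0.
rewrite /= addnS addSn exprS factS natrM.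
have n0 : m.+1%:R != 0 :> R by rewrite pnatr_eq0.
by move: n0; move: (m.+1%:R) => x x0; field; rewrite x0 pnatr_eq0 -lt0n fact_gt0.
Qed.

Lemma exp_horner_taylor u n : exp_horner u 0 n = exp_taylor n u.
Proof.
by rewrite exp_horner_sum; apply: eq_bigr => i _; rewrite fact0 mulr1.
Qed.

Lemma exp_horner_ge u n : 0 <= u -> expR (- u) <= exp_horner u 0 n.*2.
Proof.
move=> u0; have := exp_taylor_alternating n.*2 u u0.
by rewrite -exp_horner_taylor -signr_odd odd_double expr0 mul1r subr_ge0.
Qed.

Lemma exp_horner_le u n : 0 <= u -> exp_horner u 0 n.*2.+1 <= expR (- u).
Proof.
move=> u0; have := exp_taylor_alternating n.*2.+1 u u0.
by rewrite -exp_horner_taylor -signr_odd /= odd_double expr1 mulN1r oppr_ge0 subr_le0.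
Qed.

End ExpTaylor.

(** * Polynomials as coefficient lists, and enclosures of their primitives *)

Section Gauss6Enclosure.
Context {R : realType}.
Implicit Types (c t k : R) (l p : seq R).

Fixpoint seq_eval l t := if l is c :: l' then c + t * seq_eval l' t else 0.

Fixpoint seq_add l p := match l, p with
  | c :: l', d :: p' => (c + d) :: seq_add l' p'
  | [::], _ => p
  | _, [::] => l
  end.

Definition seq_scale k l := [seq c * k | c <- l].

(* Up to the factor s^(2m+1), the primitive of s^(2m) l(s^2/K), as a function of s^2/K. *)
Fixpoint seq_primitive m l t :=
  if l is c :: l' then c / (2 * m + 1)%:R + t * seq_primitive m.+1 l' t else 0.

Lemma seq_add_eval l p t : seq_eval (seq_add l p) t = seq_eval l t + seq_eval p t.
Proof.
elim: l p => [|c l IH] [|d p] /=; rewrite ?add0r ?addr0//.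
by rewrite IH mulrDr addrACA.
Qed.

Lemma seq_scale_eval k l t : seq_eval (seq_scale k l) t = k * seq_eval l t.
Proof. by elim: l => [|c l IH] /=; rewrite ?mulr0// IH mulrDr (mulrC c) mulrCA. Qed.

Lemma is_derive_seq_primitive m l (K s : R) : K != 0 ->
  is_derive s (1 : R) (fun s => s ^+ (2 * m + 1) * seq_primitive m l (s ^+ 2 / K))
    (s ^+ (2 * m) * seq_eval l (s ^+ 2 / K)).
Proof.
move=> K0; elim: l m => [|c l IH] m /=.
  by rewrite mulr0; apply: (dv_ext _ (fun=> 0)) (dv_cst 0 s) => v; rewrite mulr0.
have -> : (fun s : R => s ^+ (2 * m + 1) * (c / (2 * m + 1)%:R + s ^+ 2 / K * seq_primitive m.+1 l (s ^+ 2 / K)))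
   = fun s => c / (2 * m + 1)%:R * s ^+ (2 * m + 1)
       + K^-1 * (s ^+ (2 * m.+1 + 1) * seq_primitive m.+1 l (s ^+ 2 / K)).
  apply/funext => v; rewrite (_ : (2 * m.+1 + 1 = 2 * m + 1 + 2)%N); last by lia.
  rewrite [v ^+ (_ + 2)]exprD; move: (v ^+ (2 * m + 1)) (seq_primitive _ _ _) ((_ + _)%:R) => x y z.
  by ring.
have h := IH m.+1.
apply: (dv_eq _ _ (c / (2 * m + 1)%:R * ((2 * m + 1)%:R * s ^+ (2 * m)) + K^-1 * (s ^+ (2 * m.+1) * seq_eval l (s ^+ 2 / K)))).
  apply: dvD.
    by dv; rewrite addn1 /=; ring.
have n0 : (2 * m + 1)%:R != 0 :> R by rewrite pnatr_eq0 addn1.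
rewrite (_ : (2 * m.+1 = 2 * m + 2)%N); last by lia.
by move: n0; move: ((2 * m + 1)%:R) => d d0; rewrite exprD; field; rewrite K0 d0.
Qed.

(** Coefficients in t of the Horner form of exp(-(A t + B t^3)), started at index m. With t =
    s^2/L^2 the exponent is that of [gauss6] on [0, L], rescaled so that the endpoint is t = 1. *)
Fixpoint exp_seq (A B : R) m n : seq R :=
  if n is n'.+1 then
    let p := exp_seq A B m.+1 n' in
    seq_add [:: 1] (seq_add (0 :: seq_scale (- A / m.+1%:R) p)
      [:: 0, 0, 0 & seq_scale (- B / m.+1%:R) p])
  else [:: 1].

Lemma exp_seq_eval A B m n t :
  seq_eval (exp_seq A B m n) t = exp_horner (A * t + B * t ^+ 3) m n.
Proof.
elim: n m => [|n IH] m; first by rewrite /= mulr0 addr0.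
have -> : exp_seq A B m n.+1 = seq_add [:: 1] (seq_add
    (0 :: seq_scale (- A / m.+1%:R) (exp_seq A B m.+1 n))
    [:: 0, 0, 0 & seq_scale (- B / m.+1%:R) (exp_seq A B m.+1 n)]) by [].
rewrite !seq_add_eval /= !seq_scale_eval IH.
by move: (exp_horner _ _ _) => e; ring.
Qed.

Variables (S : Z).
Local Notation mem := (iv_mem S).

Fixpoint seq_mem l (i : seq (Z * Z)) : Prop := match l, i with
  | [::], [::] => True
  | c :: l', x :: i' => mem c x /\ seq_mem l' i'
  | _, _ => False
  end.

Fixpoint iv_seq_add (l p : seq (Z * Z)) := match l, p with
  | c :: l', d :: p' => iv_add c d :: iv_seq_add l' p'
  | [::], _ => p
  | _, [::] => l
  end.

Definition iv_seq_scale (a b : Z) (l : seq (Z * Z)) := [seq iv_mulq a b x | x <- l].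

Fixpoint iv_seq_primitive (m : Z) (l : seq (Z * Z)) :=
  if l is c :: l' then iv_add (iv_mulq 1 (2 * m + 1) c) (iv_seq_primitive (m + 1) l') else (0, 0)%Z.

Fixpoint iv_exp_seq (ap aq bp bq m : Z) n :=
  if n is n'.+1 then
    let p := iv_exp_seq ap aq bp bq (m + 1) n' in
    iv_seq_add [:: iv_cst S 1] (iv_seq_add (iv_cst S 0 :: iv_seq_scale (- ap) (aq * (m + 1)) p)
      [:: iv_cst S 0, iv_cst S 0, iv_cst S 0 & iv_seq_scale (- bp) (bq * (m + 1)) p])
  else [:: iv_cst S 1].

Lemma iv_seq_addP l p i j : seq_mem l i -> seq_mem p j -> seq_mem (seq_add l p) (iv_seq_add i j).
Proof.
elim: l p i j => [|c l IH] [|d p] [|x i] [|y j] //=.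
by move=> [h1 h2] [h3 h4]; split; [exact: iv_addP|exact: IH].
Qed.

Lemma iv_seq_scaleP a b l i : (0 < b)%Z -> seq_mem l i ->
  seq_mem (seq_scale (zr a / zr b) l) (iv_seq_scale a b i).
Proof.
move=> b0; elim: l i => [|c l IH] [|x i] //= [h1 h2].
by split; [exact: iv_mulqP|exact: IH].
Qed.

Lemma iv_seq_primitiveP m l i : seq_mem l i ->
  mem (seq_primitive m l 1) (iv_seq_primitive (Z.of_nat m) i).
Proof.
elim: l m i => [|c l IH] m [|x i] //=; first by rewrite /iv_mem /= mul0r zr0.
move=> [h1 h2]; rewrite mul1r; apply: iv_addP; last first.
  by rewrite (_ : (Z.of_nat m + 1 = Z.of_nat m.+1)%Z); [exact: IH|lia].
rewrite -[X in c / X](_ : zr (2 * Z.of_nat m + 1) = _); last first.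
  by rewrite !(zrD, zrM) zr_nat zr1 zr2 natrD natrM.
by rewrite -[(_)^-1]mul1r -zr1; apply: iv_mulqP => //; lia.
Qed.

Lemma iv_exp_seqP ap aq bp bq m n : (0 < aq)%Z -> (0 < bq)%Z ->
  seq_mem (exp_seq (zr ap / zr aq) (zr bp / zr bq) m n) (iv_exp_seq ap aq bp bq (Z.of_nat m) n).
Proof.
move=> a0 b0; elim: n m => [|n IH] m; first by split => //; exact: iv_cst1P.
have e (p q : Z) : (0 < q)%Z -> - (zr p / zr q) / m.+1%:R = zr (- p) / zr (q * (Z.of_nat m + 1)) :> R.
  move=> q0; rewrite zrN zrM zrD zr_nat zr1 natr1 invfM; ring.
have c0 : mem (0 : R) (iv_cst S 0) by rewrite -(@zr0 R); exact: iv_cstP.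
have s1 : (Z.of_nat m + 1 = Z.of_nat m.+1)%Z by lia.
apply: iv_seq_addP; first by split => //; exact: iv_cst1P.
by apply: iv_seq_addP; [split => //|do 3 (split => //)]; rewrite e//;
  apply: iv_seq_scaleP; rewrite ?s1//; lia.
Qed.

End Gauss6Enclosure.

(** * Numerical enclosure of the integral of [gauss6] *)

Section LimitConstant.
Context {R : realType}.
Local Open Scope classical_set_scope.
Local Notation S := (1000000000000000)%Z.
Variables (a : R) (P : R -> R).
Hypothesis dP : forall s : R, -1 < s -> is_derive s (1 : R) P (gauss6 a s).
Hypothesis P0 : P 0 = 0.

Let q L w s : L != 0 -> w * L ^+ 2 * (s ^+ 2 / L ^+ 2) + L ^+ 6 / 3 * (s ^+ 2 / L ^+ 2) ^+ 3 =
  s ^+ 6 / 3 + w * s ^+ 2 :> R.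
Proof. by move=> L0; field. Qed.

Let q_ge0 w s : 0 <= w -> 0 <= s -> 0 <= s ^+ 6 / 3 + w * s ^+ 2 :> R.
Proof. by move=> w0 s0; rewrite addr_ge0// ?divr_ge0 ?mulr_ge0 ?exprn_ge0. Qed.

(** A smaller w in place of 2 a and an even Taylor degree both err upwards. A rational w makes the
    polynomial accessible to interval arithmetic. *)
Lemma gauss6_primitive_le L w n : 0 < L -> 0 <= w -> w <= 2 * a ->
  P L <= L * seq_primitive 0 (exp_seq (w * L ^+ 2) (L ^+ 6 / 3) 0 n.*2) 1.
Proof.
move=> L0 w0 wa; have LN : L != 0 by rewrite gt_eqF.
have := dv_increment_le P _ (gauss6 a) _ 0 L (ltW L0) _
  (fun s _ => is_derive_seq_primitive 0 (exp_seq (w * L ^+ 2) (L ^+ 6 / 3) 0 n.*2) (L ^+ 2) s (expf_neq0 2 LN)).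
rewrite P0 expr0n /= mul0r !subr0 expr1 divff ?expf_neq0//; apply.
  by move=> s /andP[s0 _]; apply: dP; lra.
move=> s /andP[s0 _]; rewrite expr0 mul1r exp_seq_eval q//.
apply: le_trans (exp_horner_ge _ _ (q_ge0 _ _ w0 (ltW s0))).
by rewrite ler_expR lerN2 lerD2l ler_wpM2r// sqr_ge0.
Qed.

Lemma gauss6_primitive_ge L w n : 0 < L -> 0 <= w -> 2 * a <= w ->
  L * seq_primitive 0 (exp_seq (w * L ^+ 2) (L ^+ 6 / 3) 0 n.*2.+1) 1 <= P L.
Proof.
move=> L0 w0 wa; have LN : L != 0 by rewrite gt_eqF.
have := fun u : R => exp_horner_le u n; move: n.*2.+1 => N hN.
have := dv_increment_le _ P _ (gauss6 a) 0 L (ltW L0)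
  (fun s _ => is_derive_seq_primitive 0 (exp_seq (w * L ^+ 2) (L ^+ 6 / 3) 0 N) (L ^+ 2) s (expf_neq0 2 LN)).
rewrite P0 expr0n /= mul0r !subr0 expr1 divff ?expf_neq0//; apply.
  by move=> s /andP[s0 _]; apply: dP; lra.
move=> s /andP[s0 _]; rewrite expr0 mul1r exp_seq_eval q//.
apply: le_trans (hN _ (q_ge0 _ _ w0 (ltW s0))) _.
by rewrite ler_expR lerN2 lerD2l ler_wpM2r// sqr_ge0.
Qed.

Lemma seq_primitive_exp_le ap aq bp bq n p r : 
  [&& 0 <? S, 0 <? aq, 0 <? bq, 0 <? r &
    (iv_seq_primitive 0 (iv_exp_seq S ap aq bp bq 0 n)).2 * r <=? p * S]%Z ->
  seq_primitive 0 (exp_seq (zr ap / zr aq) (zr bp / zr bq) 0 n) 1 <= zr p / zr r :> R.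
Proof.
move=> /and5P[/Z.ltb_spec0 h1 /Z.ltb_spec0 h2 /Z.ltb_spec0 h3 /Z.ltb_spec0 h4 /Z.leb_spec0 h5].
apply: iv_mem_le h4 h5 => //; apply: (iv_seq_primitiveP S 0); exact: (iv_exp_seqP S _ _ _ _ 0).
Qed.

Lemma seq_primitive_exp_ge ap aq bp bq n p r : 
  [&& 0 <? S, 0 <? aq, 0 <? bq, 0 <? r &
    p * S <=? (iv_seq_primitive 0 (iv_exp_seq S ap aq bp bq 0 n)).1 * r]%Z ->
  zr p / zr r <= seq_primitive 0 (exp_seq (zr ap / zr aq) (zr bp / zr bq) 0 n) 1 :> R.
Proof.
move=> /and5P[/Z.ltb_spec0 h1 /Z.ltb_spec0 h2 /Z.ltb_spec0 h3 /Z.ltb_spec0 h4 /Z.leb_spec0 h5].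
apply: iv_mem_ge h4 h5 => //; apply: (iv_seq_primitiveP S 0); exact: (iv_exp_seqP S _ _ _ _ 0).
Qed.

Hypothesis aB : (74 * 100 + 23) / (40 * 100) <= a <= ((3 * 100 + 71) * 100 + 17) / (2 * 100 * 100).
Variable g : R.
Hypothesis Pg : P s @[s --> +oo] --> g.

Lemma gauss6_integral_bounds :
  3 / 2 * (((3 * 100 + 3) * 100 + 56) * 100 + 55) / (10 * 100 * 100 * 100) <= g <=
  3 / 2 * (((3 * 100 + 3) * 100 + 57) * 100 + 37) / (10 * 100 * 100 * 100) + (26 * (125 * 125))^-1.
Proof.
have [a1 a2] := andP aB.
have L0 : 0 < 3 / 2 :> R by lra.
have eB : (3 / 2) ^+ 6 / 3 = zr 243 / zr 64 :> R.
  by rewrite (_ : 243 = 2 * 100 + 43)%Z//; zr_simpl; field.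
have eA : (74 * 100 + 23) / (20 * 100) * (3 / 2) ^+ 2 = zr 66807 / zr 8000 :> R.
  rewrite (_ : 66807 = (6 * 100 + 68) * 100 + 7)%Z// (_ : 8000 = 80 * 100)%Z//.
  by zr_simpl; field.
have eA' : ((3 * 100 + 71) * 100 + 17) / (100 * 100) * (3 / 2) ^+ 2 = zr 334053 / zr 40000 :> R.
  rewrite (_ : 334053 = (33 * 100 + 40) * 100 + 53)%Z// (_ : 40000 = 4 * 100 * 100)%Z//.
  by zr_simpl; field.
have up := gauss6_primitive_le (3 / 2) ((74 * 100 + 23) / (20 * 100)) 20 L0 ltac:(lra) ltac:(lra).
have lo := gauss6_primitive_ge (3 / 2) (((3 * 100 + 71) * 100 + 17) / (100 * 100)) 20 L0 ltac:(lra) ltac:(lra).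
have n1 : seq_primitive 0 (exp_seq (zr 66807 / zr 8000) (zr 243 / zr 64) 0 20.*2) 1
    <= zr (((3 * 100 + 3) * 100 + 57) * 100 + 37) / zr (10 * 100 * 100 * 100) :> R.
  by apply: seq_primitive_exp_le; vm_compute.
have n2 : zr (((3 * 100 + 3) * 100 + 56) * 100 + 55) / zr (10 * 100 * 100 * 100)
    <= seq_primitive 0 (exp_seq (zr 334053 / zr 40000) (zr 243 / zr 64) 0 20.*2.+1) 1 :> R.
  by apply: seq_primitive_exp_ge; vm_compute.
move: up lo; rewrite eA eA' eB => up lo.
move: n1 n2 up lo; move: (seq_primitive _ _ _) (seq_primitive _ _ _) => x y; zr_simpl => n1 n2 up lo.
have h1 : 1 <= 2 * a by lra.
have g1 := gauss6_integral_ge a P g dP Pg (3 / 2) (ltW L0).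
(* 26 lies just below 2 L^5 + 4 a L at L = 3/2, about 26.3. *)
have g2 := gauss6_integral_le a h1 P g dP Pg (3 / 2) 26 (ltW L0) ltac:(lra) ltac:(lra).
(* The exponent at 3/2 exceeds 12, and e^12 = (e^(1/2))^24 >= ((3/2)^4)^6 >= 5^6 = 125^2. *)
have e : gauss6 a (3 / 2) <= (125 * 125)^-1.
  rewrite /gauss6 expRN lef_pV2 ?posrE ?expR_gt0//.
  apply: (@le_trans _ _ (expR (24%:R * (1 / 2)))); last by rewrite ler_expR; lra.
  rewrite expRM_natl; have h : 3 / 2 <= expR (1 / 2) :> R by apply: le_trans (expR_ge1Dx _); lra.
  have h4 : 5 <= expR (1 / 2) ^+ 4 :> R.
    apply: (@le_trans _ _ ((3 / 2) ^+ 4)); first by lra.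
    by rewrite lerXn2r ?nnegrE ?expR_ge0//; lra.
  rewrite (_ : 24 = 4 * 6)%N// exprM.
  apply: (@le_trans _ _ (5 ^+ 6)); first by lra.
  by rewrite lerXn2r ?nnegrE ?exprn_ge0 ?expR_ge0.
have e2 : gauss6 a (3 / 2) / 26 <= (26 * (125 * 125))^-1 by rewrite invfM mulrC ler_pM2l.
apply/andP; split.
  by apply: le_trans g1; apply: le_trans lo; rewrite -mulrA ler_pM2l.
apply: le_trans g2 _; apply: lerD e2; apply: le_trans up _.
by rewrite -mulrA ler_pM2l.
Qed.

End LimitConstant.

Section LimitConstantBounds.
Context {R : realType}.
Local Open Scope classical_set_scope.

Lemma A_const_primitive : exists (Psi : R -> R) (l : R),
  [/\ (forall x : R, 0 < x -> is_derive x (1 : R) Psi (limit_density a_const x)),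
      (forall x : R, 0 < x -> 0 <= Psi x <= 2 * Num.sqrt x),
      (forall x : R, 0 < x -> Psi x <= l) &
      (forall x : R, 1 <= x -> l - Psi x <= expR (- x))] /\
  [/\ 0 < l, (A_const : R) ^+ 2 = l^-1, 0 < (A_const : R) &
    ((13 * 100 + 95) * 100 + 5) / (10 * 100 * 100) <= (A_const : R) <=
    ((13 * 100 + 95) * 100 + 15) / (10 * 100 * 100)].
Proof.
have [_ [_ aB _ _ _]] := @a_const_airyV R; have [a1 a2] := andP aB.
have h1 : 1 <= 2 * a_const :> R by lra.
have [P [g [dP P0 Pg]]] := exists_gauss6_integral _ h1.
pose l : R := 2 / Num.sqrt pi * g.
exists (density_primitive P), l.
have p0 := @sqrt_pi_gt0 R.
have sp : Num.sqrt pi ^+ 2 = pi :> R by rewrite sqr_sqrtr// pi_ge0.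
have [pi1 pi2] := andP (@pi_bounds R).
have gB := gauss6_integral_bounds _ _ dP P0 aB _ Pg.
(* The tail becomes a variable subject to a linear equation, which [lra] can use. *)
have [t et tB] : exists2 t : R, t * (26 * (125 * 125)) = 1 & t = (26 * (125 * 125))^-1.
  by exists ((26 * (125 * 125))^-1) => //; rewrite mulVf.
move: gB; rewrite -{}tB => /andP[g1 g2].
have g0 : 0 < g by apply: lt_le_trans g1; lra.
have l0 : 0 < l by rewrite !mulr_gt0// invr_gt0.
have Al : (A_const : R) = (Num.sqrt l)^-1.
  have := Rintegral_limit_density _ P g dP P0 Pg; rewrite -/l /limit_density => el.
  rewrite /A_const el.
  by rewrite powRN div1r powR12_sqrt ?(ltW l0).
have A0 : 0 < (A_const : R) by rewrite Al invr_gt0 sqrtr_gt0.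
split; first split.
- exact: is_derive_density_primitive.
- by move=> x x0; exact: (density_primitive_bounds _ h1 _ dP P0).
- by move=> x x0; exact: (density_primitive_le _ _ _ dP Pg).
- by move=> x x1; exact: (density_primitive_tail _ h1 _ _ dP Pg).
have A2 : (A_const : R) ^+ 2 = l^-1 by rewrite Al exprVn sqr_sqrtr// ltW.
split => //.
(* 1.772424 and 1.77257 enclose sqrt pi, which equals 2 g A^2; an A outside the claimed bounds then
   contradicts the enclosure of g linearly. *)
pose r1 : R := ((1 * 100 + 77) * 100 + 24) * 100 + 24; pose r2 : R := (17 * 100 + 72) * 100 + 57.
have s1 : r1 / (100 * 100 * 100) <= Num.sqrt pi.
  rewrite -(@ler_pXn2r _ 2) ?nnegrE ?(ltW p0)//; last by rewrite /r1; lra.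
  by rewrite sp; apply: le_trans pi1; rewrite /r1; lra.
have s2 : Num.sqrt pi <= r2 / (10 * 100 * 100).
  rewrite -(@ler_pXn2r _ 2) ?nnegrE ?(ltW p0)//; last by rewrite /r2; lra.
  by rewrite sp; apply: le_trans pi2 _; rewrite /r2; lra.
have sN : Num.sqrt pi != 0 :> R by rewrite gt_eqF.
have e : (A_const : R) ^+ 2 * (2 * g) = Num.sqrt pi.
  have gN : g != 0 by rewrite gt_eqF.
  by rewrite A2 /l; move: sN; move: (Num.sqrt pi) => u u0; field; rewrite gN u0.
move: s1 s2; rewrite -e /r1 /r2 => s1 s2.
apply/andP; split; rewrite leNgt; apply/negP => h.
  have : (A_const : R) ^+ 2 < (((13 * 100 + 95) * 100 + 5) / (10 * 100 * 100)) ^+ 2.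
    by rewrite ltrXn2r// ?nnegrE ?(ltW A0)//; lra.
  move=> h2; have := ltr_pM2r (_ : 0 < 2 * g); rewrite mulr_gt0// => /(_ isT) h3.
  by move: h2; rewrite -h3; lra.
have : (((13 * 100 + 95) * 100 + 15) / (10 * 100 * 100)) ^+ 2 < (A_const : R) ^+ 2.
  by rewrite ltrXn2r// ?nnegrE ?(ltW A0)//; lra.
move=> h2; have := ltr_pM2r (_ : 0 < 2 * g); rewrite mulr_gt0// => /(_ isT) h3.
by move: h2; rewrite -h3; lra.
Qed.

End LimitConstantBounds.

(** * Wallis and Stirling *)

Section Wallis.
Context {R : realType}.
Implicit Types x : R.

(** The central binomial coefficient over 4^m. *)
Definition wallis m : R := \prod_(i < m) ((i%:R + 2^-1) / (i%:R + 1)).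

Lemma wallisS m : wallis m.+1 = wallis m * ((m%:R + 2^-1) / (m%:R + 1)).
Proof. by rewrite /wallis big_ord_recr. Qed.

Lemma wallis_gt0 m : 0 < wallis m.
Proof. by apply: prodr_gt0 => i _; rewrite divr_gt0 ?ltr_wpDl// ?invr_gt0. Qed.

Lemma wallis_le1 m : wallis m <= 1.
Proof.
elim: m => [|m IH]; first by rewrite /wallis big_ord0.
rewrite wallisS mulr_ile1 ?(ltW (wallis_gt0 m))//.
by rewrite ler_pdivrMr ?ltr_wpDl// mul1r lerD2l; lra.
Qed.

(** The reduction formula for the primitive of sin^n that vanishes at 0; its values at pi/2 are the
    Wallis integrals. *)
Fixpoint sin_primitive n x : R := match n with
  | 0 => x
  | 1 => 1 - cos x
  | m.+2 => (m.+1%:R * sin_primitive m x - cos x * sin x ^+ m.+1) / m.+2%:R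
  end.

Lemma is_derive_sin_primitive n x : is_derive x (1 : R) (sin_primitive n) (sin x ^+ n).
Proof.
elim/ltn_ind: n => -[|[|n]] IH; first by rewrite expr0; exact: dv_id.
  by apply: (dv_ext _ (fun x => 1 - cos x)) => //; rewrite expr1; dv; ring.
have h := IH n (ltnW (ltnSn n.+1)).
apply: (dv_ext _ (fun x => (n.+1%:R * sin_primitive n x - cos x * sin x ^+ n.+1) / n.+2%:R)) => //.
have n2 : n.+2%:R != 0 :> R by rewrite pnatr_eq0.
have c2 : cos x * cos x = 1 - sin x ^+ 2 by rewrite -expr2 -(cos2Dsin2 x) addrK.
have e : n.+2%:R = n.+1%:R + 1 :> R by rewrite natr1.
dv; rewrite /= !exprS; move: (sin_primitive n x) (sin x) (cos x) c2 n2 e => y s c c2.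
move: (n.+1%:R) (n.+2%:R) (s ^+ n) => p q w q0 e.
have -> : s * (s * w) = (p * w * (1 - c * c) + s * (s * w)) / q.
  by rewrite c2 e; field; rewrite -e.
by rewrite e; field; rewrite -e.
Qed.

Lemma sin_primitive0 n : sin_primitive n 0 = 0.
Proof.
elim/ltn_ind: n => -[|[|n]] IH //=; first by rewrite cos0 subrr.
by rewrite IH// sin0 exprS mul0r !mulr0 subrr mul0r.
Qed.

Lemma sin_primitive_pihalf_rec n :
  sin_primitive n.+2 (pi / 2) = n.+1%:R / n.+2%:R * sin_primitive n (pi / 2).
Proof. by rewrite /= cos_pihalf mul0r subr0 mulrAC. Qed.

Lemma sin_primitive_even m : sin_primitive (2 * m) (pi / 2) = pi / 2 * wallis m.
Proof.
elim: m => [|m IH]; first by rewrite /wallis big_ord0 mulr1.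
rewrite (_ : (2 * m.+1 = (2 * m).+2)%N); last by lia.
rewrite sin_primitive_pihalf_rec IH wallisS.
have -> : (2 * m).+2%:R = 2 * (m%:R + 1) :> R by rewrite -addn2 natrD natrM mulrDr mulr1.
have -> : (2 * m).+1%:R = 2 * m%:R + 1 :> R by rewrite -addn1 natrD natrM.
have m0 : m%:R + 1 != 0 :> R by rewrite natr1 pnatr_eq0.
by move: (wallis m) m0; move: (m%:R) => u w u0; field.
Qed.

Lemma sin_primitive_odd m :
  sin_primitive (2 * m + 1) (pi / 2) = ((2 * m + 1)%:R * wallis m)^-1.
Proof.
elim: m => [|m IH].
  by rewrite /= /wallis big_ord0 cos_pihalf subr0 !mulr1 invr1.
rewrite (_ : (2 * m.+1 + 1 = (2 * m + 1).+2)%N); last by lia.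
rewrite sin_primitive_pihalf_rec IH wallisS.
have -> : (2 * m + 1).+2%:R = 2 * m%:R + 3 :> R by rewrite -addn2 -addnA natrD natrM.
have -> : (2 * m + 1).+1%:R = 2 * m%:R + 2 :> R by rewrite -addn1 -addnA natrD natrM.
rewrite natrD natrM.
have w0 := wallis_gt0 m; have m1 : 0 <= m%:R :> R by [].
have m0 : m%:R + 1 != 0 :> R by rewrite natr1 pnatr_eq0.
move: (wallis m) w0 m1 m0; move: (m%:R) => u w w0 u1 u0.
have h1 : 2 * u + 1 != 0 by rewrite gt_eqF//; lra.
have h3 : 2 * u + 3 != 0 by rewrite gt_eqF//; lra.
have -> : u + 2^-1 = (2 * u + 1) / 2 by field.
have -> : 2 * u + 2 = 2 * (u + 1) by ring.
have w1 : w != 0 by rewrite gt_eqF.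
by move: (u + 1) (2 * u + 1) (2 * u + 3) u0 h1 h3 => x y z x0 y0 z0; field; rewrite x0 y0 z0 w1.
Qed.

Lemma sin_primitive_le n : sin_primitive n.+1 (pi / 2) <= sin_primitive n (pi / 2).
Proof.
have p0 : 0 < pi / 2 :> R by rewrite divr_gt0// pi_gt0.
have := dv_increment_le (sin_primitive n.+1) (sin_primitive n) (fun x => sin x ^+ n.+1)
  (fun x => sin x ^+ n) 0 (pi / 2) (ltW p0).
rewrite !sin_primitive0 !subr0; apply.
- by move=> x _; exact: is_derive_sin_primitive.
- by move=> x _; exact: is_derive_sin_primitive.
move=> x /andP[x0 xp]; have s0 : 0 <= sin x.
  by rewrite sin_ge0_pi// (ltW x0) /=; have := @pi_gt0 R; lra.
by rewrite exprS ler_piMl ?exprn_ge0// sin_le1.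
Qed.

(** Compares the Wallis integrals of exponents 2m + 1 and 2m: one contains the inverse of
    [wallis m], the other [wallis m] itself, so the square appears. *)
Lemma wallis_ge m : (pi * (m%:R + 2^-1))^-1 <= wallis m ^+ 2.
Proof.
have := sin_primitive_le (2 * m); rewrite -addn1 sin_primitive_odd sin_primitive_even.
have w0 := wallis_gt0 m; have p0 := @pi_gt0 R; have m1 : 0 <= m%:R :> R by [].
rewrite natrD natrM => h.
have m2 : 0 < m%:R + 2^-1 :> R by lra.
rewrite -[X in X <= _]mul1r ler_pdivrMr ?mulr_gt0//.
have y0 : 0 < (2 * m%:R + 1) * wallis m by rewrite mulr_gt0//; lra.
have := ler_wpM2r (ltW y0) h; rewrite mulVf ?gt_eqF//.
by move/le_trans; apply; rewrite le_eqVlt; apply/orP; left; apply/eqP; field.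
Qed.

Lemma wallis_le m : wallis m.+1 ^+ 2 <= (pi * m.+1%:R)^-1.
Proof.
have := sin_primitive_le (2 * m + 1); rewrite (_ : ((2 * m + 1).+1 = 2 * m.+1)%N); last by lia.
rewrite sin_primitive_odd sin_primitive_even.
have w0 := wallis_gt0 m; have w1 := wallis_gt0 m.+1.
have p0 := @pi_gt0 R; have m1 : 0 <= m%:R :> R by [].
have -> : ((2 * m + 1)%:R * wallis m)^-1 = (2 * m.+1%:R * wallis m.+1)^-1.
  rewrite wallisS -(natr1 m) natrD natrM.
  have m0 : m%:R + 1 != 0 :> R by rewrite natr1 pnatr_eq0.
  congr (_^-1); move: (wallis m) m0; move: (m%:R) => u w u0; by field.
move=> h; rewrite -[X in _ <= X]mul1r ler_pdivlMr ?mulr_gt0//.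
have y0 : 0 < 2 * m.+1%:R * wallis m.+1 by rewrite !mulr_gt0.
have := ler_wpM2r (ltW y0) h; rewrite mulVf ?gt_eqF//.
by apply: le_trans; rewrite le_eqVlt; apply/orP; left; apply/eqP; field.
Qed.

End Wallis.

(** * Increments in Stirling's formula *)

Section Stirling.
Context {R : realType}.
Implicit Types x : R.

Lemma ln1D_ge x : 0 <= x -> x - x ^+ 2 / 2 <= ln (1 + x).
Proof.
move=> x0.
have := dv_increment_le (fun x => x - x ^+ 2 / 2) (fun x => ln (1 + x)) (fun x => 1 - x)
  (fun x => (1 + x)^-1) 0 x x0.
rewrite addr0 ln1 expr0n /= mul0r !subr0; apply.
- by move=> u _; dv; field.
- by move=> u /andP[u0 _]; dv; [lra|ring].
- move=> u /andP[u0 _]; rewrite -[X in _ <= X]mul1r ler_pdivlMr; last lra.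
  by have := sqr_ge0 u; lra.
Qed.

Lemma ln1D_le x : 0 <= x -> ln (1 + x) <= x - x ^+ 2 / 2 + x ^+ 3 / 3.
Proof.
move=> x0.
have := dv_increment_le (fun x => ln (1 + x)) (fun x => x - x ^+ 2 / 2 + x ^+ 3 / 3)
  (fun x => (1 + x)^-1) (fun x => 1 - x + x ^+ 2) 0 x x0.
rewrite addr0 ln1 !expr0n /= !mul0r !addr0 !subr0; apply.
- by move=> u /andP[u0 _]; dv; [lra|ring].
- by move=> u _; dv; field.
- move=> u /andP[u0 _]; rewrite -[X in X <= _]mul1r ler_pdivrMr; last lra.
  by have := exprn_ge0 3 (ltW u0); lra.
Qed.

Definition stirling_defect n : R := ln n`!%:R - (n%:R + 2^-1) * ln n%:R + n%:R.

Lemma stirling_defect_step n : (0 < n)%N ->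
  `|stirling_defect n - stirling_defect n.+1| <= (4 * n%:R ^+ 2)^-1.
Proof.
move=> n0; have n1 : 0 < n%:R :> R by rewrite ltr0n.
have n1' : 0 < n.+1%:R :> R by rewrite ltr0n.
pose x : R := n%:R^-1; have x0 : 0 < x by rewrite invr_gt0.
have nN : n%:R != 0 :> R by rewrite gt_eqF.
have x1 : x <= 1 by rewrite invf_le1// ler1n.
have e : stirling_defect n - stirling_defect n.+1 = (x^-1 + 2^-1) * ln (1 + x) - 1.
  rewrite /stirling_defect factS natrM lnM ?posrE// ?ltr0n ?fact_gt0//.
  have -> : 1 + x = n.+1%:R / n%:R by rewrite -natr1 /x; field.
  rewrite ln_div ?posrE// /x invrK -natr1; ring.
have -> : (4 * n%:R ^+ 2)^-1 = x ^+ 2 / 4 by rewrite /x; field.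
have y0 : 0 < x^-1 + 2^-1 by rewrite addr_gt0// invr_gt0.
have xN : x != 0 by rewrite gt_eqF.
have h1 := ler_wpM2l (ltW y0) (ln1D_ge _ (ltW x0)).
have h2 := ler_wpM2l (ltW y0) (ln1D_le _ (ltW x0)).
have e1 : (x^-1 + 2^-1) * (x - x ^+ 2 / 2) = 1 - x ^+ 2 / 4 by field.
have e2 : (x^-1 + 2^-1) * (x - x ^+ 2 / 2 + x ^+ 3 / 3) = 1 + x ^+ 2 / 12 + x ^+ 3 / 6 by field.
rewrite e1 in h1; rewrite e2 in h2.
have x3 : x ^+ 3 <= x ^+ 2 by rewrite exprS ler_piMl ?sqr_ge0.
by rewrite e ler_norml; apply/andP; split; move: h1 h2; move: (_ * ln _) => w; lra.
Qed.

(** The sum of k steps, each at most 1/(4 k^2). *)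
Lemma stirling_defect_double k : (0 < k)%N ->
  `|stirling_defect k - stirling_defect (2 * k)| <= (4 * k%:R)^-1.
Proof.
move=> k0; have k1 : 0 < k%:R :> R by rewrite ltr0n.
suff h m : `|stirling_defect k - stirling_defect (k + m)| <= m%:R * (4 * k%:R ^+ 2)^-1.
  rewrite mul2n -addnn; apply: le_trans (h k) _.
  by rewrite le_eqVlt; apply/orP; left; apply/eqP; field; rewrite gt_eqF.
elim: m => [|m IH]; first by rewrite addn0 subrr normr0 mul0r.
have -> : stirling_defect k - stirling_defect (k + m.+1) =
  (stirling_defect k - stirling_defect (k + m)) + (stirling_defect (k + m) - stirling_defect (k + m).+1).
  by rewrite addnS; ring.
apply: le_trans (ler_normD _ _) _; rewrite -natr1 mulrDl mul1r lerD//.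
apply: le_trans (stirling_defect_step _ _) _; first by rewrite addn_gt0 k0.
have km : 0 < (k + m)%:R :> R by rewrite ltr0n addn_gt0 k0.
rewrite lef_pV2 ?posrE ?mulr_gt0 ?exprn_gt0// ler_pM2l//.
by rewrite lerXn2r ?nnegrE// ler_nat leq_addr.
Qed.

End Stirling.

(** * Asymptotics of the modulus *)

Section ModulusCoefficient.
Context {R : realType}.
Variable k : nat.
Local Notation b := (k%:R + 2^-1 : R).

Lemma wallis_fact m : @wallis R m * (2 ^+ (2 * m) * m`!%:R ^+ 2) = (2 * m)`!%:R.
Proof.
elim: m => [|m IH]; first by rewrite /wallis big_ord0 muln0 expr0 !mul1r expr1n.
rewrite (_ : (2 * m.+1 = (2 * m).+2)%N); last by lia.
rewrite !factS !natrM -IH wallisS.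
have -> : 2 ^+ (2 * m).+2 = 4 * 2 ^+ (2 * m) :> R by rewrite !exprS; ring.
have -> : (2 * m).+2%:R = 2 * (m%:R + 1) :> R by rewrite -addn2 natrD natrM mulrDr mulr1.
have -> : (2 * m).+1%:R = 2 * m%:R + 1 :> R by rewrite -addn1 natrD natrM.
rewrite -(natr1 m); have m0 : m%:R + 1 != 0 :> R by rewrite natr1 pnatr_eq0.
move: (wallis m) (m`!%:R) (2 ^+ (2 * m)) m0; move: (m%:R) => u x y z u0.
by field.
Qed.

(** Each factor is (k - i)(k + i + 1), so the product extends (k - m)! to (k + m)!. *)
Lemma prod_sub_sqr_fact m : (m <= k)%N ->
  \prod_(i < m) (b ^+ 2 - (i%:R + 2^-1) ^+ 2) * (k - m)`!%:R = (k + m)`!%:R.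
Proof.
elim: m => [|m IH] mk; first by rewrite big_ord0 mul1r subn0 addn0.
rewrite big_ord_recr /= addnS factS natrM -(IH (ltnW mk)).
have -> : (k - m = (k - m.+1).+1)%N by lia.
rewrite factS natrM.
have -> : (k - m.+1).+1%:R = k%:R - m%:R :> R by rewrite -natrB ?(ltnW mk)//; congr (_%:R); lia.
have -> : (k + m).+1%:R = k%:R + m%:R + 1 :> R by rewrite -natr1 natrD.
by move: (\prod_(i < m) _) ((k - m.+1)`!%:R); move: (k%:R) (m%:R) => x y z w; field.
Qed.

Lemma modulus_coef_wallis m :
  modulus_coef k m = wallis m * \prod_(i < m) (b ^+ 2 - (i%:R + 2^-1) ^+ 2).
Proof. by rewrite /modulus_coef big_split. Qed.

Lemma modulus_coef_fact : modulus_coef k k * (2 ^+ (2 * k) * k`!%:R ^+ 2) = (2 * k)`!%:R ^+ 2 :> R.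
Proof.
rewrite modulus_coef_wallis mulrAC wallis_fact.
have := prod_sub_sqr_fact k (leqnn k); rewrite subnn mulr1 addnn -mul2n => ->.
by rewrite expr2.
Qed.

(** The coefficient is the square of (2k)!/(2^k k!), in which the Stirling defects of 2k and k enter
    with opposite signs. *)
Lemma ln_modulus_coef : (0 < k)%N ->
  `|ln (modulus_coef k k) - (ln 2 + 2 * k%:R * ln 2 + 2 * k%:R * ln k%:R - 2 * k%:R)| <= (2 * k%:R)^-1 :> R.
Proof.
move=> k0; have k1 : 0 < k%:R :> R by rewrite ltr0n.
have c0 := @modulus_coef_gt0 R k k (leqnn k).
have f1 : 0 < k`!%:R :> R by rewrite ltr0n fact_gt0.
have f2 : 0 < (2 * k)`!%:R :> R by rewrite ltr0n fact_gt0.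
have e := congr1 (@ln R) modulus_coef_fact.
rewrite lnM ?posrE ?mulr_gt0 ?exprn_gt0// lnM ?posrE ?exprn_gt0// !lnXn// in e.
have := @stirling_defect_double R k k0; rewrite /stirling_defect natrM lnM ?posrE//.
move: e; move: (ln (modulus_coef _ _)) (ln k`!%:R) (ln (2 * k)`!%:R) (ln 2) (ln k%:R) => x y z w v.
rewrite -(mulr_natl w) -(mulr_natl y 2) -(mulr_natl z 2) natrM => e h.
have -> : x - (w + 2 * k%:R * w + 2 * k%:R * v - 2 * k%:R) =
  - (2 * (y - (k%:R + 2^-1) * v + k%:R - (z - (2 * k%:R + 2^-1) * (w + v) + 2 * k%:R))).
  have -> : x = 2 * z - (2 * k%:R * w + 2 * y) by rewrite -e; ring.
  by field.
rewrite normrN normrM (@ger0_norm _ 2)//.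
have -> : (2 * k%:R)^-1 = 2 * (4 * k%:R)^-1 :> R by field; rewrite gt_eqF.
by rewrite ler_pM2l.
Qed.

End ModulusCoefficient.

Section ProductBounds.
Context {R : realType}.
Implicit Types (u : nat -> R) (m : nat).

Lemma prod_1B_ge0 u m : (forall i, (i < m)%N -> 0 <= u i <= 1) -> 0 <= \prod_(i < m) (1 - u i).
Proof. by move=> h; apply: prodr_ge0 => i _; rewrite subr_ge0; have /andP[] := h i (ltn_ord i). Qed.

Lemma prod_1B_le_expR u m : (forall i, (i < m)%N -> 0 <= u i <= 1) ->
  \prod_(i < m) (1 - u i) <= expR (- \sum_(i < m) u i).
Proof.
elim: m => [|m IH] h; first by rewrite !big_ord0 oppr0 expR0.
rewrite !big_ord_recr /= opprD expRD; apply: ler_pM.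
- by apply: prod_1B_ge0 => i im; apply: h; exact: leqW.
- by rewrite subr_ge0; have /andP[] := h m (ltnSn m).
- by apply: IH => i im; apply: h; exact: leqW.
- exact: expR_ge1Dx.
Qed.

Lemma prod_1B_ge_sum u m : (forall i, (i < m)%N -> 0 <= u i <= 1) ->
  1 - \sum_(i < m) u i <= \prod_(i < m) (1 - u i).
Proof.
elim: m => [|m IH] h; first by rewrite !big_ord0 subr0.
have {}IH := IH (fun i im => h i (leqW im)).
have p1 : \prod_(i < m) (1 - u i) <= 1.
  apply: le_trans (prod_1B_le_expR _ _ (fun i im => h i (leqW im))) _.
  rewrite -[X in _ <= X]expR0 ler_expR oppr_le0; apply: sumr_ge0 => i _.
  by have /andP[] := h i (leqW (ltn_ord i)).
have /andP[u0 u1] := h m (ltnSn m).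
rewrite !big_ord_recr /=; move: IH p1; move: (\prod_(i < m) _) (\sum_(i < m) _) => p t IH p1.
by have := ler_wpM2r u0 p1; lra.
Qed.

(* (1 - u) e^u >= (1 - u) (1 + u). *)
Lemma prod_1B_ge_expR u m : (forall i, (i < m)%N -> 0 <= u i <= 1) ->
  expR (- \sum_(i < m) u i) * (1 - \sum_(i < m) u i ^+ 2) <= \prod_(i < m) (1 - u i).
Proof.
move=> h.
have h2 i : (i < m)%N -> 0 <= u i ^+ 2 <= 1.
  by move=> /h/andP[u0 u1]; rewrite sqr_ge0 /= expr_le1.
have := ler_wpM2l (expR_ge0 (- \sum_(i < m) u i)) (prod_1B_ge_sum (fun i => u i ^+ 2) m h2).
move/le_trans; apply; rewrite -sumrN expR_sum -big_split /=.
apply: ler_prod => i _; have /andP[u0 u1] := h i (ltn_ord i).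
rewrite mulr_ge0 ?expR_ge0 ?subr_ge0 ?expr_le1//=.
have -> : 1 - u i ^+ 2 = (1 + u i) * (1 - u i) by ring.
rewrite mulrA ler_piMl ?subr_ge0// expRN mulrC ler_pdivrMr ?expR_gt0// mul1r.
exact: expR_ge1Dx.
Qed.

Lemma sum_half_sqr m : \sum_(i < m) (i%:R + 2^-1) ^+ 2 = m%:R ^+ 3 / 3 - m%:R / 12 :> R.
Proof.
elim: m => [|m IH]; first by rewrite big_ord0 expr0n !mul0r subr0.
by rewrite big_ord_recr /= IH -(natr1 m); move: (m%:R) => x; field.
Qed.

End ProductBounds.

Section WallisSqrt.
Context {R : realType}.

Lemma wallis_le_sqrt m : wallis m.+1 <= (Num.sqrt (pi * m.+1%:R))^-1 :> R.
Proof.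
have p0 : 0 < pi * m.+1%:R :> R by rewrite mulr_gt0 ?pi_gt0.
rewrite -(@ler_pXn2r _ 2) ?nnegrE ?invr_ge0 ?sqrtr_ge0 ?(ltW (wallis_gt0 _))//.
by rewrite exprVn sqr_sqrtr ?(ltW p0)// wallis_le.
Qed.

Lemma wallis_ge_sqrt m : (Num.sqrt (pi * m.+1%:R))^-1 <= wallis m :> R.
Proof.
have p0 : 0 < pi * m.+1%:R :> R by rewrite mulr_gt0 ?pi_gt0.
rewrite -(@ler_pXn2r _ 2) ?nnegrE ?invr_ge0 ?sqrtr_ge0 ?(ltW (wallis_gt0 _))//.
rewrite exprVn sqr_sqrtr ?(ltW p0)//; apply: le_trans (wallis_ge m).
rewrite lef_pV2 ?posrE ?mulr_gt0 ?pi_gt0//.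
by rewrite ler_pM2l ?pi_gt0// -(natr1 m) lerD2l; lra.
Qed.

End WallisSqrt.

(** * The modulus at the first zero as a Riemann sum *)

Section ModulusSum.
Context {R : realType}.
Variables (k : nat) (a s z K : R).
Local Notation b := (@GRing.natmul R 1 k + 2^-1).

(** A term of S(z)/z^k counted from the leading coefficient, without its Wallis factor. Below, s =
    b^(-1/3), and the nodes of the Riemann sum are m s^2. *)
Definition modulus_ratio m : R := \prod_(i < m) ((b ^+ 2 - (i%:R + 2^-1) ^+ 2) / z).

Definition modulus_sum : R := \sum_(m < k.+1) wallis m * modulus_ratio m.

Hypothesis k0 : (0 < k)%N.
Hypothesis a1 : 1 <= a.
Hypothesis s0 : 0 < s.
Hypothesis sb : s ^+ 3 * b = 1.
Hypothesis z0 : 0 < z.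
Hypothesis K0 : 0 <= K.
Hypothesis z_le : ln z <= 2 * (ln b + a * s ^+ 2).
Hypothesis z_ge : 2 * (ln b + a * s ^+ 2) - K * s ^+ 4 <= ln z.

Lemma modulus_poly_sum : (modulus_poly k).[z] = z ^+ k * modulus_sum.
Proof.
rewrite /modulus_poly horner_poly (reindex_inj rev_ord_inj) /= mulr_sumr.
apply: eq_bigr => i _; have ik : (i <= k)%N by rewrite -ltnS.
rewrite subSS subKn// modulus_coef_wallis /modulus_ratio big_split /= prodr_const card_ord.
rewrite mulrCA -!mulrA; congr (_ * _); rewrite mulrCA; congr (_ * _).
by rewrite exprVn -expfB_cond// ?(gt_eqF z0)//.
Qed.

Let b0 : 0 < b. Proof. exact: b_gt0. Qed.

Lemma scale_le1 : s <= 1.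
Proof.
rewrite leNgt; apply/negP => s1; have : 1 < s ^+ 3 by rewrite exprn_egt1.
have k1 : 1 <= k%:R :> R by rewrite ler1n.
by move=> h; have := ltr_pM2r b0 1 (s ^+ 3); rewrite h sb mul1r; lra.
Qed.

Let defect i : R := ((i%:R + 2^-1) / b) ^+ 2.

Let defect_bounds m : (m <= k)%N -> forall i, (i < m)%N -> 0 <= defect i <= 1.
Proof.
move=> mk i im; rewrite sqr_ge0 /= expr_le1 ?divr_ge0 ?addr_ge0 ?invr_ge0 ?(ltW b0)//.
rewrite ler_pdivrMr// mul1r lerD2r ler_nat; exact: leq_trans (ltnW im) mk.
Qed.

Let bs : b^-1 = s ^+ 3.
Proof. by rewrite -[LHS]mul1r -{1}sb mulfK// gt_eqF. Qed.

Let sum_defect m : \sum_(i < m) defect i = (m%:R * s ^+ 2) ^+ 3 / 3 - m%:R * s ^+ 6 / 12.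
Proof.
rewrite (eq_bigr (fun i : 'I_m => (i%:R + 2^-1) ^+ 2 * s ^+ 6)) => [|i _].
  by rewrite -mulr_suml sum_half_sqr; field.
by rewrite /defect exprMn bs -exprM.
Qed.

Let modulus_ratioE m : modulus_ratio m = expR (2 * ln b - ln z) ^+ m * \prod_(i < m) (1 - defect i).
Proof.
have -> : expR (2 * ln b - ln z) = b ^+ 2 / z.
  have -> : 2 * ln b - ln z = ln (b ^+ 2 / z).
    by rewrite ln_div ?posrE ?exprn_gt0// lnXn// mulr_natl.
  by rewrite lnK// posrE divr_gt0// exprn_gt0.
rewrite -[X in _ ^+ X](card_ord m) -prodr_const -big_split /=; apply: eq_bigr => i _.
rewrite /defect; have bN : b != 0 by rewrite gt_eqF//.
  have zN : z != 0 by rewrite gt_eqF//.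
  move: bN zN; move: (k%:R + 2^-1) (i%:R + 2^-1) z => c d e c0 e0.
  by field; rewrite c0 e0.
Qed.

Definition density_exp x : R := expR (- (x ^+ 3 / 3%:R) - 2%:R * a * x).

(** With x = m s^2, the power of b^2/z contributes -2 a x to the exponent and the squares contribute
    - x^3/3. As m <= b = s^-3, the errors m s^4 and m s^6 are at most s, whence the factor
    e^((K+1)s). *)
Lemma modulus_ratio_le m : (m <= k)%N ->
  modulus_ratio m <= density_exp (m%:R * s ^+ 2) * expR ((K + 1) * s).
Proof.
move=> mk; rewrite modulus_ratioE.
apply: (@le_trans _ _ (expR (2 * ln b - ln z) ^+ m * expR (- \sum_(i < m) defect i))).
  by rewrite ler_wpM2l ?exprn_ge0 ?expR_ge0// prod_1B_le_expR//; exact: defect_bounds.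
rewrite sum_defect -expRM_natl -!expRD ler_expR /density_exp.
have m0 : 0 <= m%:R :> R by [].
have h1 : m%:R * (2 * ln b - ln z) <= m%:R * (- 2 * a * s ^+ 2 + K * s ^+ 4).
  rewrite ler_wpM2l//; move: z_ge; move: (ln z) (ln b) => u v; lra.
have ms : m%:R * s ^+ 3 <= 1.
  by rewrite -[X in _ <= X]sb mulrC ler_pM2l ?exprn_gt0//; apply: ler_wpDr; rewrite ?invr_ge0 ?ler_nat.
have ms4 : m%:R * s ^+ 4 <= s.
  by rewrite exprSr mulrA ler_piMl// ltW.
have s3 : s ^+ 3 <= 1 by rewrite exprn_ile1 ?scale_le1// ltW.
have ms6 : m%:R * s ^+ 6 <= s.
  apply: le_trans ms4; rewrite ler_wpM2l// (exprD s 4 2) ler_piMr ?exprn_ge0 ?(ltW s0)//.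
  by rewrite exprn_ile1 ?scale_le1// ltW.
have h2 := ler_wpM2l K0 ms4; move: h1 h2 (s0); lra.
Qed.

Lemma modulus_ratio_ge m : (m <= k)%N ->
  density_exp (m%:R * s ^+ 2) * (1 - (m%:R * s ^+ 2) ^+ 5 * s ^+ 2) <= modulus_ratio m.
Proof.
move=> mk; rewrite modulus_ratioE.
have p0 := prod_1B_ge0 _ _ (defect_bounds m mk).
have [h|h] := leP (1 - (m%:R * s ^+ 2) ^+ 5 * s ^+ 2) 0.
  apply: (@le_trans _ _ 0); first by rewrite mulr_ge0_le0 ?expR_ge0.
  by rewrite mulr_ge0 ?exprn_ge0 ?expR_ge0.
have q0 : expR (- (2 * a * s ^+ 2)) ^+ m <= expR (2 * ln b - ln z) ^+ m.
  rewrite lerXn2r ?nnegrE ?expR_ge0// ler_expR.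
  by move: z_le; move: (ln z) (ln b) => u v; lra.
have d0 := prod_1B_ge_expR _ _ (defect_bounds m mk).
set D2 := \sum_(i < m) defect i ^+ 2 in d0.
(* There are m terms, each at most (m s^3)^4. *)
have D2le : D2 <= (m%:R * s ^+ 2) ^+ 5 * s ^+ 2.
  apply: (@le_trans _ _ (\sum_(i < m) (m%:R ^+ 4 * s ^+ 12))).
    apply: ler_sum => i _; rewrite /defect bs -exprM exprMn -exprM.
    rewrite ler_wpM2r ?exprn_ge0 ?(ltW s0)// lerXn2r ?nnegrE ?addr_ge0 ?invr_ge0//.
    have : i.+1%:R <= m%:R :> R by rewrite ler_nat.
    by rewrite -natr1; lra.
  rewrite sumr_const card_ord -mulr_natl le_eqVlt; apply/orP; left; apply/eqP; ring.
have : 0 <= 1 - D2 by lra.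
move: D2 D2le d0 => D2 D2le d0 D20.
apply: le_trans (ler_wpM2l (exprn_ge0 m (expR_ge0 _)) d0).
rewrite [leRHS]mulrA; apply: (ler_pM (expR_ge0 _) (ltW h)); last by rewrite lerD2l lerN2.
apply: (@le_trans _ _ (expR (- (2 * a * s ^+ 2)) ^+ m * expR (- \sum_(i < m) defect i))).
  rewrite sum_defect -expRM_natl -expRD ler_expR.
  have m6 : 0 <= m%:R * s ^+ 6 by rewrite mulr_ge0 ?exprn_ge0// ltW.
  by rewrite /density_exp; lra.
by rewrite ler_wpM2r ?expR_ge0.
Qed.

Variables (Psi : R -> R) (l : R).
Hypothesis dPsi : forall x : R, 0 < x -> is_derive x (1 : R) Psi (limit_density a x).
Hypothesis Psi_bounds : forall x, 0 < x -> 0 <= Psi x <= 2 * Num.sqrt x.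
Hypothesis Psi_le : forall x, 0 < x -> Psi x <= l.
Hypothesis Psi_tail : forall x, 1 <= x -> l - Psi x <= expR (- x).

Lemma density_exp_anti x y : 0 <= x -> x <= y -> density_exp y <= density_exp x.
Proof.
move=> x0 xy; rewrite ler_expR.
have : x ^+ 3 <= y ^+ 3 by rewrite lerXn2r ?nnegrE ?(le_trans x0).
have : a * x <= a * y by rewrite ler_wpM2l//; apply: le_trans a1.
by lra.
Qed.

Lemma limit_density_anti x y : 0 < x -> x <= y -> limit_density a y <= limit_density a x.
Proof.
move=> x0 xy; have y0 := lt_le_trans x0 xy; have p0 := @pi_gt0 R.
rewrite /limit_density ler_pM ?expR_ge0 ?invr_ge0 ?sqrtr_ge0//.
  exact: density_exp_anti (ltW x0) xy.
by rewrite lef_pV2 ?posrE ?sqrtr_gt0 ?mulr_gt0// ler_sqrt ?mulr_ge0 ?ler_pM2l// ltW.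
Qed.

Lemma primitive_step x y : 0 < x -> x <= y ->
  (y - x) * limit_density a y <= Psi y - Psi x <= (y - x) * limit_density a x.
Proof.
move=> x0 xy; apply/andP; split.
  have := dv_increment_le (fun u => u * limit_density a y) Psi (fun=> limit_density a y)
    (limit_density a) x y xy; rewrite -mulrBl; apply.
  - by move=> u _; dv; ring.
  - by move=> u /andP[xu _]; apply: dPsi; exact: lt_le_trans xu.
  - by move=> u /andP[xu uy]; apply: limit_density_anti (ltW uy); exact: lt_trans xu.
have := dv_increment_le Psi (fun u => u * limit_density a x) (limit_density a)
  (fun=> limit_density a x) x y xy; rewrite -mulrBl; apply.
- by move=> u /andP[xu _]; apply: dPsi; exact: lt_le_trans xu.
- by move=> u _; dv; ring.
- by move=> u /andP[xu uy]; apply: limit_density_anti (ltW xu).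
Qed.

Local Notation x_ m := (m%:R * s ^+ 2).

Let x_gt0 m : 0 < x_ m.+1. Proof. by rewrite mulr_gt0// exprn_gt0. Qed.

(** The Wallis weight 1/sqrt(pi m) is s/sqrt(pi x_m). Since the mesh is s^2, the sum is 1/s times a
    Riemann sum; this 1/s is the source of the factor k^(-1/6) in tau. *)
Let density_node m : density_exp (x_ m.+1) / Num.sqrt (pi * m.+1%:R) = s * limit_density a (x_ m.+1).
Proof.
have -> : limit_density a (x_ m.+1) = density_exp (x_ m.+1) / (Num.sqrt (pi * m.+1%:R) * s).
  rewrite /limit_density (mulrA pi) [Num.sqrt (_ * s ^+ 2)]sqrtrM ?mulr_ge0 ?pi_ge0//.
  by rewrite sqrtr_sqr gtr0_norm.
have := sqrtr_gt0 (pi * m.+1%:R : R).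
rewrite mulr_gt0 ?pi_gt0// => r0.
by move: (density_exp _) (Num.sqrt _) r0 => u v v0; field; rewrite !gt_eqF.
Qed.

Let step m : x_ m.+1 = x_ m + s ^+ 2. Proof. by rewrite -natr1 mulrDl mul1r. Qed.

Let s1 : 0 < s ^+ 2. Proof. exact: exprn_gt0. Qed.

Let nodes_le m n : (m <= n)%N -> x_ m <= x_ n.
Proof. by move=> mn; rewrite ler_pM2r// ler_nat. Qed.

Let modulus_ratio_ge0 m : (m <= k)%N -> 0 <= modulus_ratio m.
Proof.
move=> mk; rewrite modulus_ratioE mulr_ge0 ?exprn_ge0 ?expR_ge0//.
by apply: prod_1B_ge0; exact: defect_bounds.
Qed.

(** The density decreases, so a term is at most the integral over the cell on its left, divided by s
    and up to the exponential factor. The terms m = 0 and m = 1 are bounded by that factor alone,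
    whence the 2. *)
Let partial_sum_le n : (n < k)%N ->
  \sum_(m < n.+2) wallis m * modulus_ratio m <= expR ((K + 1) * s) * (2 + Psi (x_ n.+1) / s).
Proof.
have e0 : 0 <= expR ((K + 1) * s) by exact: expR_ge0.
have E1 m : density_exp (x_ m) <= 1.
  rewrite -[leRHS]expR0 ler_expR subr_le0.
  have x0 : 0 <= x_ m by rewrite mulr_ge0// ltW.
  have ax : 0 <= a * x_ m by rewrite mulr_ge0// (le_trans ler01 a1).
  by have := exprn_ge0 3 x0; lra.
have bound m : (m <= k)%N -> wallis m * modulus_ratio m <= expR ((K + 1) * s).
  move=> mk; apply: le_trans (ler_piMl (modulus_ratio_ge0 _ mk) (wallis_le1 m)) _.
  by apply: le_trans (modulus_ratio_le _ mk) _; rewrite ler_piMl.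
elim: n => [|n IH] nk.
  rewrite !big_ord_recr big_ord0 /= add0r.
  apply: (@le_trans _ _ (expR ((K + 1) * s) * 2)).
    by rewrite mulr_natr mulr2n lerD ?bound.
  rewrite ler_wpM2l// lerDl divr_ge0 ?(ltW s0)//.
  by have /andP[] := Psi_bounds _ (x_gt0 0).
rewrite big_ord_recr /=; apply: le_trans (lerD (IH (ltnW nk)) (le_refl _)) _.
have h1 : wallis n.+2 * modulus_ratio n.+2 <= expR ((K + 1) * s) * (s * limit_density a (x_ n.+2)).
  rewrite -density_node mulrA [leRHS]mulrC; apply: ler_pM; rewrite ?wallis_le_sqrt ?modulus_ratio_ge0 ?(ltW (wallis_gt0 _))//.
  by rewrite mulrC; exact: modulus_ratio_le.
apply: le_trans (lerD (le_refl _) h1) _.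
rewrite -mulrDr ler_wpM2l// -addrA lerD2l -lerBrDl -mulrBl ler_pdivlMr//.
have /andP[+ _] := primitive_step _ _ (x_gt0 n) (nodes_le _ _ (leqnSn n.+1)).
by rewrite (step n.+1) addrAC subrr add0r; apply: le_trans; rewrite le_eqVlt; apply/orP; left; apply/eqP; ring.
Qed.

Lemma modulus_sum_le : modulus_sum <= expR ((K + 1) * s) * (2 + l / s).
Proof.
rewrite /modulus_sum -(prednK k0); apply: le_trans (partial_sum_le k.-1 _) _.
  by rewrite prednK.
by rewrite ler_wpM2l ?expR_ge0// lerD2l ler_pM2r ?invr_gt0// Psi_le.
Qed.

(** Tames the relative error x^5 s^2 of [modulus_ratio_ge]: of the two factors e^(-x), one absorbs
    the power and the other is left for the summation. *)
Let density_exp_moment x : 0 <= x -> density_exp x * x ^+ 5 <= 5 ^+ 5 * expR (- x).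
Proof.
move=> x0; have h : x <= 5 * expR (x / 5) by have := expR_ge1Dx (x / 5); lra.
have h5 : x ^+ 5 <= 5 ^+ 5 * expR x.
  rewrite (_ : expR x = expR (x / 5) ^+ 5); last first.
    by rewrite -expRM_natl; congr expR; field.
  by rewrite -exprMn lerXn2r ?nnegrE// mulr_ge0 ?expR_ge0.
have h2 : density_exp x <= expR (- x) * expR (- x).
  rewrite -expRD ler_expR; have := ler_wpM2r x0 a1; have := exprn_ge0 3 x0; lra.
apply: le_trans (ler_pM (expR_ge0 _) (exprn_ge0 5 x0) h2 h5) _.
rewrite le_eqVlt; apply/orP; left; apply/eqP.
by rewrite !expRN; have := expR_gt0 x; move: (expR x) => e e0; field; rewrite gt_eqF.
Qed.

(** The mesh times e^(-x) is bounded by a telescoping difference, at the price of a factor e. *)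
Let gap_le x : s ^+ 2 * expR (- x) <= expR 1 * (expR (- x) - expR (- (x + s ^+ 2))).
Proof.
rewrite opprD expRD -{2}[expR (- x)]mulr1 -mulrBr mulrCA mulrC ler_pM2l ?expR_gt0//.
have v1 : s ^+ 2 <= 1 by rewrite exprn_ile1 ?scale_le1// ltW.
apply: (@le_trans _ _ (expR 1 * (s ^+ 2 * expR (- s ^+ 2)))).
  rewrite mulrCA -expRD ler_peMr ?(ltW s1)// -[leLHS]expR0 ler_expR subr_ge0.
  exact: v1.
rewrite ler_wpM2l ?expR_ge0// lerBrDr -[X in _ + X]mul1r -mulrDl.
by rewrite expRN ler_pdivrMr ?expR_gt0// mul1r addrC expR_ge1Dx.
Qed.

(** Up to its error, term m is at least the integral over [x_(m+1), x_(m+2)], divided by s; the cell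
    is shifted because the lower Wallis bound involves m + 1. The errors telescope by [gap_le]. *)
Let partial_sum_ge n : (n <= k.+1)%N ->
  (Psi (x_ n.+1) - Psi (x_ 1)) / s - 5 ^+ 5 * expR 1 * (1 - expR (- x_ n)) <=
  \sum_(m < n) wallis m * modulus_ratio m.
Proof.
elim: n => [|n IH] nk; first by rewrite big_ord0 subrr !mul0r oppr0 expR0 subrr mulr0 subr0.
rewrite big_ord_recr /=; apply: le_trans (lerD (IH (ltnW nk)) (le_refl _)).
set D := 5 ^+ 5 * expR 1; have xn0 : 0 <= x_ n by rewrite mulr_ge0// ltW.
have w0 := @wallis_gt0 R n; have w1 := @wallis_le1 R n.
have h1 : wallis n * density_exp (x_ n) - 5 ^+ 5 * expR (- x_ n) * s ^+ 2 <= wallis n * modulus_ratio n.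
  apply: le_trans (ler_wpM2l (ltW w0) (modulus_ratio_ge n nk)).
  rewrite mulrBr mulr1 mulrBr lerD2l lerN2.
  have d0 : 0 <= density_exp (x_ n) * (x_ n ^+ 5 * s ^+ 2) by rewrite !mulr_ge0 ?expR_ge0 ?exprn_ge0// ltW.
  apply: le_trans (ler_piMl d0 w1) _; rewrite mulrA ler_pM2r//; exact: density_exp_moment.
have h2 : (Psi (x_ n.+2) - Psi (x_ n.+1)) / s <= wallis n * density_exp (x_ n).
  apply: (@le_trans _ _ (s * limit_density a (x_ n.+1))).
    have /andP[_ +] := primitive_step _ _ (x_gt0 n) (nodes_le _ _ (leqnSn n.+1)).
    rewrite (step n.+1) addrAC subrr add0r ler_pdivrMr// => /le_trans; apply.
    by rewrite le_eqVlt; apply/orP; left; apply/eqP; ring.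
  rewrite -density_node mulrC; apply: ler_pM.
  - by rewrite invr_ge0 sqrtr_ge0.
  - exact: expR_ge0.
  - exact: wallis_ge_sqrt.
  - by apply: density_exp_anti => //; apply: nodes_le.
have h3 := gap_le (x_ n); rewrite -step in h3.
have h4 := ler_wpM2l (_ : 0 <= 5 ^+ 5) h3; rewrite exprn_ge0// in h4; have {}h4 := h4 isT.
apply: le_trans (lerD (le_refl _) h1).
have -> : (Psi (x_ n.+2) - Psi (x_ 1)) / s = (Psi (x_ n.+1) - Psi (x_ 1)) / s + (Psi (x_ n.+2) - Psi (x_ n.+1)) / s.
  by rewrite -mulrDl; congr (_ / _); ring.
move: h2 h4; rewrite /D; move: (expR (- x_ n)) (expR (- x_ n.+1)) (expR 1) (wallis n * _) (_ / s) (_ / s) (5 ^+ 5).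
by move=> e e' e1 w p q d h2 h4; lra.
Qed.

(** In the constant, 1 pays for the integral beyond x_(k+2), 2 for the integral before x_1, and 5^5
    e for the telescoped errors. *)
Lemma modulus_sum_ge : (l - (3 + 5 ^+ 5 * expR 1) * s) / s <= modulus_sum.
Proof.
apply: le_trans (partial_sum_ge k.+1 (leqnn _)).
(* x_(k+2) >= b s^2 = 1/s, so the tail of the integral is at most e^(-1/s) <= s. *)
have x1 : s^-1 <= x_ k.+2.
  have kb : b <= k.+2%:R by rewrite -[k.+2]addn2 natrD; lra.
  have := ler_wpM2r (ltW s1) kb; apply: le_trans.
  rewrite -[leLHS]mul1r ler_pdivrMr// -[leLHS]sb.
  by rewrite le_eqVlt; apply/orP; left; apply/eqP; ring.
have sV : 1 <= s^-1 by rewrite invf_ge1// scale_le1.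
have t1 : l - Psi (x_ k.+2) <= s.
  apply: le_trans (Psi_tail _ (le_trans sV x1)) _.
  rewrite expRN invf_ple ?posrE ?expR_gt0//; apply: le_trans x1 _.
  by have := expR_ge1Dx (x_ k.+2); lra.
have t2 : Psi (x_ 1) <= 2 * s.
  by have /andP[_] := Psi_bounds _ (x_gt0 0); rewrite mul1r sqrtr_sqr gtr0_norm.
have D0 : 0 <= 5 ^+ 5 * expR 1 :> R by rewrite mulr_ge0 ?expR_ge0 ?exprn_ge0.
apply: (@le_trans _ _ ((Psi (x_ k.+2) - Psi (x_ 1)) / s - 5 ^+ 5 * expR 1)); last first.
  rewrite lerD2l lerN2 ler_piMr// gerBl expR_ge0//.
rewrite lerBrDr -[X in _ + X](mulfK (lt0r_neq0 s0)) -mulrDl ler_pM2r ?invr_gt0//.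
by move: t1 t2; move: (5 ^+ 5 * expR 1) => D; lra.
Qed.

(** For small k the preceding lower bound may be negative; this one keeps the logarithm under
    control there. *)
Lemma modulus_sum_ge1 : 1 <= modulus_sum.
Proof.
rewrite /modulus_sum big_ord_recl /wallis /modulus_ratio !big_ord0 mulr1 lerDl.
apply: sumr_ge0 => i _; rewrite mulr_ge0 ?(ltW (wallis_gt0 _))//.
exact: modulus_ratio_ge0 (ltn_ord i).
Qed.

End ModulusSum.

(** * Assembly *)

Section LogBounds.
Context {R : realType}.
Implicit Types x : R.

Lemma ln_le_sub1 x : 0 < x -> ln x <= x - 1.
Proof. by move=> x0; have := expR_ge1Dx (ln x); rewrite lnK ?posrE//; lra. Qed.

Lemma ln_ge_1subV x : 0 < x -> 1 - x^-1 <= ln x.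
Proof.
by move=> x0; have := ln_le_sub1 x^-1; rewrite invr_gt0 => /(_ x0); rewrite lnV ?posrE//; lra.
Qed.

Lemma expR_sub1_norm x : `|expR x - 1| <= `|x| * expR `|x|.
Proof.
have e1 := expR_ge1Dx `|x|; have [x0|x0] := leP 0 x.
  rewrite ger0_norm; last by rewrite subr_ge0 -expR0 ler_expR.
  rewrite ger0_norm//; have := expR_ge1Dx (- x); rewrite expRN => h.
  have := ler_wpM2r (expR_ge0 x) h; rewrite mulVf ?gt_eqF ?expR_gt0//; lra.
rewrite ler0_norm; last by rewrite subr_le0 -expR0 ler_expR ltW.
have h1 : `|x| <= `|x| * expR `|x|.
  by rewrite ler_peMr// -[leLHS]expR0 ler_expR.
by apply: le_trans h1; rewrite ltr0_norm//; have := expR_ge1Dx x; lra.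
Qed.

Lemma exists_inv_cbrt x : 0 < x -> exists2 c, 0 < c & c ^+ 3 * x = 1.
Proof.
move=> x0; exists (x `^ (- (1 / 3))); first exact: powR_gt0.
rewrite -powR_mulrn ?powR_ge0// -powRrM (_ : - (1 / 3) * 3%:R = - 1); last by field.
by rewrite powR_inv1 ?(ltW x0)// mulVf// gt_eqF.
Qed.

End LogBounds.

(** * Logarithmic enclosure of the first zero *)

Section BesselZeroLog.
Context {R : realType}.
Variable k : nat.
Hypothesis k0 : (0 < k)%N.
Local Notation b := (@GRing.natmul R 1 k + 2^-1).

(** The upper bound is the logarithmic comparison with c = s^-2. The lower one is sqrt z >= mu (1 +
    a c^2) with c = mu^(-1/3), after which mu and c are traded for b and s. *)
Lemma bessel_first_zero_log (s : R) : 0 < s -> s ^+ 3 * b = 1 ->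
  exists z : R, [/\ 0 < z, @besselB R k z = 0, (forall u, 0 <= u < z -> 0 < @besselB R k u),
    ln z <= 2 * (ln b + a_const * s ^+ 2) &
    2 * (ln b + a_const * s ^+ 2) - (16 * a_const ^+ 2 + 1) * s ^+ 4 <= ln z].
Proof.
move=> s0 sb.
have [sg [V0 aB Va V1a Vpos]] := @a_const_airyV R.
move: (a_const : R) aB Va V1a Vpos => a /andP[a1 a2] Va V1a Vpos.
have a0 : 0 < a by lra.
have b0 := @b_gt0 R k.
have dV t : is_derive t (1 : R) (airyV sg) (airyV1 sg t) by exact: is_derive_airyV.
have dV1 t : is_derive t (1 : R) (airyV1 sg) (- 2 * t * airyV sg t) by exact: is_derive_airyV1.
have V00 : airyV sg 0 = 1 /\ airyV1 sg 0 = sg.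
  have [e1 e2 e3 e4] := @airy_at0 R (- 2).
  by rewrite /airyV /airyV1 e1 e2 e3 e4 mulr0 mulr1 addr0 add0r.
have VC t : t <= 0 -> `|airyV sg t| <= 1 + sg /\ `|airyV1 sg t| <= 1 + sg.
  move=> t0; have [v0 v1] := V0 t t0.
  rewrite !gtr0_norm//.
  have h1 : airyV sg t <= airyV sg 0.
    apply: (nondecreasing_dv _ _ _ _ t0) => // u /andP[_ u0].
    by apply: ltW; have [] := V0 u (ltW u0).
  have h2 : airyV1 sg t <= airyV1 sg 0.
    apply: (nondecreasing_dv _ _ _ _ t0) => // u /andP[_ u0].
    have [w _] := V0 u (ltW u0).
    by rewrite mulr_ge0 ?(ltW w)//; lra.
  have [e1 e2] := V00; have := V0 0 (lexx 0); rewrite e1 e2 => -[_ sg0].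
  by rewrite e1 in h1; rewrite e2 in h2; split; lra.
have sN : s != 0 by rewrite gt_eqF.
have bs : b = s^-1 ^+ 3.
  by rewrite exprVn; apply: (mulfI (expf_neq0 3 sN)); rewrite sb mulfV// expf_neq0.
have [|||z [z0 zle Bz Bpos]] := bessel_first_zero_le k (airyV sg) (airyV1 sg) a dV dV1 Va Vpos V1a (s^-1 ^+ 2) (1 + sg).
- by rewrite exprn_gt0// invr_gt0.
- by rewrite bs -!exprM.
- exact: VC.
exists z; split => //.
  have h : ln z <= ln (expR (2 * (ln b + a / s^-1 ^+ 2))) by rewrite ler_ln ?posrE ?expR_gt0.
  by move: h; rewrite expRK exprVn invrK.
have k1 : 1 <= k%:R :> R by rewrite ler1n.
have kk0 : 0 <= k%:R * (k%:R + 1) :> R by rewrite mulr_ge0//; lra.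
pose mu : R := Num.sqrt (k%:R * (k%:R + 1)).
have mu2 : mu ^+ 2 = k%:R * (k%:R + 1) by rewrite sqr_sqrtr.
have mu0 : 0 < mu by rewrite sqrtr_gt0 mulr_gt0//; lra.
have mub : mu <= b.
  rewrite -(@ler_pXn2r _ 2) ?nnegrE ?(ltW mu0) ?(ltW b0)// mu2; lra.
have muk : k%:R <= mu.
  rewrite -(@ler_pXn2r _ 2) ?nnegrE ?(ltW mu0)// mu2; lra.
have [c c0 c3] := exists_inv_cbrt mu mu0.
have ge := bessel_first_zero_ge k (airyV sg) (airyV1 sg) a dV dV1 Vpos mu c z k0 mu0 mu2 c0 c3 z0 Bz Bpos.
have cs : s <= c.
  rewrite -(@ler_pXn2r _ 3) ?nnegrE ?(ltW c0) ?(ltW s0)//.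
  rewrite -(ler_pM2r mu0) c3 -[leRHS]sb; apply: ler_wpM2l mub; exact: exprn_ge0 (ltW s0).
have c2s : c <= 2 * s.
  rewrite -(@ler_pXn2r _ 3) ?nnegrE ?(ltW c0) ?mulr_ge0 ?(ltW s0)//.
  rewrite -(ler_pM2r mu0) c3 -[leLHS]sb (_ : (2 * s) ^+ 3 * mu = s ^+ 3 * (8 * mu)); last by ring.
  rewrite ler_wpM2l ?exprn_ge0 ?(ltW s0)//; lra.
set j := Num.sqrt z in ge.
have j0 : 0 < j by rewrite sqrtr_gt0.
have zj : z = j ^+ 2 by rewrite sqr_sqrtr// ltW.
pose v := a * c ^+ 2.
have v0 : 0 <= v by rewrite mulr_ge0 ?sqr_ge0// ltW.
have jge : mu * (1 + v) <= j.
  have cN : c != 0 by rewrite gt_eqF.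
  rewrite -(ler_pM2l c0).
  have -> : c * (mu * (1 + v)) = c * mu + a * (c ^+ 3 * mu) by rewrite /v; ring.
  by rewrite c3; move: ge; lra.
have lnj : ln mu + ln (1 + v) <= ln j.
  by rewrite -lnM ?posrE ?ler_ln ?posrE ?mulr_gt0//; lra.
have lnz : ln z = 2 * ln j by rewrite zj lnXn// mulr_natl.
(* mu^2 = b^2 - 1/4, so the exchange of mu for b costs O(b^-2) = O(s^6). *)
have lnmu : 2 * ln b - s ^+ 4 <= 2 * ln mu.
  have q0 : 0 < mu ^+ 2 / b ^+ 2 by rewrite divr_gt0// exprn_gt0.
  have := ln_ge_1subV _ q0; rewrite ln_div ?posrE ?exprn_gt0// !lnXn// -(mulr_natl (ln mu)) -(mulr_natl (ln b)).
  have e : b ^+ 2 = mu ^+ 2 + 1 / 4 by rewrite mu2; field.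
  have -> : 1 - (mu ^+ 2 / b ^+ 2)^-1 = - (4 * mu ^+ 2)^-1.
    have mN : mu != 0 by rewrite gt_eqF.
    by rewrite invf_div e; field.
  have -> : s ^+ 4 = s ^+ 4 * 1 by rewrite mulr1.
  have s1 : s <= 1 by apply: (scale_le1 k).
  have : (4 * mu ^+ 2)^-1 <= s ^+ 4 * 1.
    apply: (@le_trans _ _ (s ^+ 6)); last first.
      by rewrite (exprD s 4 2) ler_wpM2l ?exprn_ge0 ?exprn_ile1 ?(ltW s0).
    have -> : s ^+ 6 = (b ^+ 2)^-1 by rewrite bs -exprM exprVn invrK.
    rewrite lef_pV2 ?posrE ?mulr_gt0 ?exprn_gt0// e mu2.
    by have := mulr_ge0 (ler0n R k) (ler0n R k); lra.
  by lra.
have lv := ln1D_ge v v0.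
have v1 : a * s ^+ 2 <= v by rewrite ler_wpM2l ?(ltW a0)// lerXn2r ?nnegrE ?(ltW s0) ?(ltW c0).
(* The quadratic loss in ln(1 + v) >= v - v^2/2; with c <= 2 s it yields the constant 16 a^2. *)
have v2 : v ^+ 2 <= 16 * a ^+ 2 * s ^+ 4.
  have -> : v ^+ 2 = a ^+ 2 * c ^+ 4 by rewrite /v; ring.
  have -> : 16 * a ^+ 2 * s ^+ 4 = a ^+ 2 * (2 * s) ^+ 4 by ring.
  by rewrite ler_wpM2l ?sqr_ge0// lerXn2r ?nnegrE ?mulr_ge0 ?(ltW s0) ?(ltW c0).
by rewrite lnz; lra.
Qed.

End BesselZeroLog.

Section Assembly.
Context {R : realType}.
Local Notation b k := (@GRing.natmul R 1 k + 2^-1).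

(** Put v = C s/l. For v <= 1/2 the lower bound on S suffices; otherwise s/l exceeds 1/(2C), so
    [1 <= S] bounds the logarithm below by - ln(2C), which 2 v ln(2C) covers. *)
Lemma ln_ratio_bound (S l s C e : R) : 0 < s -> 0 < l -> 1 <= C ->
  S <= expR (e * s) * (2 + l / s) -> (l - C * s) / s <= S -> 1 <= S ->
  - (2 * (C / l) * (1 + ln (2 * C))) * s <= ln S - ln (l / s) <= (e + 2 / l) * s.
Proof.
move=> s0 l0 C1 Sle Sge S1; have S0 : 0 < S by lra.
have sN : s != 0 by rewrite gt_eqF.
have lN : l != 0 by rewrite gt_eqF.
have ls0 : 0 < l / s by rewrite divr_gt0.
have sl0 : 0 < s / l by rewrite divr_gt0.
have e0 : expR (e * s) * (2 + l / s) = expR (e * s) * (l / s * (1 + 2 * (s / l))).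
  by congr (_ * _); field; rewrite lN sN.
have p0 : 0 < 1 + 2 * (s / l) by lra.
apply/andP; split; last first.
  have : ln S <= ln (expR (e * s) * (l / s * (1 + 2 * (s / l)))).
    by rewrite ler_ln ?posrE -?e0// mulr_gt0 ?expR_gt0//; lra.
  have -> : ln (expR (e * s) * (l / s * (1 + 2 * (s / l)))) = e * s + (ln (l / s) + ln (1 + 2 * (s / l))).
    rewrite lnM ?posrE; [|exact: expR_gt0|exact: mulr_gt0].
    by rewrite expRK lnM ?posrE.
  by have := ln_le_sub1 _ p0; rewrite [1 + _ - 1]addrAC subrr add0r; lra.
have C0 : 0 < C by lra.
have ln0 : 0 <= ln (2 * C) by apply: ln_ge0; lra.
pose v := C / l * s; have v0 : 0 < v by rewrite mulr_gt0// divr_gt0.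
have -> : - (2 * (C / l) * (1 + ln (2 * C))) * s = - (2 * v) - 2 * v * ln (2 * C).
  by rewrite /v; ring.
have -> : ln S - ln (l / s) = ln (S * (s / l)).
  by rewrite -ln_div ?posrE// invf_div.
have q0 : 0 < S * (s / l) by exact: mulr_gt0.
have vln : 0 <= 2 * v * ln (2 * C) by apply: mulr_ge0 => //; lra.
have [v1|v1] := leP v (1 / 2).
  have h : 1 - v <= S * (s / l).
    have -> : 1 - v = (l - C * s) / s * (s / l) by rewrite /v; field; rewrite lN sN.
    by rewrite ler_pM2r.
  have v2 : 0 < 1 - v by lra.
  have : ln (1 - v) <= ln (S * (s / l)) by rewrite ler_ln.
  have : - (2 * v) <= 1 - (1 - v)^-1.
    rewrite lerBrDr -lerBrDl -[leLHS]mul1r ler_pdivrMr//.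
    have : 0 <= v * (1 - 2 * v) by rewrite mulr_ge0//; lra.
    lra.
  have := ln_ge_1subV _ v2; lra.
have h : (2 * C)^-1 <= S * (s / l).
  apply: (@le_trans _ _ (s / l)); last by rewrite ler_peMl// ltW.
  rewrite -[leLHS]mul1r ler_pdivrMr; last lra.
  by move: v1; rewrite /v; have -> : s / l * (2 * C) = 2 * (C / l * s); [ring|lra].
have : ln (2 * C)^-1 <= ln (S * (s / l)).
  by rewrite ler_ln// posrE invr_gt0 mulr_gt0.
rewrite lnV ?posrE; last by rewrite mulr_gt0.
have : 0 <= (2 * v - 1) * ln (2 * C) by rewrite mulr_ge0//; lra.
lra.
Qed.

(** The shift by 1/2 adds 1 to 2 k ln k, which completes the exponent 2k of 1/e in tau^2 to 2k +
    1. *)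
Lemma ln_half_shift k : (0 < k)%N ->
  2 * k%:R * ln k%:R + 1 - (4 * k%:R)^-1 <= 2 * k%:R * ln (b k) <= 2 * k%:R * ln k%:R + 1.
Proof.
move=> k0; have k1 : 0 < k%:R :> R by rewrite ltr0n.
have kN : k%:R != 0 :> R by rewrite gt_eqF.
pose x : R := (2 * k%:R)^-1; have x0 : 0 < x by rewrite invr_gt0 mulr_gt0.
have -> : b k = k%:R * (1 + x) by rewrite /x; field.
rewrite lnM ?posrE//; last by lra.
have h1 := ln1D_ge x (ltW x0).
have h2 : ln (1 + x) <= x by have := @ln_le_sub1 R (1 + x) ltac:(lra); lra.
have k2 : 0 <= 2 * k%:R :> R by rewrite mulr_ge0// ltW.
have := ler_wpM2l k2 h1; have := ler_wpM2l k2 h2.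
have -> : 2 * k%:R * x = 1 by rewrite /x mulfV// mulf_neq0.
have -> : 2 * k%:R * (x - x ^+ 2 / 2) = 1 - (4 * k%:R)^-1 by rewrite /x; field.
by move=> h3 h4; rewrite mulrDr; apply/andP; split; lra.
Qed.

(* s = b^(-1/3) and r = k^(1/6), so that s r^2 = (k/b)^(1/3) is close to 1. *)
Lemma scale_root_bounds k (s r : R) : (0 < k)%N -> 0 < s -> s ^+ 3 * b k = 1 -> 1 <= r ->
  r ^+ 6 = k%:R ->
  [/\ s <= r^-1, k%:R * s ^+ 4 <= r^-1, r ^+ 2 - r^-1 <= k%:R * s ^+ 2 <= r ^+ 2 &
     0 <= - ln s - 2 * ln r <= r^-1].
Proof.
move=> k0 s0 sb r1 rk; have r0 : 0 < r by lra.
have rN : r != 0 by rewrite gt_eqF.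
have k1 : 1 <= k%:R :> R by rewrite ler1n.
pose w := s * r ^+ 2; have w0 : 0 < w by rewrite mulr_gt0 ?exprn_gt0.
have w3b : w ^+ 3 * b k = k%:R.
  have -> : w ^+ 3 * b k = s ^+ 3 * b k * r ^+ 6 by rewrite /w; ring.
  by rewrite sb mul1r.
have w3 : w ^+ 3 = 1 - (2 * b k)^-1.
  have bN : b k != 0 by rewrite gt_eqF// b_gt0.
  apply: (mulIf bN); rewrite w3b mulrBl mul1r; move: bN; move: (k%:R) => x x0.
  by field; move: x0; apply: contra => /eqP h; apply/eqP; lra.
have r1' : r^-1 <= 1 by rewrite invf_le1.
have rV0 : 0 < r^-1 by rewrite invr_gt0.
have bV : (2 * b k)^-1 <= r^-1 ^+ 6.
  rewrite exprVn rk lef_pV2 ?posrE ?mulr_gt0 ?b_gt0//; lra.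
have w31 : w ^+ 3 <= 1.
  by rewrite w3 gerBl invr_ge0 mulr_ge0// ltW// b_gt0.
have w1 : w <= 1 by rewrite -(@ler_pXn2r _ 3) ?nnegrE ?(ltW w0)// expr1n.
(* The errors here are in fact at most r^-2; they are all weakened to r^-1 = k^(-1/6). *)
have rV6 n : (0 < n)%N -> r^-1 ^+ n <= r^-1.
  by case: n => // n _; rewrite exprS ler_piMr ?(ltW rV0)// exprn_ile1 ?(ltW rV0).
have es : s = w * r^-1 ^+ 2 by rewrite /w; field.
split.
- rewrite es; apply: le_trans (rV6 2 isT); rewrite ler_piMl ?exprn_ge0// ltW//.
- have -> : k%:R * s ^+ 4 = w ^+ 4 * r^-1 ^+ 2 by rewrite es -rk; field.
  apply: le_trans (rV6 2 isT); rewrite ler_piMl ?exprn_ge0 ?exprn_ile1 ?(ltW rV0) ?(ltW w0)//.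
- have -> : k%:R * s ^+ 2 = r ^+ 2 * w ^+ 2 by rewrite es -rk; field.
  have r2 : 0 < r ^+ 2 by rewrite exprn_gt0.
  apply/andP; split; last by rewrite ler_piMr ?(ltW r2)// exprn_ile1// ltW.
  have w23 : w ^+ 3 <= w ^+ 2 by rewrite exprS ler_piMl ?sqr_ge0.
  have : 1 - r^-1 ^+ 6 <= w ^+ 2 by lra.
  move=> h; have := ler_wpM2l (ltW r2) h.
  have -> : r ^+ 2 * (1 - r^-1 ^+ 6) = r ^+ 2 - r^-1 ^+ 4 by field.
  have := rV6 4 isT; lra.
have -> : - ln s - 2 * ln r = - ln w.
  by rewrite /w lnM ?posrE ?exprn_gt0// lnXn// -(mulr_natl (ln r)); ring.
have e3 : ln (w ^+ 3) = 3 * ln w by rewrite lnXn// mulr_natl.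
have l3 : ln (w ^+ 3) <= 0 by apply: ln_le0.
have := ln_ge_1subV _ (exprn_gt0 3 w0).
have -> : 1 - (w ^+ 3)^-1 = - (2 * k%:R)^-1.
  have bN : b k != 0 by rewrite gt_eqF// b_gt0.
  have -> : w ^+ 3 = k%:R / b k by apply: (mulIf bN); rewrite w3b divfK.
  by rewrite invf_div; field; rewrite gt_eqF//; lra.
have : (2 * k%:R)^-1 <= r^-1 ^+ 6.
  by rewrite exprVn rk lef_pV2 ?posrE ?mulr_gt0//; lra.
by have := rV6 6 isT; rewrite e3 in l3 *; move=> h1 h2 h3; apply/andP; split; lra.
Qed.

Lemma tau_star_modulus k (z : R) : 0 < z -> @besselB R k z = 0 ->
  (forall u, 0 <= u < z -> 0 < @besselB R k u) ->
  0 <= (tau_star k : R) /\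
  (tau_star k : R) ^+ 2 = modulus_coef k k / (z ^+ k * modulus_sum k z).
Proof.
move=> z0 Bz Bpos.
have e1 : k.+1%:R + 2^-1 = b k + 1 by rewrite -natr1; ring.
have e2 : k.+2%:R + 2^-1 = b k + 2 by rewrite -natr1 -natr1; ring.
have := tau_star_h01 k z z0; rewrite e1 e2 => h.
rewrite h//; last exact: besselQ_first_zero.
split; first exact: normr_ge0.
by rewrite -normrX ger0_norm ?sqr_ge0// h01_modulus ?(ltW z0)// modulus_poly_sum.
Qed.

(** 2 ln tau is the logarithm of c_k minus k ln z minus that of [modulus_sum]. The last is close to
    ln l - ln s, which gives 2 ln A - 2 ln r. A root [r] with [r ^+ 6 = k] keeps real powers out of
    the estimates. *)
Lemma tau_star_log : exists C, 0 <= C /\ forall k (r : R), (0 < k)%N -> 1 <= r -> r ^+ 6 = k%:R ->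
  0 < (tau_star k : R) /\
  `|2 * ln (tau_star k) - (2 * ln A_const + (2 * k%:R + 1) * (ln 2 - 1) - 2 * a_const * r ^+ 2 - 2 * ln r)|
    <= C / r.
Proof.
have [_ [_ aB _ _ _]] := @a_const_airyV R; have /andP[aB1 aB2] := aB.
have a1 : 1 <= (a_const : R) by lra.
have [Psi [l [[dPsi Psi_bounds Psi_le Psi_tail] [l0 A2 A0 _]]]] := @A_const_primitive R.
have lnA : 2 * ln A_const = - ln l :> R.
  by rewrite mulr_natl -lnXn// A2 lnV// posrE.
clear aB aB1 aB2.
move: (a_const : R) a1 dPsi (@bessel_first_zero_log R) => a a1 dPsi zero_log.
pose K := 16 * a ^+ 2 + 1; have K0 : 0 <= K by rewrite addr_ge0// mulr_ge0 ?sqr_ge0.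
pose D : R := 3 + 5 ^+ 5 * expR 1.
have D1 : 1 <= D.
  have : 0 <= 5 ^+ 5 * expR 1 :> R by rewrite mulr_ge0 ?expR_ge0 ?exprn_ge0.
  by rewrite /D; lra.
pose G := 2 * (D / l) * (1 + ln (2 * D)).
have G0 : 0 <= G.
  have : 0 <= ln (2 * D) by apply: ln_ge0; lra.
  by move=> h; rewrite !mulr_ge0 ?invr_ge0 ?(ltW l0)//; lra.
have lV : 0 <= 2 / l by rewrite divr_ge0 ?(ltW l0).
(* G and K + 1 + 2/l come from [ln_ratio_bound], K and 2 a from ln z; 5 covers the errors in ln c_k,
   ln b and ln s. *)
exists (G + (K + 1 + 2 / l) + K + 2 * a + 5); split; first lra.
move=> k r k0 r1 rk.
have k1 : 1 <= k%:R :> R by rewrite ler1n.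
have [s s0 sb] := exists_inv_cbrt _ (@b_gt0 R k).
have [z [z0 Bz Bpos zle zge]] := zero_log k k0 s s0 sb.
have [s_le ks4 /andP[ks2l ks2u] /andP[w1 w2]] := scale_root_bounds k s r k0 s0 sb r1 rk.
have Sle := modulus_sum_le k a s z K k0 a1 s0 sb z0 K0 zge Psi l dPsi Psi_bounds Psi_le.
have Sge := modulus_sum_ge k a s z k0 a1 s0 sb z0 zle Psi l dPsi Psi_bounds Psi_tail.
have S1 := modulus_sum_ge1 k z z0.
have S0 : 0 < modulus_sum k z := lt_le_trans ltr01 S1.
have /andP[X3l X3u] := ln_ratio_bound _ _ _ _ _ s0 l0 D1 Sle Sge S1.
clear Sle Sge.
rewrite -/G -/K in X3l X3u zge *.
clearbody G K; clear D D1.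
have X1 := @ln_modulus_coef R k k0.
have /andP[b1 b2] := ln_half_shift k k0.
have c0 := @modulus_coef_gt0 R k k (leqnn k).
have den0 : 0 < z ^+ k * modulus_sum k z by rewrite mulr_gt0// exprn_gt0.
have [tge t2] := tau_star_modulus k z z0 Bz Bpos.
have t0 : 0 < (tau_star k : R).
  rewrite lt_neqAle tge andbT eq_sym -sqrf_eq0 t2.
  by rewrite gt_eqF// divr_gt0.
split => //.
have lnt : 2 * ln (tau_star k) = ln (modulus_coef k k) - (k%:R * ln z + ln (modulus_sum k z)) :> R.
  rewrite [LHS]mulr_natl -lnXn// t2 ln_div ?posrE// lnM ?posrE ?exprn_gt0// lnXn//.
  by rewrite mulr_natl.
have kz1 := ler_wpM2l (ler0n R k) zle; have kz2 := ler_wpM2l (ler0n R k) zge.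
have r0 : 0 < r := lt_le_trans ltr01 r1.
have rk' : r <= k%:R by rewrite -rk exprS ler_peMr ?(ltW r0)// exprn_ege1.
have kg0 : 0 < k%:R :> R := lt_le_trans ltr01 k1.
have X0 : (2 * k%:R)^-1 <= r^-1.
  by rewrite lef_pV2 ?posrE ?mulr_gt0// (le_trans rk')// ler_peMl ?ler1n// ltW.
have X0' : (4 * k%:R)^-1 <= r^-1.
  by rewrite lef_pV2 ?posrE ?mulr_gt0// (le_trans rk')// ler_peMl ?ler1n// ltW.
have e1 : ln (l / s) = ln l - ln s by rewrite ln_div.
have rV0 : 0 < r^-1 by rewrite invr_gt0.
have a0 : 0 <= a := le_trans ler01 a1.
rewrite lnt lnA; move: X1; rewrite !ler_norml => /andP[X1l X1u].
have Gs : G * s <= G * r^-1 by rewrite ler_wpM2l.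
have Es : (K + 1 + 2 / l) * s <= (K + 1 + 2 / l) * r^-1 by rewrite ler_wpM2l ?addr_ge0.
have Ks : K * (k%:R * s ^+ 4) <= K * r^-1 by rewrite ler_wpM2l.
have as1 : a * (r ^+ 2 - r^-1) <= a * (k%:R * s ^+ 2) by rewrite ler_wpM2l.
have as2 : a * (k%:R * s ^+ 2) <= a * r ^+ 2 by rewrite ler_wpM2l.
have Gr : 0 <= G / r by rewrite mulr_ge0 ?(ltW rV0).
have Kr : 0 <= K / r by rewrite mulr_ge0 ?(ltW rV0).
have ar : 0 <= a / r by rewrite mulr_ge0 ?(ltW rV0).
have lr : 0 <= 2 / l / r by rewrite mulr_ge0 ?(ltW rV0).
move: X1l X1u X3l X3u; rewrite e1.
move: (ln (modulus_coef k k)) (ln (modulus_sum k z)) (ln z) (ln s) (ln r) (ln 2) (ln l)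
  (ln (k%:R + 2^-1)) (ln k%:R) kz1 kz2 b1 b2 w1 w2 => x1 x2 x3 x4 x5 x6 x7 x8 x9.
move=> kz1 kz2 b1 b2 w1 w2 X1l X1u X3l X3u.
by apply/andP; split; lra.
Qed.

End Assembly.

(** Writes the large literals of the statement through small ones, for [lra]. *)
Lemma natr_dec (R : realType) (n d c e : nat) : n = (d * c + e)%N ->
  n%:R = d%:R * c%:R + e%:R :> R.
Proof. by move=> ->; rewrite natrD natrM. Qed.

Theorem theorem1p7 (R : realType) :
  (exists C : R, forall k : nat, (1 <= k)%N ->
     exists eps : R,
       `|eps| <= C * k%:R `^ (- (1 / 6%:R)) /\
       tau_star k =
         A_const * (2%:R / expR 1) `^ (k%:R + 1 / 2%:R)
         * expR (- a_const * k%:R `^ (1 / 3%:R))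
         * k%:R `^ (- (1 / 6%:R)) * (1 + eps)) /\
  `|(a_const : R) - 18558%:R / 10000%:R| <= 5%:R / 100000%:R /\
  `|(A_const : R) - 13951%:R / 10000%:R| <= 5%:R / 100000%:R.
Proof.
split; last first.
  have [_ [_ aB _ _ _]] := @a_const_airyV R.
  have [_ [_ [_ [_ _ _ AB]]]] := @A_const_primitive R.
  have e10 : 10000%:R = 100 * 100 :> R.
    by rewrite (natr_dec R 10000 100 100 0) ?addr0//; vm_compute.
  have e100 : 100000%:R = 10 * (100 * 100) :> R.
    by rewrite (natr_dec R 100000 10 10000 0) ?addr0 ?e10//; vm_compute.
  rewrite (natr_dec R 18558 185 100 58); last by vm_compute.
  rewrite (natr_dec R 13951 139 100 51); last by vm_compute.
  by rewrite e10 e100 !ler_distl; split; apply/andP; split; lra.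
have A0 : 0 < (A_const : R) by have [Psi [l [_ []]]] := @A_const_primitive R.
have [C [C0 hC]] := @tau_star_log R.
(* With E the error in ln tau, |e^E - 1| <= |E| e^|E| and |E| <= C/r <= C. *)
exists (C * expR C) => k k0.
have k1 : 1 <= k%:R :> R by rewrite ler1n.
have kg0 : 0 < k%:R :> R by lra.
pose r : R := k%:R `^ (1 / 6%:R).
have rg0 : 0 < r by rewrite powR_gt0.
have rk : r ^+ 6 = k%:R.
  rewrite -powR_mulrn ?(ltW rg0)// /r -powRrM (_ : 1 / 6%:R * 6%:R = 1 :> R); last by field.
  by rewrite powRr1// ltW.
have r1 : 1 <= r.
  by rewrite -(@ler_pXn2r _ 6) ?nnegrE ?(ltW rg0)// expr1n rk.
have r2 : k%:R `^ (1 / 3%:R) = r ^+ 2.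
  by rewrite -powR_mulrn ?(ltW rg0)// /r -powRrM; congr (_ `^ _); field.
have rV : k%:R `^ (- (1 / 6%:R)) = r^-1 by rewrite powRN.
have [t0 hE] := hC k r k0 r1 rk.
rewrite r2 rV.
set F := A_const * _ * _ * _.
have q0 : 0 < 2%:R / expR 1 :> R by rewrite divr_gt0 ?expR_gt0.
have p0 : 0 < (2%:R / expR 1 : R) `^ (k%:R + 1 / 2%:R) by rewrite powR_gt0.
have F0 : 0 < F by rewrite !mulr_gt0 ?expR_gt0 ?invr_gt0.
pose E := ln (tau_star k) - ln F.
have lnF : 2 * ln F = 2 * ln A_const + (2 * k%:R + 1) * (ln 2 - 1) - 2 * a_const * r ^+ 2 - 2 * ln r.
  rewrite /F lnM ?posrE ?invr_gt0 ?mulr_gt0 ?expR_gt0// lnM ?posrE ?mulr_gt0 ?expR_gt0//.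
  rewrite lnM ?posrE// expRK ln_powR ln_div ?posrE ?expR_gt0// expRK lnV ?posrE//.
  by move: (ln _) (ln _) (ln _) => x y w; field.
have hE2 : `|E| <= C / r.
  have : `|2 * E| <= C / r by rewrite /E mulrBr lnF.
  by rewrite normrM (@ger0_norm _ 2)//; have := normr_ge0 E; lra.
have CrC : C / r <= C by rewrite ler_pdivrMr// ler_peMr.
exists (expR E - 1); split.
  apply: le_trans (expR_sub1_norm E) _.
  rewrite mulrAC; apply: ler_pM => //.
  by rewrite ler_expR; exact: le_trans hE2 CrC.
by rewrite addrC subrK /E expRB !lnK ?posrE// mulrC divfK// gt_eqF.
Qed.
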